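(* Let $(X,\Gamma)$ be a Euclidean building with chambers missing of type $\tilde A_2$, and let $(X,\Gamma)\leadsto (X',\Gamma')$ be an extension into a Euclidean building $X'$ of type $\tilde A_2$ such that any two missing chambers of $X'$ lying in distinct $\Gamma'$-orbits are at distance at least 2. Then $(X,\Gamma)\leadsto(X',\Gamma')$ is, up to isomorphism of extensions, the unique extension of $(X,\Gamma)$ into a Euclidean building of type $\tilde A_2$.
   Context: Building with chambers missing: let $X$ be a simplicial complex and $\Gamma$ a countable group of automorphisms of $X$ acting freely with finite fundamental domain. $(X,\Gamma)$ is a building with chambers missing if there exist a Tits building $X'$, a group $\Gamma'$ of automorphisms of $X'$ acting freely with finite fundamental domain, a simplicial map $\lambda:X\to X'$, and chambers $C_1,\dots,C_n$ of $X'$ such that: (a) $\Gamma' C_i\neq \Gamma' C_j$ for $i\ne j$ and $\lambda(X)\cap \overset{\circ}{C_i}=\emptyset$ for all $i$; (b) $\lambda(X)\cup \Gamma'\overset{\circ}{C_1}\cup\dots\cup\Gamma'\overset{\circ}{C_n}=X'$; (c) for all $x,y\in X$, $x,y$ are in the same $\Gamma$-orbit if and only if $\lambda(x),\lambda(y)$ are in the same $\Gamma'$-orbit. It is assumed that $X$ has no boundary and is of homogeneous dimension $\dim X'$. Such a map $\lambda$ is called an extension of $(X,\Gamma)$, written $\lambda:(X,\Gamma)\leadsto(X',\Gamma')$. A missing chamber of $\lambda$ is a chamber of $X'$ not contained in $\lambda(X)$. $(X,\Gamma)$ is Euclidean if $X$ is simply connected and there is an extension with $X'$ a Euclidean building;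 it is of type $\tilde A_2$ if there is an extension with $X'$ of type $\tilde A_2$ (so $\dim X=2$). Two extensions $\lambda_0:(X_0,\Gamma_0)\leadsto(X_0',\Gamma_0')$ and $\lambda_1:(X_1,\Gamma_1)\leadsto(X_1',\Gamma_1')$ are isomorphic if there are equivariant isomorphisms $\theta:X_0\to X_1$ and $\theta':X_0'\to X_1'$ with $\theta'\circ\lambda_0=\lambda_1\circ\theta$. The distance between two chambers of $X'$ is the minimal number of edges of a path in the 1-skeleton of $X'$ joining a vertex of one to a vertex of the other. *)

(* Defs.v *)
From HB Require Import structures.
From mathcomp Require Import all_boot all_order all_algebra.
From mathcomp Require Import mathcomp_extra boolp classical_sets functions.
From mathcomp Require Import cardinality fsbigop set_interval reals.
From mathcomp Require Import topology normedtype.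

Set Implicit Arguments.
Unset Strict Implicit.
Unset Printing Implicit Defensive.

Import Order.TTheory GRing.Theory Num.Theory.
Import numFieldNormedType.Exports.
Local Open Scope classical_set_scope.
Local Open Scope card_scope.
Local Open Scope ring_scope.

(** * Simplicial complexes *)

Record complex (V : choiceType) := Complex {
  face : set (set V);
  face_finite : forall s, face s -> finite_set s;
  face_neq0 : forall s, face s -> s !=set0;
  face_sub : forall s t, face s -> t `<=` s -> t !=set0 -> face t;
  face_vertex : forall v, face [set v]
}.

Definition simplicial (V V' : choiceType) (X : complex V) (X' : complex V')
    (f : V -> V') :=
  forall s, face X s -> face X' (f @` s).

Definition complex_iso (V V' : choiceType) (X : complex V) (X' : complex V')
    (f : V -> V') :=
  bijective f /\ forall s, face X s <-> face X' (f @` s).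

Definition chamber (V : choiceType) (X : complex V) (C : set V) :=
  face X C /\ forall s, face X s -> C `<=` s -> s = C.

Definition homogeneous_dim (V : choiceType) (X : complex V) (d : nat) :=
  forall s, face X s -> s #<= `I_d.+1 /\
    exists C, [/\ face X C, s `<=` C & C #= `I_d.+1].

(* Every simplex of codimension 1 lies in at least two chambers. *)
Definition no_boundary (V : choiceType) (X : complex V) (d : nat) :=
  forall s, face X s -> s #= `I_d ->
    exists C D, [/\ C <> D, chamber X C, chamber X D, s `<=` C & s `<=` D].

Definition joined_by (V : choiceType) (X : complex V) (A B : set V) (n : nat) :=
  exists w : nat -> V, [/\ A (w 0%N), B (w n) &
    forall i, (i < n)%N -> w i <> w i.+1 /\ face X [set w i; w i.+1]].

(* [n] is the distance; when no path exists the distance is infinite, and no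
   [n] satisfies this predicate. *)
Definition is_distance (V : choiceType) (X : complex V) (A B : set V)
    (n : nat) :=
  joined_by X A B n /\ forall m, joined_by X A B m -> (n <= m)%N.

(** * Geometric realization *)

Section Realization.
Context (R : realType) (V : choiceType) (X : complex V).

Definition support (p : V -> R) : set V := [set v | p v <> 0].

(* Barycentric coordinates. *)
Definition points : set (V -> R) :=
  [set p | [/\ forall v, 0 <= p v, face X (support p)
             & \sum_(v \in support p) p v = 1]].

Definition closed_simplex (s : set V) : set (V -> R) :=
  points `&` [set p | support p `<=` s].

Definition open_simplex (s : set V) : set (V -> R) :=
  points `&` [set p | support p = s].

Definition realization := {p : V -> R | points p}.

HB.instance Definition _ := gen_eqMixin realization.
HB.instance Definition _ := gen_choiceMixin realization.

(* The coherent (CW) topology: a set is open iff its trace on every closed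
   simplex is open for the Euclidean topology of that simplex. *)
Definition realization_open (U : set realization) :=
  forall s, face X s -> forall p, U p -> support (sval p) `<=` s ->
    exists2 e : R, 0 < e & forall q : realization, support (sval q) `<=` s ->
      (forall v, s v -> `|sval p v - sval q v| < e) -> U q.

Lemma realization_openT : realization_open setT.
Proof. by move=> s _ p _ _; exists 1. Qed.

Lemma realization_openI : setI_closed realization_open.
Proof.
move=> U W oU oW s Xs p [Up Wp] sp.
have [e e0 eU] := oU s Xs p Up sp; have [d d0 dW] := oW s Xs p Wp sp.
exists (Num.min e d); first by rewrite lt_min e0.
move=> q sq pq; split; [apply: eU|apply: dW] => // v sv;
  by have := pq v sv; rewrite lt_min => /andP[].
Qed.

Lemma realization_open_bigcup (I : Type) (f : I -> set realization) :
  (forall i, realization_open (f i)) -> realization_open (\bigcup_i f i).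
Proof.
move=> of_ s Xs p [i _ fip] sp.
have [e e0 ef] := of_ i s Xs p fip sp.
by exists e => // q sq pq; exists i => //; exact: ef.
Qed.

HB.instance Definition _ := isOpenTopological.Build realization
  realization_openT realization_openI realization_open_bigcup.

Definition path_connected :=
  forall x y : realization, exists g : R -> realization,
    [/\ {within `[0, 1]%classic, continuous g}, g 0 = x & g 1 = y].

Definition loops_contractible :=
  forall g : R -> realization, {within `[0, 1]%classic, continuous g} -> g 0 = g 1 ->
  exists H : R * R -> realization,
    [/\ {within `[0, 1]%classic `*` `[0, 1]%classic, continuous H},
        forall t, `[0, 1]%classic t -> H (0, t) = g t,
        forall t, `[0, 1]%classic t -> H (1, t) = g 0 &
        forall u, `[0, 1]%classic u -> H (u, 0) = g 0 /\ H (u, 1) = g 0].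

Definition simply_connected :=
  [/\ points !=set0, path_connected & loops_contractible].

End Realization.

(* The map induced on barycentric coordinates by a map of vertices. *)
Definition affine_map (R : realType) (V V' : choiceType) (f : V -> V')
    (p : V -> R) : V' -> R :=
  fun v' => \sum_(v \in f @^-1` [set v']) p v.

(** * Groups of automorphisms *)

(* An automorphism is determined by its action on vertices, so a group of
   automorphisms is represented by a set of self-maps of [V]. *)
Record automorphism_group (V : choiceType) (X : complex V)
    (G : set (V -> V)) : Prop := {
  aut_id : G id;
  aut_comp : forall g h, G g -> G h -> G (g \o h);
  aut_inv : forall g, G g -> exists h, [/\ G h, cancel g h & cancel h g];
  aut_iso : forall g, G g -> complex_iso X X g
}.

(* Freeness is required on points, not only on vertices: a nontrivial element
   cannot permute the vertices of a simplex. *)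
Definition acts_freely (R : realType) (V : choiceType) (X : complex V)
    (G : set (V -> V)) :=
  forall g (p : V -> R), G g -> points X p -> affine_map g p = p -> g = id.

Definition finite_fundamental_domain (V : choiceType) (X : complex V)
    (G : set (V -> V)) :=
  exists F : set (set V), [/\ finite_set F, F `<=` face X &
    forall s, face X s -> exists! t, F t /\ exists2 g, G g & g @` t = s].

Definition free_cofinite_group (R : realType) (V : choiceType) (X : complex V)
    (G : set (V -> V)) :=
  [/\ automorphism_group X G, acts_freely R X G & finite_fundamental_domain X G].

Definition same_orbit (R : realType) (V : choiceType) (G : set (V -> V))
    (p q : V -> R) :=
  exists2 g, G g & affine_map g p = q.

Definition face_orbit (V : choiceType) (G : set (V -> V)) (s : set V) :
    set (set V) :=
  [set g @` s | g in G].

(** * Coxeter complexes *)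

(* The value 0 stands for an infinite order. *)
Definition coxeter_matrix (I : finType) (M : I -> I -> nat) :=
  [/\ forall i, M i i = 1%N, forall i j, M i j = M j i
    & forall i j, i <> j -> M i j <> 1%N].

Section CoxeterComplex.
Context (I : finType) (M : I -> I -> nat).

(* Elements of the Coxeter group W are words in the generators up to the
   congruence generated by (i j)^(M i j) = 1; since M i i = 1, every generator
   is an involution, so no inverse letters are needed. *)
Inductive coxeter_eq : seq I -> seq I -> Prop :=
| coxeter_refl u : coxeter_eq u u
| coxeter_sym u v : coxeter_eq u v -> coxeter_eq v u
| coxeter_trans u v w : coxeter_eq u v -> coxeter_eq v w -> coxeter_eq u w
| coxeter_rel u v i j :
    coxeter_eq (u ++ flatten (nseq (M i j) [:: i; j]) ++ v) (u ++ v).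

(* The maximal proper special coset w W_(I \ {i}), as a saturated set of
   words. *)
Definition special_coset (w : seq I) (i : I) : set (seq I) :=
  [set u | exists2 x, i \notin x & coxeter_eq u (w ++ x)].

Definition coxeter_vertex :=
  {c : set (seq I) | exists w i, c = special_coset w i}.

HB.instance Definition _ := gen_eqMixin coxeter_vertex.
HB.instance Definition _ := gen_choiceMixin coxeter_vertex.

Definition coxeter_chamber (w : seq I) : set coxeter_vertex :=
  [set c | exists i, sval c = special_coset w i].

Definition coxeter_face : set (set coxeter_vertex) :=
  [set s | s !=set0 /\ exists w, s `<=` coxeter_chamber w].

Lemma coxeter_face_finite s : coxeter_face s -> finite_set s.
Proof.
case=> _ [w sw]; apply: sub_finite_set sw _.
pose f i : coxeter_vertex :=
  exist _ (special_coset w i) (ex_intro _ w (ex_intro _ i erefl)).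
apply: (@sub_finite_set _ _ (range f)); last exact/finite_image/finite_finset.
move=> [c cP] [i /= ci]; exists i => //.
by apply: eq_exist; rewrite ci.
Qed.

Lemma coxeter_face_neq0 s : coxeter_face s -> s !=set0.
Proof. by case. Qed.

Lemma coxeter_face_sub s t :
  coxeter_face s -> t `<=` s -> t !=set0 -> coxeter_face t.
Proof.
by move=> [_ [w sw]] ts t0; split=> //; exists w; exact: subset_trans sw.
Qed.

Lemma coxeter_face_vertex v : coxeter_face [set v].
Proof.
case: v => c cP; split; first by exists (exist _ c cP).
by case: (cP) => w [i ci]; exists w => _ ->; exists i.
Qed.

Definition coxeter_complex : complex coxeter_vertex :=
  Complex coxeter_face_finite coxeter_face_neq0 coxeter_face_sub
    coxeter_face_vertex.

End CoxeterComplex.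

(** * Buildings *)

(* Subcomplexes are given by their sets of faces. [f] is an isomorphism from
   the subcomplex [A] onto the subcomplex [B]. *)
Definition subcomplex_iso (V W : choiceType) (A : set (set V))
    (B : set (set W)) (f : V -> W) :=
  set_inj (\bigcup_(s in A) s) f /\ B = [set f @` s | s in A].

(* Neither thickness nor completeness of the apartment system is required. *)
Definition building_of_type (I : finType) (M : I -> I -> nat) (V : choiceType)
    (X : complex V) :=
  coxeter_matrix M /\
  exists apartments : set (set (set V)),
  [/\ apartments !=set0,
      forall A, apartments A -> A `<=` face X /\
        exists f, subcomplex_iso (face (coxeter_complex M)) A f,
      forall s t, face X s -> face X t ->
        exists A, [/\ apartments A, A s & A t]
    & forall A B s t, apartments A -> apartments B ->
        A s -> A t -> B s -> B t ->
        exists f, subcomplex_iso A B f /\ forall v, (s `|` t) v -> f v = v].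

Definition Tits_building (V : choiceType) (X : complex V) :=
  exists (I : finType) (M : I -> I -> nat), building_of_type M X.

Definition A2tilde (i j : 'I_3) : nat := if i == j then 1%N else 3%N.

(** * Buildings with chambers missing *)

Record extension (R : realType) (V V' : choiceType)
    (X : complex V) (G : set (V -> V)) (X' : complex V') (G' : set (V' -> V'))
    (lambda : V -> V') : Prop := {
  ext_countable : countable G;
  ext_group : free_cofinite_group R X G;
  ext_building : Tits_building X';
  ext_group' : free_cofinite_group R X' G';
  ext_simplicial : simplicial X X' lambda;
  ext_chambers : let lambdaX := affine_map lambda @` @points R V X in
    exists (n : nat) (C : 'I_n -> set V'),
    [/\ forall i, chamber X' (C i),
        forall i j, i <> j -> face_orbit G' (C i) <> face_orbit G' (C j),
        forall i, lambdaX `&` open_simplex X' (C i) = set0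
      & lambdaX `|` \bigcup_i
          [set affine_map g p | g in G' & p in open_simplex X' (C i)]
        = points X'];
  ext_orbit : forall x y : V -> R, points X x -> points X y ->
    same_orbit G x y <->
    same_orbit G' (affine_map lambda x) (affine_map lambda y);
  ext_dim : exists d, [/\ homogeneous_dim X' d, homogeneous_dim X d
                        & no_boundary X d]
}.

Definition missing_chamber (R : realType) (V V' : choiceType) (X : complex V)
    (X' : complex V') (lambda : V -> V') (C : set V') :=
  chamber X' C /\
  ~ (@closed_simplex R V' X' C `<=` affine_map lambda @` @points R V X).

(* A building of type A2tilde is in particular Euclidean. *)
Definition euclidean_missing_A2tilde (R : realType) (V : choiceType)
    (X : complex V) (G : set (V -> V)) :=
  simply_connected R X /\
  exists (V' : choiceType) (X' : complex V') (G' : set (V' -> V'))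
    (lambda : V -> V'),
    extension R X G X' G' lambda /\ building_of_type A2tilde X'.

(* Equivariance is with respect to some isomorphism of the two groups, which,
   when [f] is bijective, is necessarily conjugation by [f]. *)
Definition equivariant (V W : choiceType) (G : set (V -> V))
    (H : set (W -> W)) (f : V -> W) :=
  (forall g, G g -> exists2 h, H h & f \o g = h \o f) /\
  (forall h, H h -> exists2 g, G g & f \o g = h \o f).

Definition isomorphic_extensions (V0 V0' V1 V1' : choiceType)
    (X0 : complex V0) (G0 : set (V0 -> V0))
    (X0' : complex V0') (G0' : set (V0' -> V0')) (lambda0 : V0 -> V0')
    (X1 : complex V1) (G1 : set (V1 -> V1))
    (X1' : complex V1') (G1' : set (V1' -> V1')) (lambda1 : V1 -> V1') :=
  exists (theta : V0 -> V1) (theta' : V0' -> V1'),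
  [/\ complex_iso X0 X1 theta /\ equivariant G0 G1 theta,
      complex_iso X0' X1' theta' /\ equivariant G0' G1' theta'
    & theta' \o lambda0 = lambda1 \o theta].

(* Main.v *)
(* A vertex link of an A2tilde building is a generalized triangle, and the link L
   of a vertex of X is such a triangle A with missing flags. Missing chambers
   sharing a vertex lie in one orbit, so by freeness A has at most three missing
   flags, and L determines A: a flag (x, m) of another completion B forces, for
   every point y of m in A, one of (y, m), (y, xy), (x, xy) to be missing, which
   leaves only m with three points, and a second new flag then gives a
   contradiction. Hence both extensions have the same missing corners.

   An extension is a covering of its image, so the theorem says that two vertices
   have the same image under lambda iff they have the same image under mu. The
   1-skeleton of a building is simply connected modulo its triangles: a vertex has
   one or two (adjacent) neighbours nearer to a given vertex, which allows to compare
   geodesics. So it is enough that the boundary of a missing chamber of one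
   extension closes up in the other. By freeness some edge of it lies in no
   other missing chamber, and the corners at the two ends of this edge force the
   boundary path to close up after three steps. *)
Require Import Defs.
From mathcomp Require Import all_boot all_order all_algebra.
From mathcomp Require Import boolp classical_sets functions.
From mathcomp Require Import cardinality fsbigop reals.
From mathcomp Require Import topology normedtype.
From mathcomp Require Import zify lra.
From Stdlib Require Setoid Morphisms.

Set Implicit Arguments.
Unset Strict Implicit.
Unset Printing Implicit Defensive.

Import Order.TTheory GRing.Theory Num.Theory.
Import numFieldNormedType.Exports.
Local Open Scope classical_set_scope.

(** * Links of vertices *)

(** Condition (c) of an extension speaks of points, and its combinatorial content is extracted by
    testing points whose barycentric coordinates are all distinct: an element carrying one such
    point to another is prescribed on every vertex. With freeness, this makes [lam] injective on
    faces and around each vertex, and its fibres orbits of deck transformations, so that the links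
    of both extensions become relations on the same set of neighbours in [X].

    Apartments are given by words modulo the Coxeter relations. Before they can be replaced by the
    triangular lattice, where local statements become finite checks or integer arithmetic, the word
    problem of the affine Weyl group has to be solved.

    The distance hypothesis concerns [X'] only, so the two extensions do not play symmetric roles:
    the number of flags missing from a link of [X''] is not bounded in advance, and the closing of
    triangles of [X''] is deduced from that of triangles of [X']. *)

Lemma bool_neq_neq (b1 b2 b3 : bool) : b1 <> b2 -> b2 <> b3 -> b1 = b3.
Proof. by case: b1 b2 b3 => [] [] []. Qed.

(** The incidence graph of a possibly degenerate projective plane: [N] holds points and lines alike,
    so [gt_join] and [gt_uniq] serve at once for joining points and for intersecting lines. *)
Record gen_triangle (T : Type) (N : T -> Prop) (A : T -> T -> Prop)
    (t : T -> bool) : Prop := {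
  gt_sym : forall x y, A x y -> A y x;
  gt_dom : forall x y, A x y -> N x;
  gt_type : forall x y, A x y -> t x <> t y;
  gt_join : forall x y, N x -> N y -> x <> y -> t x = t y ->
    exists z, A x z /\ A y z;
  gt_uniq : forall x y z w, x <> y -> A x z -> A y z -> A x w -> A y w -> z = w
}.

Section Links.
Context (T : Type) (N : T -> Prop) (L A B : T -> T -> Prop) (t s : T -> bool).
Hypotheses (gA : gen_triangle N A t) (gB : gen_triangle N B s).
Hypotheses (LA : forall x y, L x y -> A x y) (LB : forall x y, L x y -> B x y).
Hypothesis L_sym : forall x y, L x y -> L y x.
Hypothesis L_deg : forall x, N x -> exists y z, [/\ y <> z, L x y & L x z].

Let M x y := A x y /\ ~ L x y.

(* At most three missing edges, each listed from its end of a given type. *)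
Hypothesis M_four : forall p1 l1 p2 l2 p3 l3 p4 l4,
  M p1 l1 -> M p2 l2 -> M p3 l3 -> M p4 l4 ->
  t p1 = t p2 -> t p1 = t p3 -> t p1 = t p4 ->
  [\/ (p1, l1) = (p2, l2) \/ (p1, l1) = (p3, l3),
      (p1, l1) = (p4, l4) \/ (p2, l2) = (p3, l3)
    | (p2, l2) = (p4, l4) \/ (p3, l3) = (p4, l4)].

Let As := gt_sym gA.
Let Bs := gt_sym gB.

Lemma A_mid x y z : A x z -> A y z -> t x = t y.
Proof.
move=> /(gt_type gA) h /(gt_type gA) k.
by case: (t x) (t y) (t z) h k => [] [] [].
Qed.

Lemma B_mid x y z : B x z -> B y z -> s x = s y.
Proof.
move=> /(gt_type gB) h /(gt_type gB) k.
by case: (s x) (s y) (s z) h k => [] [] [].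
Qed.

Lemma A_opp x y z : A x y -> t y <> t z -> t x = t z.
Proof.
move=> /(gt_type gA) h k.
by case: (t x) (t y) (t z) h k => [] [] [].
Qed.

Lemma L_or_M x y : A x y -> L x y \/ M x y.
Proof. by move=> a; case: (pselect (L x y)); [left|right]. Qed.

Definition three_nbrs x :=
  exists a b c, [/\ A x a, A x b, A x c & [/\ a <> b, a <> c & b <> c]].

(** Projection from [l] to [x]: two neighbours of [l] with the same join to [x] would force this
    join to be [l], which is not incident with [x]. *)
Lemma three_nbrs_project l x : N x -> ~ A x l -> t x <> t l ->
  three_nbrs l -> three_nbrs x.
Proof.
move=> Nx xl tx [a [b [c [la lb lc [ab ac bc]]]]].
have proj d : A l d -> exists k, A x k /\ A d k.
  move=> ld; apply: (gt_join gA) => //.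
  - exact: (gt_dom gA (As ld)).
  - by move=> xd; apply: xl; rewrite xd; exact: As.
  - by rewrite -(A_opp (As ld) (fun e => tx (esym e))).
have [ka [xka aka]] := proj a la; have [kb [xkb bkb]] := proj b lb.
have [kc [xkc ckc]] := proj c lc.
have neq d e kd ke : A l d -> A l e -> A x kd -> A d kd -> A x ke -> A e ke ->
    d <> e -> kd <> ke.
  move=> ld le xd dd xe ee de kde; subst ke; apply: xl.
  by rewrite (gt_uniq gA de (As ld) (As le) dd ee).
by exists ka, kb, kc; split=> //; split; eauto.
Qed.

(** If [x] lies off [l], one projection suffices. If [x] lies on [l], two projections are made
    through a line [n] that meets [l] in a third point. *)
Lemma three_nbrs_same p l x : A p l -> three_nbrs p -> three_nbrs l ->
  N x -> t x = t p -> three_nbrs x.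
Proof.
move=> pl p3 l3 Nx txp.
have [->//|xp] := EM (x = p).
case: (EM (A x l)) => xl; last first.
  by apply: three_nbrs_project l3 => // e; apply: (gt_type gA pl); rewrite -txp.
have [r [lr [rp rx]]] : exists r, A l r /\ (r <> p /\ r <> x).
  case: l3 => a [b [c [la lb lc [ab ac bc]]]].
  have [ap|ap] := EM (a = p); have [ax|ax] := EM (a = x);
  have [bp|bp] := EM (b = p); have [bx|bx] := EM (b = x);
  have [cp|cp] := EM (c = p); have [cx|cx] := EM (c = x);
  first [by exists a|by exists b|by exists c|by exfalso; congruence].
have [n [rn nl]] : exists n, A r n /\ n <> l.
  have [y [z [yz ry rz]]] := L_deg (gt_dom gA (As lr)).
  have [yl|yl] := EM (y = l); last by exists y; split => //; exact: LA.
  by exists z; split; [exact: LA|congruence].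
have off q : A q l -> q <> r -> ~ A q n.
  by move=> ql qr qn; apply: nl; exact: (gt_uniq gA qr qn rn ql (As lr)).
have tn : t n <> t p.
  by rewrite (A_mid pl (As lr)); apply: (gt_type gA); exact: As.
have n3 : three_nbrs n.
  apply: (three_nbrs_project (gt_dom gA (As rn)) _ tn p3).
  by move=> np; apply: (off p pl) => [e|]; [exact: rp|exact: As].
apply: (three_nbrs_project Nx _ _ n3).
  by apply: off => // e; exact: rx.
by rewrite txp => e; exact: tn.
Qed.

Lemma M_sym x y : M x y -> M y x.
Proof. by move=> [a l]; split; [exact: As|move=> /L_sym]. Qed.

Lemma M_three p l : M p l -> three_nbrs p.
Proof.
move=> [pl npl]; have [y [z [yz py pz]]] := L_deg (gt_dom gA pl).
exists l, y, z; split; [by []|exact: LA|exact: LA|split=> //].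
  by move=> e; apply: npl; rewrite e.
by move=> e; apply: npl; rewrite e.
Qed.

(** A missing flag gives both its ends a third neighbour beside two in [L], and projections spread
    this over the whole plane. *)
Lemma thick p l x : M p l -> N x -> three_nbrs x.
Proof.
move=> pl Nx; have p3 := M_three pl; have l3 := M_three (M_sym pl).
have Apl := pl.1.
have [e|e] := EM (t x = t p); first exact: three_nbrs_same Apl p3 l3 Nx e.
apply: (three_nbrs_same (As Apl) l3 p3 Nx).
by move: (gt_type gA Apl) e; case: (t x) (t p) (t l) => [] [] [].
Qed.

Lemma other_nbr l p : N l -> exists r, L l r /\ r <> p.
Proof.
move=> /L_deg[y [z [yz ly lz]]].
by have [e|e] := EM (y = p); [exists z; split=> // e'; apply: yz; rewrite e e'
  |exists y].
Qed.

(* Two vertices of the same type are joined in [A] by too many edge-disjoint paths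
   of length 2 and 4 for three missing edges to cut all of them. *)
Lemma same_type_missing x y k0 : x <> y -> A x k0 -> A y k0 -> N x -> N y ->
  t x = t y -> ~ L x k0 -> s x = s y.
Proof.
move=> xy xk yk Nx Ny txy nL.
apply: contrapT => sxy.
have [k1 [k2 [k12 xk1 xk2]]] := L_deg Nx.
have kne k : L x k -> k <> k0 by move=> lk e; apply: nL; rewrite -e.
(* If both flags at the meeting point [z] were in [L], the path [x], [k], [z], [k'], [y] would lie
   in [B] and give [s x = s y]. *)
have path k k' : L x k -> L y k' -> k' <> k0 ->
    exists z, [/\ A z k, A z k' & M z k \/ M z k'].
  move=> lk lk' k'0.
  have kk' : k <> k'.
    move=> e; subst k'; apply: (kne k lk).
    exact: (gt_uniq gA xy (LA lk) (LA lk') xk yk).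
  have tk : t k = t k'.
    move: (gt_type gA (LA lk)) (gt_type gA (LA lk')); rewrite -txy.
    by case: (t x) (t k) (t k') => [] [] [].
  have [z [zk zk']] := gt_join gA (gt_dom gA (As (LA lk)))
    (gt_dom gA (As (LA lk'))) kk' tk.
  exists z; split; [exact: As|exact: As|].
  case: (L_or_M (As zk)) => [l1|]; last by left.
  case: (L_or_M (As zk')) => [l2|]; last by right.
  by exfalso; apply: sxy; rewrite (B_mid (LB lk) (LB l1)) (B_mid (LB lk') (LB l2)).
have [k' [yk' k'0]] := other_nbr k0 Ny.
have M0 : M x k0 by [].
have offy k z : L x k -> A z k -> y <> z.
  move=> lk zk e; apply: (kne k lk); rewrite -e in zk.
  exact: (gt_uniq gA xy (LA lk) zk xk yk).
have offx k z : L y k -> k <> k0 -> A z k -> x <> z.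
  move=> lk kk zk e; apply: kk; rewrite -e in zk.
  exact: (gt_uniq gA xy zk (LA lk) xk yk).
have key k z1 z2 : L y k -> k <> k0 -> A z1 k1 -> A z2 k2 -> A z1 k -> A z2 k ->
    z1 <> z2.
  move=> lk kk a1 a2 b1 b2 e; subst z2.
  apply: k12; apply: (gt_uniq gA (offx k z1 lk kk b1)) => //; exact: LA.
have [z1 [z1k1 z1k' M1]] := path k1 k' xk1 yk' k'0.
have [z2 [z2k2 z2k' M2]] := path k2 k' xk2 yk' k'0.
have [k'' [yk'' k''0 k'k'']] : exists k, [/\ A y k, k <> k0 & k' <> k].
  have [a [b [c [ya yb yc [ab ac bc]]]]] := thick M0 Ny.
  have [ap|ap] := EM (a = k0); have [ax|ax] := EM (a = k');
  have [bp|bp] := EM (b = k0); have [bx|bx] := EM (b = k');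
  have [cp|cp] := EM (c = k0); have [cx|cx] := EM (c = k');
  first [by exists a; split=> //; congruence|by exists b; split=> //; congruence
  |by exists c; split=> //; congruence|by exfalso; congruence].
have z12 := key k' z1 z2 yk' k'0 z1k1 z2k2 z1k' z2k'.
have xz1 := offx _ _ yk' k'0 z1k'; have xz2 := offx _ _ yk' k'0 z2k'.
have yz1 := offy _ _ xk1 z1k1; have yz2 := offy _ _ xk2 z2k2.
have tz1 : t x = t z1 by exact: A_mid (LA xk1) z1k1.
have tz2 : t x = t z2 by exact: A_mid (LA xk2) z2k2.
have [n1 [M1' N1]] : exists n1, M z1 n1 /\ (n1 = k1 \/ n1 = k').
  by case: M1 => ?; [exists k1|exists k']; auto.
have [n2 [M2' N2]] : exists n2, M z2 n2 /\ (n2 = k2 \/ n2 = k').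
  by case: M2 => ?; [exists k2|exists k']; auto.
(* The flags at [x], [z1] and [z2] exhaust the missing ones. Hence a third line through [y] can only
   meet [k1] in [z2], which would put [z2] on both [k1] and [k2]. *)
have only p l : M p l -> t x = t p -> [\/ p = x, p = z1 | p = z2].
  move=> Mp tp; case: (M_four M0 M1' M2' Mp tz1 tz2 tp) => [[]|[]|[]] => -[];
  by [congruence|constructor 1|constructor 2|constructor 3].
have yk2 : L y k''.
  case: (L_or_M yk'') => // My; case: (only _ _ My txy) => e; congruence.
have [z3 [z3k1 z3k'' M3]] := path k1 k'' xk1 yk2 k''0.
have z3z1 : z3 <> z1.
  by move=> e; apply: k'k''; apply: (gt_uniq gA yz1 _ z1k' _ _);
    [exact: LA|exact: LA|rewrite -e].
have xz3 := offx _ _ yk2 k''0 z3k''.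
have tz3 : t x = t z3 by exact: A_mid (LA xk1) z3k1.
have e3 : z3 = z2.
  by case: M3 => M3; case: (only _ _ M3 tz3) => // e; congruence.
have k12' : k1 <> k2 := k12.
apply: k12'; apply: (gt_uniq gA xz2) => //; [exact: LA|by rewrite -e3|exact: LA].
Qed.

Lemma same_type x y : N x -> N y -> t x = t y -> s x = s y.
Proof.
move=> Nx Ny txy; have [->//|xy] := EM (x = y).
have [k [xk yk]] := gt_join gA Nx Ny xy txy.
have [lx|mx] := EM (L x k); last exact: same_type_missing xk yk Nx Ny txy mx.
have [ly|my] := EM (L y k); first exact: B_mid (LB lx) (LB ly).
by apply/esym; apply: (same_type_missing _ yk xk) => // e; apply: xy.
Qed.

(** * A flag of [B] that is absent from [A] *)

Section NewFlag.
Context (x m : T).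
Hypotheses (Bxm : B x m) (nAxm : ~ A x m) (txm : t x <> t m).

Let Nx : N x := gt_dom gB Bxm.
Let Nm : N m := gt_dom gB (Bs Bxm).

Lemma new_proj y : A y m -> exists k, A x k /\ A y k.
Proof.
move=> ym; apply: (gt_join gA) => //; first exact: (gt_dom gA ym).
  by move=> e; apply: nAxm; rewrite e.
by rewrite (A_opp ym (fun e => txm (esym e))).
Qed.

(** Otherwise [x] and [y] would be joined in [B] by both [m] and [k]. *)
Lemma new_missing y k : A y m -> A x k -> A y k ->
  [\/ M y m, M y k | M x k].
Proof.
move=> ym xk yk.
case: (L_or_M ym) => [l1|]; last by constructor 1.
case: (L_or_M yk) => [l2|]; last by constructor 2.
case: (L_or_M xk) => [l3|]; last by constructor 3.
have xy : x <> y by move=> e; apply: nAxm; rewrite e.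
exfalso; apply: nAxm.
by rewrite (gt_uniq gB xy Bxm (LB l1) (LB l3) (LB l2)).
Qed.

(** The places where the path from [x] through [k] and [y] to [m] may be cut. Blocks of distinct
    points of [m] are disjoint and each holds a missing flag, so three points of [m] account for all
    missing flags, one each. *)
Let block y p l := exists2 k, A x k /\ A y k &
  [\/ (p, l) = (y, m), (p, l) = (y, k) | (p, l) = (x, k)].

Let block_missing y : A y m -> exists p l, [/\ M p l, t p = t x & block y p l].
Proof.
move=> ym; have [k [xk yk]] := new_proj ym.
have ty : t y = t x by exact: A_mid yk xk.
case: (new_missing ym xk yk) => h.
- by exists y, m; split=> //; exists k => //; constructor 1.
- by exists y, k; split=> //; exists k => //; constructor 2.
- by exists x, k; split=> //; exists k => //; constructor 3.
Qed.

Let block_disj y y' p l : A y m -> A y' m -> block y p l -> block y' p l -> y = y'.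
Proof.
move=> ym ym' [k [xk yk] h] [k' [xk' yk'] h']; apply: contrapT => yy'.
have xy : x <> y by move=> e; apply: nAxm; rewrite e.
have xy' : x <> y' by move=> e; apply: nAxm; rewrite e.
case: h => -[? ?]; case: h' => -[? ?]; subst; try congruence.
by apply: nAxm; rewrite (gt_uniq gA yy' ym ym' yk yk').
Qed.

Let Nm3 y : A y m -> exists y1 y2, [/\ A y1 m, A y2 m & [/\ y <> y1, y <> y2 & y1 <> y2]].
Proof.
move=> ym; have [p [l [Mp _ _]]] := block_missing ym.
have [a [b [c [ma mb mc [ab ac bc]]]]] := thick Mp Nm.
have [ya|ya] := EM (y = a); have [yb|yb] := EM (y = b);
have [yc|yc] := EM (y = c);
first [by exfalso; congruence
|by exists b, c; split; [exact: As|exact: As|split=> //; congruence]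
|by exists a, c; split; [exact: As|exact: As|split=> //; congruence]
|by exists a, b; split; [exact: As|exact: As|split=> //; congruence]].
Qed.

Let blocks_cover p l : M p l -> t p = t x -> exists2 y, A y m & block y p l.
Proof.
move=> Mp tp; have [y0 [_ [_ /LA/As ym _]]] := L_deg Nm.
have [y1 [y2 [y1m y2m [y01 y02 y12]]]] := Nm3 ym.
have [p0 [l0 [M0 t0 b0]]] := block_missing ym.
have [p1 [l1 [M1 t1 b1]]] := block_missing y1m.
have [p2 [l2 [M2 t2 b2]]] := block_missing y2m.
have := M_four Mp M0 M1 M2; rewrite tp t0 t1 t2.
case=> // -[] [e e']; subst; first [by exists y0|by exists y1|by exists y2|idtac].
- by case: y01; exact: block_disj b0 b1.
- by case: y02; exact: block_disj b0 b2.
- by case: y12; exact: block_disj b1 b2.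
Qed.

Let block_uniq y p l p' l' : A y m -> M p l -> M p' l' -> t p = t x ->
  t p' = t x -> block y p l -> block y p' l' -> (p, l) = (p', l').
Proof.
move=> ym Mp Mp' tp tp' b b'; have [y1 [y2 [y1m y2m [y01 y02 y12]]]] := Nm3 ym.
have [p1 [l1 [M1 t1 b1]]] := block_missing y1m.
have [p2 [l2 [M2 t2 b2]]] := block_missing y2m.
have := M_four Mp Mp' M1 M2; rewrite tp tp' t1 t2.
case=> // -[] // [e e']; subst; exfalso;
first [apply: y01; by eauto|apply: y02; by eauto|apply: y12; by eauto].
Qed.

Lemma new_flag_uniq y k p l p' l' : A y m -> A x k -> A y k ->
  M p l -> M p' l' -> t p = t x -> t p' = t x ->
  [\/ (p, l) = (y, m), (p, l) = (y, k) | (p, l) = (x, k)] ->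
  [\/ (p', l') = (y, m), (p', l') = (y, k) | (p', l') = (x, k)] ->
  (p, l) = (p', l').
Proof.
by move=> ym xk yk Mp Mp' tp tp' h h'; apply: (block_uniq ym); rewrite // /block;
  exists k.
Qed.

Lemma new_flag_missing p l : M p l -> t p = t x ->
  A p m /\ (l = m \/ A x l) \/ p = x /\ A x l.
Proof.
move=> Mp tp; have [y ym [k [xk yk] h]] := blocks_cover Mp tp.
by case: h => -[-> ->]; [left; split; [|left]|left; split; [|right]|right].
Qed.

Lemma new_flag_transversal : exists y k, [/\ A y m, A x k, M y k, L y m & L x k].
Proof.
have [y0 [_ [_ Ly0 _]]] := L_deg Nm.
have y0m := As (LA Ly0).
have tyx y : A y m -> t y = t x.
  by move=> ym; exact: A_opp ym (fun e => txm (esym e)).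
(* At least two points of [m] stay on [m] in [L]; at most one of the lines
   joining [x] to them is removed at [x]. *)
have good y : A y m -> L y m -> (forall k, A x k -> A y k -> L x k) ->
    exists y k, [/\ A y m, A x k, M y k, L y m & L x k].
  move=> ym ly lx; have [k [xk yk]] := new_proj ym.
  exists y, k; split=> //; last exact: lx.
  by case: (new_missing ym xk yk) => [[]|//|[_ /(_ (lx _ xk yk))]].
have [y [y' [yy' Ly Ly']]] := L_deg Nm.
move/L_sym in Ly; move/L_sym in Ly'.
have [k [xk yk]] := new_proj (LA Ly).
have [lk|nlk] := EM (L x k).
  apply: (good y (LA Ly) Ly) => k1 xk1 yk1.
  have xy : x <> y by move=> e; apply: nAxm; rewrite e; exact: LA.
  by rewrite (gt_uniq gA xy xk1 yk1 xk yk).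
have [k' [xk' yk']] := new_proj (LA Ly').
have xy' : x <> y' by move=> e; apply: nAxm; rewrite e; exact: LA.
have [lk'|nlk'] := EM (L x k').
  apply: (good y' (LA Ly') Ly') => k1 xk1 yk1.
  by rewrite (gt_uniq gA xy' xk1 yk1 xk' yk').
have [k1 [k2 [k12 Lk1 Lk2]]] := L_deg Nx.
(* With both joins cut at [x], the two lines of [L] through [x] meet [m] in two further points, and
   four points of [m] would require four missing flags. *)
have meet j : L x j -> exists z, [/\ A z m, A z j, z <> y & z <> y'].
  move=> lj; have xj := LA lj.
  have jm : j <> m by move=> e; apply: nAxm; rewrite -e.
  have [z [jz mz]] := gt_join gA (gt_dom gA (As xj)) Nm jm
    (bool_neq_neq (nesym (gt_type gA xj)) txm).
  have zj := As jz; have zm := As mz.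
  have neq u ku : A x ku -> A u ku -> x <> u -> ~ L x ku -> z <> u.
    move=> xku uku xu nl e; apply: nl.
    by rewrite e in zj; rewrite (gt_uniq gA xu xku uku xj zj).
  exists z; split=> //; first apply: (neq _ k) => //.
    by move=> e; apply: nAxm; rewrite e; exact: LA.
  exact: (neq _ k').
have [z1 [z1m z1k1 z1y z1y']] := meet _ Lk1.
have [z2 [z2m z2k2 z2y z2y']] := meet _ Lk2.
have z12 : z1 <> z2.
  move=> e; apply: k12; have xz : x <> z1 by move=> e'; apply: nAxm; rewrite e'.
  by apply: (gt_uniq gA xz (LA Lk1) z1k1 (LA Lk2)); rewrite e.
have [p [l [Mp tp b]]] := block_missing (LA Ly).
have [p' [l' [Mp' tp' b']]] := block_missing (LA Ly').
have [p1 [l1 [M1 t1 b1]]] := block_missing z1m.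
have [p2 [l2 [M2 t2 b2]]] := block_missing z2m.
have Aym := LA Ly; have Ay'm := LA Ly'.
have := M_four Mp Mp' M1 M2; rewrite tp tp' t1 t2.
case=> // -[] // [e e']; subst; exfalso.
- by apply: yy'; exact: block_disj b b'.
- by apply: z1y; exact: block_disj b1 b.
- by apply: z2y; exact: block_disj b2 b.
- by apply: z1y'; exact: block_disj b1 b'.
- by apply: z2y'; exact: block_disj b2 b'.
- by apply: z12; exact: block_disj b1 b2.
Qed.

End NewFlag.

(* The argument of [new_flag_missing] is applied to a second new flag through
   [y] or through another point [w] of the line [k]. *)
Lemma new_flag_contra x m : B x m -> ~ A x m -> t x <> t m -> False.
Proof.
move=> Bxm nAxm txm.
have [y [k [ym xk Myk Lym Lxk]]] := new_flag_transversal Bxm nAxm txm.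
have Nm := gt_dom gB (Bs Bxm).
have xy : x <> y by move=> e; apply: nAxm; rewrite e.
have km : k <> m by move=> e; apply: nAxm; rewrite -e.
have nBxk w : B w m -> B w k -> w = x.
  move=> wm wk; apply: contrapT => wx; apply: km.
  exact: (gt_uniq gB wx wk (LB Lxk) wm Bxm).
have nByk : ~ B y k by move=> b; apply: xy; rewrite (nBxk _ (LB Lym) b).
have [w [Lkw wx]] := other_nbr x (gt_dom gA (As xk)).
have Lwk := L_sym Lkw.
have wy : w <> y by move=> e; apply: Myk.2; rewrite -e.
have tw : t w = t x by exact: A_mid (LA Lwk) xk.
have ty : t y = t x by exact: A_mid Myk.1 xk.
have Nw := gt_dom gA (LA Lwk); have Ny := gt_dom gA ym.
have swy : s w = s y by apply: same_type; rewrite // tw ty.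
(* In [B] the points [w] and [y] lie on different lines through [x], so [j] is neither [k] nor [m].
   In [A] their join is [k], so [j] misses one of them there: this is the second new flag. *)
have [j [wj yj]] := gt_join gB Nw Ny wy swy.
have nwm : ~ A w m.
  move=> wm; apply: km.
  exact: (gt_uniq gA wy (LA Lwk) Myk.1 wm ym).
have jm : j <> m by move=> e; apply: wx; apply: nBxk; [rewrite -e|exact: LB].
have jk : j <> k by move=> e; apply: nByk; rewrite -e.
have tj : t x <> t j.
  have h u v : B u v -> t u <> t v.
    move=> uv e; apply: (gt_type gB uv); apply: same_type => //.
      exact: (gt_dom gB uv).
    exact: (gt_dom gB (Bs uv)).
  by rewrite -tw; exact: h wj.
have nLxj : ~ L x j.
  move=> xj; apply: jk; exact: (gt_uniq gB wx wj (LB xj) (LB Lwk) (LB Lxk)).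
have My j' : A x j' -> A y j' -> j' = k.
  by move=> a b; exact: (gt_uniq gA xy a b xk Myk.1).
(* If [j] passed through [x] in [A], the missing flag of the block of [z], the meeting point of [j]
   and [m], would be the one of [x] and [j]. The other two flags of the block would lie in [L], and
   [j] and [m] would share [y] and [z] in [B]. *)
have nAxj : ~ A x j.
  move=> xj; have Mxj : M x j by [].
  have jmt : t j = t m.
    by move: (gt_type gA xj) txm; case: (t x) (t j) (t m) => [] [] [].
  have [z [jz mz]] := gt_join gA (gt_dom gA (As xj)) Nm jm jmt.
  have zj := As jz; have zm := As mz.
  have tz : t z = t x by exact: A_mid zj xj.
  have zx : z <> x by move=> e; apply: nAxm; rewrite -e.
  have b : [/\ L z j & L z m].
    split; apply: contrapT => nl.
      have Mzj : M z j by [].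
      have [/esym //] := new_flag_uniq Bxm nAxm txm zm xj zj Mxj Mzj erefl tz
        (Or33 _ _ erefl) (Or32 _ _ erefl).
    have Mzm : M z m by [].
    have [/esym //] := new_flag_uniq Bxm nAxm txm zm xj zj Mxj Mzm erefl tz
      (Or33 _ _ erefl) (Or31 _ _ erefl).
  have zy : z <> y by move=> e; apply: jk; apply: My; rewrite -?e.
  apply: jm; exact: (gt_uniq gB zy (LB b.1) yj (LB b.2) (LB Lym)).
have [y' [Lmy' y'y]] := other_nbr y Nm.
have y'm := As (LA Lmy').
have ty' : t y' = t x by rewrite (A_mid y'm ym).
have [k2 [xk2 y'k2]] := new_proj Bxm nAxm txm y'm.
have nk2 : k2 <> k.
  move=> e; apply: km; apply: (gt_uniq gA y'y _ Myk.1 y'm ym).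
  by rewrite -e.
have k2j : k2 <> j by move=> e; apply: nAxj; rewrite -e.
(* The block of [y'] supplies a missing flag whose line contains neither [w] nor [y], which
   [new_flag_missing] excludes for a new flag on [j]. *)
have [p [Mp tp pn]] : exists p, [/\ M p k2, t p = t x & p = y' \/ p = x].
  case: (new_missing Bxm nAxm y'm xk2 y'k2) => [[_ []]|h|h].
  - exact: L_sym.
  - by exists y'; split=> //; left.
  - by exists x; split=> //; right.
have pw : p <> w.
  by case: pn => -> e; [apply: nwm; rewrite -e|exact: wx].
have py : p <> y by case: pn => ->.
have key u : A u k -> u <> x -> ~ A u k2.
  by move=> uk ux uk2; apply: nk2; exact: (gt_uniq gA ux uk2 xk2 uk xk).
have [Awj|nAwj] := EM (A w j); last first.
  have tpw : t p = t w by rewrite tp tw.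
  case: (new_flag_missing wj nAwj _ Mp tpw) => [|[_ [//|h]]|[]//].
    by rewrite tw.
  exact: (key w (LA Lwk) wx h).
have nAyj : ~ A y j.
  by move=> Ayj; apply: jk; exact: (gt_uniq gA wy Awj Ayj (LA Lwk) Myk.1).
have tpy : t p = t y by rewrite tp ty.
case: (new_flag_missing yj nAyj _ Mp tpy) => [|[_ [//|h]]|[]//].
  by rewrite ty.
exact: (key y Myk.1 (nesym xy) h).
Qed.

Lemma new_edge x m : B x m -> A x m.
Proof.
move=> Bxm; have Nx := gt_dom gB Bxm; have Nm := gt_dom gB (Bs Bxm).
apply: contrapT => nA; apply: (new_flag_contra Bxm nA) => txm.
by apply: (gt_type gB Bxm); exact: same_type.
Qed.

(** For the inclusion of [A] in [B], take an [L]-neighbour [z] of [y]: the join of [x] and [z] in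
    [B] is by [new_edge] their join in [A], hence equals [y]. *)
Theorem link_unique x y : A x y <-> B x y.
Proof.
split; last exact: new_edge.
move=> xy; have Nx := gt_dom gA xy.
have [z [Lyz zx]] := other_nbr x (gt_dom gA (As xy)).
have yz := LA Lyz; have Nz := gt_dom gA (As yz).
have txz : t z = t x by exact: A_mid (As yz) xy.
have [k [xk zk]] := gt_join gB Nx Nz (nesym zx) (same_type Nx Nz (esym txz)).
by rewrite (gt_uniq gA zx (As yz) xy (new_edge zk) (new_edge xk)).
Qed.

End Links.

(** * The triangular lattice and its Coxeter group *)

Local Open Scope ring_scope.

Notation lattice := (int * int)%type.

(* The triangular lattice in oblique coordinates: the neighbours of 0 are
   (1, 0), (0, 1), (1, -1) and their opposites. *)
Definition ladj (z w : lattice) : bool :=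
  [&& z != w, -1 <= w.1 - z.1 <= 1, -1 <= w.2 - z.2 <= 1 &
      -1 <= (w.1 - z.1) + (w.2 - z.2) <= 1].

(** The graph distance of the lattice, whose balls are hexagons. *)
Definition hexdist (z w : lattice) : nat :=
  let a := w.1 - z.1 in let b := w.2 - z.2 in
  maxn (absz a) (maxn (absz b) (absz (a + b))).

Lemma lat_eqE (z w : lattice) : (z == w) = (z.1 == w.1) && (z.2 == w.2).
Proof. by case: z w => [a b] [c d]. Qed.

Lemma ladj_hexdist z w : ladj z w = (hexdist z w == 1%N).
Proof. case: z w => [a b] [c d]; rewrite /ladj /hexdist lat_eqE /=; lia. Qed.

Lemma no_four_clique x y z w : ladj x y -> ladj x z -> ladj x w -> ladj y z ->
  ladj y w -> ladj z w -> False.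
Proof.
case: x y z w => [a b] [c d] [e f] [g h]; rewrite /ladj !lat_eqE /=.
lia.
Qed.

Definition state := (lattice * lattice * lattice)%type.

Definition corner (st : state) (i : 'I_3) : lattice :=
  match val i with 0%N => st.1.1 | 1%N => st.1.2 | _ => st.2 end.

(* The Coxeter group acts from the right on ordered triangles: the letter [i]
   reflects the [i]-th vertex in the opposite edge. *)
Definition reflect_state (st : state) (i : 'I_3) : state :=
  let: (x, y, z) := st in
  match val i with
  | 0%N => (y + z - x, y, z)
  | 1%N => (x, x + z - y, z)
  | _ => (x, y, x + y - z)
  end.

Definition run := foldl reflect_state.

Lemma stateP (a b c d e f a' b' c' d' e' f' : int) :
  a = a' -> b = b' -> c = c' -> d = d' -> e = e' -> f = f' ->
  (((a, b), (c, d), (e, f)) : state) = ((a', b'), (c', d'), (e', f')).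
Proof. by move=> -> -> -> -> -> ->. Qed.

Local Notation eqc := (coxeter_eq A2tilde).

Lemma run_sound u v : eqc u v -> forall st, run st u = run st v.
Proof.
elim=> {u v} [//|u v _ IH st|u v w _ IH1 _ IH2 st|u v i j st].
- by rewrite IH.
- by rewrite IH1 IH2.
rewrite /run !foldl_cat; congr foldl.
move: (foldl _ _ u) => -[[[a b] [c d]] [e f]].
rewrite /A2tilde; case: i j => [[|[|[|i]]] Hi] [[|[|[|j]]] Hj] //; apply: stateP => /=; lia.
Qed.


(** * Normal forms in the affine Weyl group *)

Lemma coxeter_eq_ctx p q u v : eqc u v -> eqc (p ++ u ++ q) (p ++ v ++ q).
Proof.
elim=> {u v} [u|u v _ IH|u v w _ IH1 _ IH2|u v i j].
- exact: coxeter_refl.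
- exact: coxeter_sym.
- exact: coxeter_trans IH2.
have := coxeter_rel A2tilde (p ++ u) (v ++ q) i j.
by rewrite -!catA.
Qed.

#[local] Hint Resolve coxeter_refl : core.

#[local] Instance coxeter_eq_equiv : RelationClasses.Equivalence eqc.
Proof.
by split; [exact: coxeter_refl|exact: coxeter_sym|exact: coxeter_trans].
Qed.

#[local] Instance coxeter_eq_cat : Morphisms.Proper
  (Morphisms.respectful eqc (Morphisms.respectful eqc eqc)) cat.
Proof.
move=> u u' uu' v v' vv'; transitivity (u' ++ v).
  exact: (coxeter_eq_ctx [::] v uu').
by have := coxeter_eq_ctx u' [::] vv'; rewrite !cats0.
Qed.

Local Notation a := (ord0 : 'I_3).
Local Notation b := (@Ordinal 3 1 isT).
Local Notation c := (@Ordinal 3 2 isT).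

Lemma coxeter_sq i : eqc [:: i; i] [::].
Proof. by have := coxeter_rel A2tilde [::] [::] i i; rewrite /A2tilde eqxx. Qed.

Lemma coxeter_cancel p q i : eqc (p ++ [:: i, i & q]) (p ++ q).
Proof. exact: (coxeter_eq_ctx p q (coxeter_sq i)). Qed.

Lemma coxeter_rev u : eqc (u ++ rev u) [::].
Proof.
elim/last_ind: u => [|u i IH]; first exact: coxeter_refl.
by rewrite rev_rcons cat_rcons coxeter_cancel.
Qed.

Lemma coxeter_braid p q i j : i != j ->
  eqc (p ++ [:: i, j, i & q]) (p ++ [:: j, i, j & q]).
Proof.
move=> ij; apply: (@coxeter_eq_ctx p q [:: i; j; i] [:: j; i; j]).
symmetry.
have := coxeter_rel A2tilde [::] [:: j; i; j] i j; rewrite /A2tilde (negbTE ij) /=.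
move=> h; apply: (coxeter_trans (coxeter_sym h)).
apply: (coxeter_trans (coxeter_cancel [:: i; j; i; j; i] [:: i; j] j)).
apply: (coxeter_trans (coxeter_cancel [:: i; j; i; j] [:: j] i)).
exact: (coxeter_cancel [:: i; j; i] [::] j).
Qed.

Fixpoint wpow (n : nat) (t : seq 'I_3) :=
  if n is n'.+1 then t ++ wpow n' t else [::].

Lemma wpow_comm n t u : eqc (u ++ t) (t ++ u) -> eqc (u ++ wpow n t) (wpow n t ++ u).
Proof.
move=> h; elim: n => [|n IH] /=; first by rewrite cats0.
by rewrite catA h -(catA t u) IH catA.
Qed.

Lemma wpowS n t : eqc (wpow n t ++ t) (wpow n.+1 t).
Proof. by symmetry; apply: wpow_comm; reflexivity. Qed.

Lemma wpow_cancel m m' t t' : eqc (t ++ t') [::] ->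
  eqc (wpow m t ++ wpow m' t') (wpow (m - m') t ++ wpow (m' - m) t').
Proof.
move=> h; elim: m m' => [|m IH] [|m'] //.
rewrite subSS -IH; transitivity ((wpow m t ++ t) ++ (t' ++ wpow m' t')).
  by rewrite wpowS.
by rewrite -catA (catA t t') h.
Qed.

Lemma comm_inv u t t' : eqc (t ++ t') [::] -> eqc (t' ++ t) [::] ->
  eqc (u ++ t) (t ++ u) -> eqc (u ++ t') (t' ++ u).
Proof.
move=> tt' t't ut; transitivity ((t' ++ t) ++ (u ++ t')); first by rewrite t't.
rewrite -(catA t') (catA t u) -ut -(catA u t) tt' cats0.
reflexivity.
Qed.

Tactic Notation "cancel" constr(p) constr(q) constr(i) :=
  apply: (coxeter_trans (coxeter_cancel p q i)).
Tactic Notation "braid" constr(p) constr(q) constr(i) constr(j) :=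
  apply: (coxeter_trans (@coxeter_braid p q i j isT)).

(** [t0] and [t1] translate [base] by (1, 1) and (-2, 1), which span the translations preserving the
    three types of vertices. The primed words are their inverses. *)
Definition t0 := [:: a; b; c; b].
Definition t0' := [:: b; c; b; a].
Definition t1 := [:: b; c; a; c].
Definition t1' := [:: c; a; c; b].

Lemma t0K : eqc (t0 ++ t0') [::]. Proof. exact: (coxeter_rev t0). Qed.
Lemma t0'K : eqc (t0' ++ t0) [::]. Proof. exact: (coxeter_rev t0'). Qed.
Lemma t1K : eqc (t1 ++ t1') [::]. Proof. exact: (coxeter_rev t1). Qed.
Lemma t1'K : eqc (t1' ++ t1) [::]. Proof. exact: (coxeter_rev t1'). Qed.

Lemma t01E : eqc (t0 ++ t1) [:: b; a; b; c].
Proof.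
cancel [:: a; b; c] [:: c; a; c] b; cancel [:: a; b] [:: a; c] c.
by braid (Nil 'I_3) [:: c] a b.
Qed.

Lemma t01_comm : eqc (t0 ++ t1) (t1 ++ t0).
Proof.
rewrite t01E; symmetry.
braid [:: b] [:: a; b; c; b] c a; cancel [:: b; a; c] [:: b; c; b] a.
braid [:: b; a; c] (Nil 'I_3) b c; cancel [:: b; a] [:: b; c] c.
by [].
Qed.


(* Every element of the Coxeter group is a translation, written in terms of the
   commuting translations t0 and t1, times an element of the dihedral group
   generated by b and c. *)
Definition tpart m m' n n' := wpow m t0 ++ wpow m' t0' ++ wpow n t1 ++ wpow n' t1'.

Definition dihedral : seq (seq 'I_3) :=
  [:: [::]; [:: b]; [:: c]; [:: b; c]; [:: c; b]; [:: b; c; b]].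

Lemma t0'1_comm : eqc (t1 ++ t0') (t0' ++ t1).
Proof. by apply: comm_inv t0K t0'K _; symmetry; exact: t01_comm. Qed.

Lemma t0'1'_comm : eqc (t0' ++ t1') (t1' ++ t0').
Proof. by apply: comm_inv t1K t1'K _; symmetry; exact: t0'1_comm. Qed.

Lemma t01'_comm : eqc (t0 ++ t1') (t1' ++ t0).
Proof. by apply: comm_inv t1K t1'K _; exact: t01_comm. Qed.

Lemma tt'_comm t t' : eqc (t ++ t') [::] -> eqc (t' ++ t) [::] ->
  eqc (t ++ t') (t' ++ t).
Proof. by move=> -> ->. Qed.

Lemma tpart_t1' m m' n n' : eqc (tpart m m' n n' ++ t1') (tpart m m' n n'.+1).
Proof. by rewrite /tpart -!catA wpowS. Qed.

Lemma tpart_t1 m m' n n' : eqc (tpart m m' n n' ++ t1) (tpart m m' n.+1 n').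
Proof.
rewrite /tpart -!catA -(@wpow_comm n' t1' t1); last exact: tt'_comm t1K t1'K.
by rewrite (catA (wpow n t1)) wpowS.
Qed.

Lemma tpart_t0' m m' n n' : eqc (tpart m m' n n' ++ t0') (tpart m m'.+1 n n').
Proof.
rewrite /tpart -!catA -(@wpow_comm n' t1' t0'); last exact: t0'1'_comm.
rewrite (catA (wpow n t1) t0') -(@wpow_comm n t1 t0'); last by symmetry; exact: t0'1_comm.
by rewrite -(catA t0') (catA (wpow m' t0')) wpowS.
Qed.

Lemma tpart_t0 m m' n n' : eqc (tpart m m' n n' ++ t0) (tpart m.+1 m' n n').
Proof.
rewrite /tpart -!catA -(@wpow_comm n' t1' t0); last exact: t01'_comm.
rewrite (catA (wpow n t1) t0) -(@wpow_comm n t1 t0); last exact: t01_comm.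
rewrite -(catA t0) (catA (wpow m' t0')) -(@wpow_comm m' t0' t0); last exact: tt'_comm t0K t0'K.
by rewrite -(catA t0) (catA (wpow m t0)) wpowS.
Qed.

Definition normal_form w := exists m m' n n' u,
  u \in dihedral /\ eqc w (tpart m m' n n' ++ u).

Lemma normal_form_eq w w' : eqc w w' -> normal_form w' -> normal_form w.
Proof.
by move=> e [m [m' [n [n' [u [ud h]]]]]]; exists m, m', n, n', u; split=> //; rewrite e.
Qed.

Lemma normal_form_pf m m' n n' u : u \in dihedral -> normal_form (tpart m m' n n' ++ u).
Proof. by move=> ud; exists m, m', n, n', u. Qed.

Lemma normal_form_translate m m' n n' v : v \in dihedral ->
  [/\ normal_form (tpart m m' n n' ++ t0 ++ v), normal_form (tpart m m' n n' ++ t0' ++ v),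
      normal_form (tpart m m' n n' ++ t1 ++ v) & normal_form (tpart m m' n n' ++ t1' ++ v)].
Proof.
move=> vd; split; rewrite catA.
- by apply: (normal_form_eq _ (normal_form_pf m.+1 m' n n' vd)); rewrite tpart_t0.
- by apply: (normal_form_eq _ (normal_form_pf m m'.+1 n n' vd)); rewrite tpart_t0'.
- by apply: (normal_form_eq _ (normal_form_pf m m' n.+1 n' vd)); rewrite tpart_t1.
- by apply: (normal_form_eq _ (normal_form_pf m m' n n'.+1 vd)); rewrite tpart_t1'.
Qed.

Lemma normal_form_t0t1 m m' n n' v : v \in dihedral -> 
  normal_form (tpart m m' n n' ++ t0 ++ t1 ++ v).
Proof.
move=> vd; have [_ _ h _] := normal_form_translate m.+1 m' n n' vd.
by apply: normal_form_eq h; rewrite catA tpart_t0.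
Qed.

Lemma normal_form_t1't0' m m' n n' v : v \in dihedral -> 
  normal_form (tpart m m' n n' ++ t1' ++ t0' ++ v).
Proof.
move=> vd; have [_ h _ _] := normal_form_translate m m' n n'.+1 vd.
by apply: normal_form_eq h; rewrite catA tpart_t1'.
Qed.

(** The letters [b] and [c] stay in the dihedral group. Multiplying its six elements by [a] brings
    out the translations by the six roots: [t0], [t1], their product, and the inverses. *)
Lemma dihedral_rcons u i : u \in dihedral ->
  [\/ exists2 v, v \in dihedral & eqc (u ++ [:: i]) v,
      exists T v, [/\ T \in [:: t0; t0'; t1; t1'], v \in dihedral &
        eqc (u ++ [:: i]) (T ++ v)],
      exists2 v, v \in dihedral & eqc (u ++ [:: i]) (t0 ++ t1 ++ v) |
      exists2 v, v \in dihedral & eqc (u ++ [:: i]) (t1' ++ t0' ++ v)].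
Proof.
case: i => [[|[|[|i]]] Hi] //; rewrite !inE.
- have -> : Ordinal Hi = a by exact: val_inj.
  case/or4P => [|||/orP[|/orP[]]] /eqP->.
  + constructor 2; exists t0, [:: b; c; b]; split=> //; symmetry.
    cancel [:: a; b; c] [:: c; b] b; cancel [:: a; b] [:: b] c.
    by cancel [:: a] (Nil 'I_3) b.
  + constructor 3; exists [:: c; b] => //; rewrite (catA t0) t01E; symmetry.
    by cancel [:: b; a; b] [:: b] c; cancel [:: b; a] (Nil 'I_3) b.
  + constructor 2; exists t1', [:: b; c]; split=> //; symmetry.
    by cancel [:: c; a; c] [:: c] b; cancel [:: c; a] (Nil 'I_3) c.
  + constructor 2; exists t1, [:: c]; split=> //; symmetry.
    by cancel [:: b; c; a] (Nil 'I_3) c.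
  + constructor 4; exists [:: b] => //; symmetry.
    cancel [:: c; a; c] [:: c; b; a; b] b; cancel [:: c; a] [:: b; a; b] c.
    by braid [:: c; a] (Nil 'I_3) b a; cancel [:: c] [:: b; a] a.
  + by constructor 2; exists t0', [::]; split.
- have -> : Ordinal Hi = b by exact: val_inj.
  constructor 1; move: H; case/or4P => [|||/orP[|/orP[]]] /eqP->.
  + by exists [:: b].
  + by exists [::] => //; cancel (Nil 'I_3) (Nil 'I_3) b.
  + by exists [:: c; b].
  + by exists [:: b; c; b].
  + by exists [:: c] => //; cancel [:: c] (Nil 'I_3) b.
  + by exists [:: b; c] => //; cancel [:: b; c] (Nil 'I_3) b.
- have -> : Ordinal Hi = c by exact: val_inj.
  constructor 1; move: H; case/or4P => [|||/orP[|/orP[]]] /eqP->.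
  + by exists [:: c].
  + by exists [:: b; c].
  + by exists [::] => //; cancel (Nil 'I_3) (Nil 'I_3) c.
  + by exists [:: b] => //; cancel [:: b] (Nil 'I_3) c.
  + by exists [:: b; c; b] => //; braid (Nil 'I_3) (Nil 'I_3) c b.
  + exists [:: c; b] => //; braid (Nil 'I_3) [:: c] b c.
    by cancel [:: c; b] (Nil 'I_3) c.
Qed.

Lemma normal_form_all w : normal_form w.
Proof.
elim/last_ind: w => [|w i [m [m' [n [n' [u [ud e]]]]]]].
  by exists 0%N, 0%N, 0%N, 0%N, [::].
apply: (@normal_form_eq _ (tpart m m' n n' ++ (u ++ [:: i]))); first by rewrite -cats1 e catA.
have sub x y : eqc x y -> normal_form (tpart m m' n n' ++ y) -> normal_form (tpart m m' n n' ++ x).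
  by move=> xy; apply: normal_form_eq; rewrite xy.
have [[v vd h]|[T [v [Td vd h]]]|[v vd h]|[v vd h]] := dihedral_rcons i ud;
  apply: sub h _.
- exact: normal_form_pf.
- have [h0 h0' h1 h1'] := normal_form_translate m m' n n' vd.
  by move: Td; rewrite !inE; case/or4P => /eqP->.
- exact: normal_form_t0t1.
- exact: normal_form_t1't0'.
Qed.

Definition translate (d : lattice) (st : state) : state :=
  (st.1.1 + d, st.1.2 + d, st.2 + d).

Definition base : state := ((0, 0), (1, 0), (0, 1)).

Lemma translateK d : cancel (translate d) (translate (- d)).
Proof. by case=> -[x y] z; rewrite /translate /= !addrK. Qed.

Lemma run_translate d st w : run (translate d st) w = translate d (run st w).
Proof.
elim: w st => [|i w IH] st //=; rewrite -IH; congr run.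
case: st => -[[x1 x2] [y1 y2]] [z1 z2]; move: d {IH} => [d1 d2].
by case: i => [[|[|[|i]]] Hi] //; apply: stateP => /=; lia.
Qed.

Lemma run_cat st u v : run st (u ++ v) = run (run st u) v.
Proof. exact: foldl_cat. Qed.

Lemma run_wpow n t d v : run base t = translate d base ->
  run base (wpow n t ++ v) = translate (d *+ n) (run base v).
Proof.
have translate0 st : translate 0 st = st.
  by case: st => -[x y] z; rewrite /translate !addr0.
have translateD e e' st : translate e (translate e' st) = translate (e + e') st.
  by rewrite /translate /= -!addrA (addrC e).
move=> td; elim: n => [|n IH] /=; first by rewrite mulr0n translate0.
by rewrite -catA run_cat td run_translate IH translateD mulrS.
Qed.

Lemma run_tpart m m' n n' u : run base (tpart m m' n n' ++ u) =
  translate ((m%:Z - m'%:Z) - 2 * (n%:Z - n'%:Z), (m%:Z - m'%:Z) + (n%:Z - n'%:Z))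
    (run base u).
Proof.
rewrite /tpart -!catA (@run_wpow _ _ (1, 1)) // (@run_wpow _ _ (-1, -1)) //.
rewrite (@run_wpow _ _ (-2, 1)) // (@run_wpow _ _ (2, -1)) //.
have mulE (x y : int) k : (x, y) *+ k = (x *+ k, y *+ k).
  by elim: k => [//|k IH]; rewrite !mulrS IH.
rewrite !mulE; case: (run base u) => -[[x1 x2] [y1 y2]] [z1 z2].
by apply: stateP => /=; lia.
Qed.

Lemma dihedral_fix u : u \in dihedral -> (run base u).1.1 = 0.
Proof. by rewrite !inE => /or4P[|||/orP[|/orP[]]] /eqP->. Qed.

Lemma dihedral_inj u v : u \in dihedral -> v \in dihedral ->
  run base u = run base v -> u = v.
Proof.
rewrite !inE => /or4P[|||/orP[|/orP[]]] /eqP-> /or4P[|||/orP[|/orP[]]] /eqP-> //.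
Qed.

(** The dihedral part fixes the corner of [base] at the origin, so the image of this corner reads
    off the translation, with exponents known up to cancellation of inverses; the six dihedral words
    are then told apart by their action. *)
Lemma run_complete w w' : run base w = run base w' -> eqc w w'.
Proof.
have [m [m' [n [n' [u [ud wE]]]]]] := normal_form_all w.
have [k [k' [l [l' [v [vd w'E]]]]]] := normal_form_all w'.
rewrite (run_sound wE) (run_sound w'E) !run_tpart => e.
have [e1 e2] : (m%:Z - m'%:Z) - 2 * (n%:Z - n'%:Z) = (k%:Z - k'%:Z) - 2 * (l%:Z - l'%:Z)
    /\ (m%:Z - m'%:Z) + (n%:Z - n'%:Z) = (k%:Z - k'%:Z) + (l%:Z - l'%:Z).
  have := congr1 (fun st : state => st.1.1) e.
  by rewrite /translate /= (dihedral_fix ud) (dihedral_fix vd) !add0r => -[].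
have uv : u = v.
  apply: dihedral_inj => //; move: e; rewrite e1 e2.
  exact: (can_inj (translateK _)).
rewrite wE w'E uv /tpart (catA (wpow m t0)) (wpow_cancel m m' t0K).
rewrite (wpow_cancel n n' t1K) (catA (wpow k t0)) (wpow_cancel k k' t0K).
rewrite (wpow_cancel l l' t1K).
have -> : (m - m' = k - k')%N by lia.
have -> : (m' - m = k' - k)%N by lia.
have -> : (n - n' = l - l')%N by lia.
by have -> : (n' - n = l' - l)%N by lia.
Qed.

(** * Lattice triangles as elements of the Coxeter group *)

Definition typ (z : lattice) (r : nat) := exists k, z.1 - z.2 = 3 * k + r%:Z.

Definition valid (st : state) :=
  [/\ typ st.1.1 0, typ st.1.2 1 & typ st.2 2] /\
  [&& ladj st.1.1 st.1.2, ladj st.1.1 st.2 & ladj st.1.2 st.2].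

Lemma valid_base : valid base.
Proof. by split=> //; split; [exists 0|exists 0|exists (-1)]. Qed.

Lemma valid_reflect st i : valid st -> valid (reflect_state st i).
Proof.
case: st => -[[x1 x2] [y1 y2]] [z1 z2].
case=> -[[kx /= ex] [ky /= ey] [kz /= ez]] adj.
case: i => [[|[|[|i]]] Hi] //.
- split; first split.
  + by exists (ky + kz + 1 - kx) => /=; lia.
  + by exists ky => /=; lia.
  + by exists kz => /=; lia.
  + by move: adj; rewrite /ladj !lat_eqE /=; lia.
- split; first split.
  + by exists kx => /=; lia.
  + by exists (kx + kz - ky) => /=; lia.
  + by exists kz => /=; lia.
  + by move: adj; rewrite /ladj !lat_eqE /=; lia.
- split; first split.
  + by exists kx => /=; lia.
  + by exists ky => /=; lia.
  + by exists (kx + ky - kz - 1) => /=; lia.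
  + by move: adj; rewrite /ladj !lat_eqE /=; lia.
Qed.

Lemma valid_run w : valid (run base w).
Proof.
elim/last_ind: w => [|w i IH]; first exact: valid_base.
by rewrite -cats1 run_cat; exact: valid_reflect.
Qed.


Definition offsets : seq (lattice * lattice) :=
  [:: ((1, 0), (0, 1)); ((-1, 1), (0, 1)); ((1, 0), (1, -1));
      ((-1, 1), (-1, 0)); ((0, -1), (1, -1)); ((0, -1), (-1, 0))].

(* [y] is of type one more than [x], and [z] of type two more. *)
Definition typed_triangle (x y z : lattice) :=
  exists p q, [/\ y = x + p, z = x + q & (p, q) \in offsets].

Lemma latP (p q : lattice) : p.1 = q.1 -> p.2 = q.2 -> p = q.
Proof. by case: p q => [p1 p2] [q1 q2] /= -> ->. Qed.

Lemma ladj_type1 x y kx ky r : x.1 - x.2 = 3 * kx + r ->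
  y.1 - y.2 = 3 * ky + (r + 1) -> ladj x y ->
  exists2 p, y = x + p & p \in [:: (1, 0); (-1, 1); (0, -1)].
Proof.
case: x y => [x1 x2] [y1 y2]; rewrite /ladj lat_eqE /= => ex ey xy.
exists (y1 - x1, y2 - x2); first by apply: latP => /=; lia.
rewrite !inE !xpair_eqE.
lia.
Qed.

Lemma ladj_type2 x z kx kz r : x.1 - x.2 = 3 * kx + r ->
  z.1 - z.2 = 3 * kz + (r + 2) -> ladj x z ->
  exists2 q, z = x + q & q \in [:: (0, 1); (-1, 0); (1, -1)].
Proof.
case: x z => [x1 x2] [y1 y2]; rewrite /ladj lat_eqE /= => ex ey xy.
exists (y1 - x1, y2 - x2); first by apply: latP => /=; lia.
rewrite !inE !xpair_eqE.
lia.
Qed.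

Lemma ladj_add x p q : ladj (x + p) (x + q) = ladj p q.
Proof. by case: x p q => [x1 x2] [p1 p2] [q1 q2]; rewrite /ladj !lat_eqE /=; lia. Qed.

Lemma typed_triangleP x y z r kx ky kz : x.1 - x.2 = 3 * kx + r ->
  y.1 - y.2 = 3 * ky + (r + 1) -> z.1 - z.2 = 3 * kz + (r + 2) ->
  ladj x y -> ladj x z -> ladj y z -> typed_triangle x y z.
Proof.
move=> ex ey ez xy xz; have [p -> hp] := ladj_type1 ex ey xy.
have [q -> hq] := ladj_type2 ex ez xz; rewrite ladj_add => pq.
exists p, q; split=> //; move: pq.
by move: hp hq; rewrite !in_cons => /or4P[|||//] /eqP-> /or4P[|||//] /eqP->.
Qed.

Lemma valid_typed_triangle st : valid st -> [/\ typed_triangle st.1.1 st.1.2 st.2,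
  typed_triangle st.1.2 st.2 st.1.1 & typed_triangle st.2 st.1.1 st.1.2].
Proof.
have sym x y : ladj x y -> ladj y x by rewrite !ladj_hexdist /hexdist; lia.
case=> -[[kx ex] [ky ey] [kz ez]] /and3P[xy xz yz]; split.
- by apply: (@typed_triangleP _ _ _ 0 kx ky kz); rewrite ?ex ?ey ?ez; auto.
- by apply: (@typed_triangleP _ _ _ 1 ky kz (kx - 1)); rewrite ?ex ?ey ?ez; auto; lia.
- by apply: (@typed_triangleP _ _ _ 2 kz (kx - 1) (ky - 1)); rewrite ?ex ?ey ?ez; auto; lia.
Qed.

Lemma typed_triangle_fan x y z y' z' : typed_triangle x y z -> typed_triangle x y' z' ->
  exists2 w, w \in dihedral & run (x, y, z) w = (x, y', z').
Proof.
move=> [p [q [-> -> h]]] [p' [q' [-> -> h']]].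
move: x {y z y' z'} => [x1 x2].
move: h; rewrite !in_cons => /or4P[|||/or4P[|||//]] /eqP [-> ->];
move: h'; rewrite !in_cons => /or4P[|||/or4P[|||//]] /eqP [-> ->];
first [by exists [::]; rewrite //; apply: stateP => /=; lia
  |by exists [:: b]; rewrite //; apply: stateP => /=; lia
  |by exists [:: c]; rewrite //; apply: stateP => /=; lia
  |by exists [:: b; c]; rewrite //; apply: stateP => /=; lia
  |by exists [:: c; b]; rewrite //; apply: stateP => /=; lia
  |by exists [:: b; c; b]; rewrite //; apply: stateP => /=; lia].
Qed.

(** Cyclic relabelling reduces the stabilizers of the other two corners to that of corner 0, which
    is generated by [b] and [c]. *)
Definition rot3 (st : state) : state := (st.1.2, st.2, st.1.1).

Lemma rot3_inj : injective rot3.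
Proof. by move=> [[? ?] ?] [[? ?] ?] [-> -> ->]. Qed.

Lemma run_rot3 st w : run (rot3 st) w = rot3 (run st (map (@ordS 3) w)).
Proof.
elim: w st => [//|i w IH] st /=; rewrite -IH; congr run.
case: st => -[[x1 x2] [y1 y2]] [z1 z2].
by case: i => [[|[|[|i]]] Hi] //; apply: stateP => /=; lia.
Qed.

Lemma dihedral_notin w : w \in dihedral -> [/\ a \notin w,
  b \notin map (@ordS 3) w & c \notin map (@ordS 3) (map (@ordS 3) w)].
Proof. by rewrite !inE => /or4P[|||/orP[|/orP[]]] /eqP->. Qed.

Lemma valid_fan st st' i : valid st -> valid st' -> corner st i = corner st' i ->
  exists2 x, i \notin x & run st x = st'.
Proof.
move=> /valid_typed_triangle + /valid_typed_triangle.
case: st st' => -[x y] z [[x' y'] z'].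
case: i => [[|[|[|i]]] Hi] //; rewrite /corner /=.
- move=> [h _ _] [h' _ _] e; subst x'.
  have [w wd <-] := typed_triangle_fan h h'; exists w => //.
  have -> : Ordinal Hi = a by exact: val_inj.
    by have [? _ _] := dihedral_notin wd.
- move=> [_ h _] [_ h' _] e; subst y'.
  have [w wd e] := typed_triangle_fan h h'; exists (map (@ordS 3) w) => //.
    have -> : Ordinal Hi = b by exact: val_inj.
    by have [_ ? _] := dihedral_notin wd.
  by apply: rot3_inj; rewrite -run_rot3.
- move=> [_ _ h] [_ _ h'] e; subst z'.
  have [w wd e] := typed_triangle_fan h h'.
  exists (map (@ordS 3) (map (@ordS 3) w)) => //.
    have -> : Ordinal Hi = c by exact: val_inj.
    by have [_ _ ?] := dihedral_notin wd.
  by do 2 apply: rot3_inj; rewrite -!run_rot3.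
Qed.

Lemma valid_reach st : valid st -> exists w, run base w = st.
Proof.
move=> v; have [[[k ek] _ _] _] := v.
(* Solves (m - 2 n, m + n) = corner 0, the translation of [run_tpart]; it is integral because the
   coordinates of this corner differ by 3 [k]. [pos] splits the exponents into positive and negative
   parts. *)
pose n := - k; pose m := st.1.1.2 + k.
pose pos (i : int) := if 0 <= i then absz i else 0%N.
have posE i : (pos i)%:Z - (pos (- i))%:Z = i.
  by rewrite /pos; do 2 case: ifP; lia.
pose t := tpart (pos m) (pos (- m)) (pos n) (pos (- n)).
have ht : corner (run base t) a = corner st a.
  have := run_tpart (pos m) (pos (- m)) (pos n) (pos (- n)) [::].
  by rewrite cats0 -/t !posE => ->; apply: latP; rewrite /corner /= /m /n; lia.
have [x _ <-] := valid_fan (valid_run t) v ht.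
by exists (t ++ x); rewrite run_cat.
Qed.

Definition vtx w i : coxeter_vertex A2tilde :=
  exist _ (special_coset A2tilde w i) (ex_intro _ w (ex_intro _ i erefl)).

Lemma run_notin st x i : i \notin x -> corner (run st x) i = corner st i.
Proof.
elim: x st => [//|j x IH] st /=; rewrite inE negb_or => /andP[ij /IH ->].
case: st => -[p q] r; rewrite /corner.
by case: i ij {IH} => [[|[|[|i]]] Hi] //; case: j => [[|[|[|j]]] Hj].
Qed.

Lemma corner_type st i : valid st -> typ (corner st i) i.
Proof. by case: st => -[x y] z [[h0 h1 h2] _]; case: i => [[|[|[|i]]] Hi]. Qed.

Lemma corner_inj st st' i j : valid st -> valid st' -> corner st i = corner st' j -> i = j.
Proof.
move=> /(@corner_type _ i) [k h] /(@corner_type _ j)[k' h'] e; rewrite e h' in h.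
apply: val_inj; move: (ltn_ord i) (ltn_ord j) => /=; lia.
Qed.

Lemma special_coset_refl w i : special_coset A2tilde w i w.
Proof. by exists [::] => //; rewrite cats0; exact: coxeter_refl. Qed.

Lemma special_coset_corner w i u : special_coset A2tilde w i u ->
  corner (run base u) i = corner (run base w) i.
Proof. by case=> x ix /run_sound->; rewrite run_cat run_notin. Qed.

(** The letters other than [i] act transitively on the triangles with a given corner [i], and
    [run_complete] turns equality of triangles into equality of group elements. *)
Lemma special_cosetP w w' i : corner (run base w) i = corner (run base w') i ->
  special_coset A2tilde w i = special_coset A2tilde w' i.
Proof.
suff sub v v' : corner (run base v) i = corner (run base v') i ->
    special_coset A2tilde v i `<=` special_coset A2tilde v' i.
  by move=> e; apply/seteqP; split; exact: sub.
move=> e u /special_coset_corner; rewrite e => /esym e'.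
have [x ix h] := valid_fan (valid_run v') (valid_run u) e'.
by exists x => //; apply: run_complete; rewrite run_cat h.
Qed.

Lemma special_coset_same w i w' j :
  special_coset A2tilde w i = special_coset A2tilde w' j ->
  corner (run base w) i = corner (run base w') j.
Proof.
move=> e.
have h : corner (run base w') j = corner (run base w) j.
  by rewrite (@special_coset_corner w' j w) // -e; exact: special_coset_refl.
have [->//|ij] := eqVneq i j.
(* For distinct indices, appending [j] would stay in the first coset and yet move corner [j]. *)
have : special_coset A2tilde w' j (w ++ [:: j]).
  rewrite -e; exists [:: j]; first by rewrite inE.
  exact: coxeter_refl.
move=> /special_coset_corner; rewrite h run_cat /=.
have [_ adj] := valid_run w; move: (run base w) adj => [[[x1 x2] [y1 y2]] [z1 z2]].
rewrite /ladj !lat_eqE /=.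
by case: j {ij h e} => [[|[|[|j]]] Hj] //= adj [] /=; lia.
Qed.

(** * The Coxeter complex as the clique complex of the lattice *)

Definition lface (s : set lattice) :=
  s !=set0 /\ forall x y, s x -> s y -> x <> y -> ladj x y.

Lemma ladj_sym x y : ladj x y -> ladj y x.
Proof. by rewrite !ladj_hexdist /hexdist; lia. Qed.

Lemma ladj_neq x y : ladj x y -> x <> y.
Proof. by move=> /andP[/eqP]. Qed.

Lemma valid_lface st : valid st -> lface [set z | exists i, z = corner st i].
Proof.
case: st => -[x y] z [_ /and3P[/= xy xz yz]].
split; first by exists x; exists a.
move=> _ _ [i ->] [j ->].
have yx := ladj_sym xy; have zx := ladj_sym xz; have zy := ladj_sym yz.
by case: i => [[|[|[|i]]] Hi] //; case: j => [[|[|[|j]]] Hj].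
Qed.

Lemma type_exists z : exists r, (r < 3)%N /\ typ z r.
Proof.
exists (absz ((z.1 - z.2) %% 3)%Z); split; first by lia.
by exists ((z.1 - z.2) %/ 3)%Z; lia.
Qed.

Lemma ladj_type x y r : ladj x y -> typ x r -> typ y r -> False.
Proof.
case: x y => [x1 x2] [y1 y2]; rewrite /ladj lat_eqE /= => xy [k /= ek] [l /= el].
lia.
Qed.

(** Mutually adjacent vertices have different types, so in a suitable order they form a valid
    state. *)
Lemma triangle_reach x y z : ladj x y -> ladj x z -> ladj y z ->
  exists w, forall p, [\/ p = x, p = y | p = z] -> exists i, corner (run base w) i = p.
Proof.
have base_case u v t : ladj u v -> ladj u t -> ladj v t ->
    typ u 0 -> typ v 1 -> typ t 2 ->
    exists w, [/\ corner (run base w) a = u, corner (run base w) b = v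
      & corner (run base w) c = t].
  move=> uv ut vt tu tv tt; have [w e] : exists w, run base w = (u, v, t).
    by apply: valid_reach; split=> //; apply/and3P.
  by exists w; rewrite e.
move=> xy xz yz; have yx := ladj_sym xy; have zx := ladj_sym xz; have zy := ladj_sym yz.
have [r [r3 tx]] := type_exists x; have [s [s3 ty]] := type_exists y.
have [t [t3 tz]] := type_exists z.
case: r r3 tx => [|[|[|r]]] // _ tx; case: s s3 ty => [|[|[|s]]] // _ ty;
case: t t3 tz => [|[|[|t]]] // _ tz;
try (by case: (ladj_type xy tx ty)); try (by case: (ladj_type xz tx tz));
try (by case: (ladj_type yz ty tz)).
- have [w [h1 h2 h3]] := base_case _ _ _ xy xz yz tx ty tz.
  by exists w => p [] ->; eexists; eassumption.
- have [w [h1 h2 h3]] := base_case _ _ _ xz xy zy tx tz ty.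
  by exists w => p [] ->; eexists; eassumption.
- have [w [h1 h2 h3]] := base_case _ _ _ yx yz xz ty tx tz.
  by exists w => p [] ->; eexists; eassumption.
- have [w [h1 h2 h3]] := base_case _ _ _ zx zy xy tz tx ty.
  by exists w => p [] ->; eexists; eassumption.
- have [w [h1 h2 h3]] := base_case _ _ _ yz yx zx ty tz tx.
  by exists w => p [] ->; eexists; eassumption.
- have [w [h1 h2 h3]] := base_case _ _ _ zy zx yx tz ty tx.
  by exists w => p [] ->; eexists; eassumption.
Qed.

Lemma third_vertex x y : ladj x y -> exists z, ladj x z /\ ladj y z.
Proof.
move=> xy; exists (x.1 - (y.2 - x.2), x.2 + (y.1 - x.1) + (y.2 - x.2)).
by move: xy; case: x y => [x1 x2] [y1 y2]; rewrite /ladj !lat_eqE /=; lia.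
Qed.

Lemma neighbor x : ladj x (x.1 + 1, x.2).
Proof. by case: x => [x1 x2]; rewrite /ladj lat_eqE /=; lia. Qed.

Lemma lface_triangle s : lface s -> exists x y z,
  [/\ ladj x y, ladj x z, ladj y z & forall p, s p -> [\/ p = x, p = y | p = z]].
Proof.
move=> [[x sx] cl]; have [[y [sy xy]]|ny] := EM (exists y, s y /\ x <> y); last first.
  have [z [h1 h2]] := third_vertex (neighbor x).
  exists x, (x.1 + 1, x.2), z; split=> //; first exact: neighbor.
  by move=> p sp; constructor 1; apply: contrapT => px; apply: ny; exists p; split=> // /esym.
have axy := cl _ _ sx sy xy.
have [[z [sz xz yz]]|nz] := EM (exists z, [/\ s z, x <> z & y <> z]); last first.
  have [z [h1 h2]] := third_vertex axy.
  exists x, y, z; split=> // p sp.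
  have [->|px] := EM (p = x); first by constructor 1.
  constructor 2; apply: contrapT => py; apply: nz; exists p.
  by split=> // /esym.
have axz := cl _ _ sx sz xz; have ayz := cl _ _ sy sz yz.
exists x, y, z; split=> // p sp.
have [->|px] := EM (p = x); first by constructor 1.
have [->|py] := EM (p = y); first by constructor 2.
constructor 3; apply: contrapT => pz.
exact: (no_four_clique axy axz (cl _ _ sx sp (nesym px)) ayz
  (cl _ _ sy sp (nesym py)) (cl _ _ sz sp (nesym pz))).
Qed.

Theorem coxeter_lattice : exists psi : lattice -> coxeter_vertex A2tilde,
  injective psi /\ face (coxeter_complex A2tilde) = [set psi @` s | s in lface].
Proof.
have surj z : exists wi, corner (run base wi.1) wi.2 = z.
  have [t [h1 h2]] := third_vertex (neighbor z).
  have [w /(_ z (Or31 _ _ erefl))[i hi]] := triangle_reach (neighbor z) h1 h2.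
  by exists (w, i).
have [f fP] := choice surj.
pose psi z := vtx (f z).1 (f z).2.
have vtxE w i : vtx w i = psi (corner (run base w) i).
  apply: eq_exist; have := fP (corner (run base w) i) => h.
  have e := corner_inj (valid_run _) (valid_run _) h.
  by rewrite e in h; rewrite /= e; apply: special_cosetP; rewrite h.
have psi_inj : injective psi.
  move=> z z' e; have := congr1 sval e => /= /special_coset_same.
  by rewrite !fP.
exists psi; split=> //; apply/seteqP; split=> [t [t0 [w tw]]|_ [s sf <-]].
  have tE c : t c -> exists i, c = psi (corner (run base w) i).
    move=> /tw [i ci]; exists i; rewrite -vtxE.
    by case: c ci => c cP /= ci; apply: eq_exist.
  exists [set z | t (psi z)]; last first.
    apply/seteqP; split=> [_ [z tz <-]//|c tc]; have [i ci] := tE _ tc.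
    by exists (corner (run base w) i); rewrite /= -?ci.
  have [_ cl] := valid_lface (valid_run w).
  split.
    by case: t0 => c tc; have [i ci] := tE _ tc; exists (corner (run base w) i); rewrite /= -ci.
  move=> x y /= /tE[i /psi_inj xi] /tE[j /psi_inj yj].
  by apply: cl; [exists i|exists j].
split; first by case: sf => -[z sz] _; exists (psi z); exists z.
have [x [y [z [xy xz yz sxyz]]]] := lface_triangle sf.
have [w wP] := triangle_reach xy xz yz.
exists w => _ [p /sxyz/wP[i <-] <-]; exists i.
by rewrite -vtxE.
Qed.

(** * Neighbourhoods and distances in the lattice *)

Definition hexagon : seq lattice :=
  [:: (1, 0); (0, 1); (-1, 1); (-1, 0); (0, -1); (1, -1)].

Lemma ladjP x y : ladj x y -> exists2 u, u \in hexagon & y = x + u.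
Proof.
move=> xy; exists (y - x); last by rewrite addrC subrK.
move: xy; case: x y => [x1 x2] [y1 y2]; rewrite /ladj !inE !lat_eqE /=.
lia.
Qed.

Lemma hexagon_ladj x u : u \in hexagon -> ladj x (x + u).
Proof.
move=> hu; have -> : ladj x (x + u) = ladj 0 u by rewrite -(ladj_add x 0) addr0.
by move: u hu; apply/allP.
Qed.

Lemma two_common x y z w u : ladj x y -> ladj x z -> ladj y z -> ladj x w ->
  ladj y w -> ladj x u -> ladj y u -> z <> w -> u = z \/ u = w.
Proof.
move=> /ladjP[p hp ->] /ladjP[q hq ->] + /ladjP[r hr ->] + /ladjP[t ht ->].
rewrite !ladj_add => pq pr pt qr; have {}qr : q <> r by move=> e; apply: qr; rewrite e.
suff /orP[/eqP->|/eqP->] : (t == q) || (t == r) by [left|right].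
apply: contraT => h; case: qr; apply/eqP; apply: contraT => qr.
have /allP/(_ p hp)/allP/(_ q hq)/implyP/(_ pq)/allP/(_ r hr)/implyP/(_ pr)/allP/(_ t ht) :
  all (fun p => all (fun q => ladj p q ==> all (fun r => ladj p r ==> all (fun t =>
    ladj p t ==> [|| q == r, t == q | t == r])
    hexagon) hexagon) hexagon) hexagon by vm_compute.
by rewrite pt (negbTE qr) (negbTE h).
Qed.

(** [x + z - y] is the vertex that follows [y] and [z] on the hexagon around [x]. *)
Lemma ladj_turn x y z : ladj x y -> ladj x z -> ladj y z ->
  ladj x (x + z - y) /\ ladj z (x + z - y).
Proof.
move=> /ladjP[p hp ->] /ladjP[q hq ->]; rewrite ladj_add.
have -> : x + (x + q) - (x + p) = x + (q - p) by rewrite -addrA [x + q]addrC addrKA.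
move=> pq; rewrite ladj_add -[X in ladj X]addr0 ladj_add.
have /allP/(_ p hp)/allP/(_ q hq) : all (fun p => all (fun q =>
  ladj p q ==> ladj 0 (q - p) && ladj q (q - p)) hexagon) hexagon by vm_compute.
by rewrite pq => /andP.
Qed.

Lemma hexagon_around x y z w : ladj x y -> ladj x z -> ladj y z -> ladj x w ->
  let t1 := x + z - y in let t2 := x + t1 - z in let t3 := x + t2 - t1 in
  let t4 := x + t3 - t2 in w \in [:: y; z; t1; t2; t3; t4].
Proof.
move=> /ladjP[p hp ->] /ladjP[q hq ->]; rewrite ladj_add => pq /ladjP[r hr ->] /=.
have sub (u v : lattice) : x + (x + u) - (x + v) = x + (u - v).
  by rewrite -addrA [x + u]addrC addrKA.
rewrite !sub !inE !(inj_eq (addrI x)).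
have /allP/(_ p hp)/allP/(_ q hq)/allP/(_ r hr) : all (fun p => all (fun q =>
  all (fun r => ladj p q ==> [|| r == p, r == q, r == q - p, r == q - p - q,
    r == q - p - q - (q - p) | r == q - p - q - (q - p) - (q - p - q)])
  hexagon) hexagon) hexagon by vm_compute.
by rewrite pq.
Qed.

Lemma hexagon_no_square x a b c d : ladj x a -> ladj x b -> ladj x c -> ladj x d ->
  ladj a c -> ladj b c -> ladj a d -> ladj b d -> a <> b -> c = d.
Proof.
move=> /ladjP[p hp ->] /ladjP[q hq ->] /ladjP[r hr ->] /ladjP[t ht ->].
rewrite !ladj_add => pr qr pt qt pq; have {}pq : p != q.
  by apply/eqP => e; apply: pq; rewrite e.
have /allP/(_ p hp)/allP/(_ r hr)/implyP/(_ pr)/allP/(_ q hq)/implyP/(_ qr)/allP/(_ t ht) :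
  all (fun p => all (fun r => ladj p r ==> all (fun q => ladj q r ==> all (fun t =>
    [&& ladj p t, ladj q t & p != q] ==> (r == t))
    hexagon) hexagon) hexagon) hexagon by vm_compute.
by rewrite pt qt pq /= => /eqP->.
Qed.

(* Walking around a vertex, the colours of a proper 3-colouring alternate. *)
Lemma hexagon_join (col : lattice -> nat) x a b :
  (forall z w, ladj z w -> col z <> col w) -> (forall z, (col z < 3)%N) ->
  ladj x a -> ladj x b -> a <> b -> col a = col b ->
  exists c, [/\ ladj x c, ladj a c & ladj b c].
Proof.
move=> colP col3 /ladjP[p hp ->] /ladjP[q hq ->] pq cpq.
have /allP/(_ p hp)/allP/(_ q hq) :
  all (fun p => all (fun q => [|| p == q, ladj p q,
     has (fun w => ladj p w && ladj q w) hexagon |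
     has (fun w => ladj p w && has (fun z => ladj w z && ladj z q) hexagon) hexagon])
     hexagon) hexagon by [].
case/or4P => [/eqP e|h|/hasP[w hw /andP[pw qw]]|/hasP[w hw /andP[pw /hasP[z hz /andP[wz zq]]]]].
- by case: pq; rewrite e.
- by case: (colP (x + p) (x + q)); rewrite ?ladj_add.
- by exists (x + w); rewrite !ladj_add; split=> //; exact: hexagon_ladj.
- exfalso.
  have := colP _ _ (hexagon_ladj x hp); have := colP _ _ (hexagon_ladj x hw).
  have := colP _ _ (hexagon_ladj x hz); have := colP _ _ (hexagon_ladj x hq).
  move: pw wz zq; rewrite -(ladj_add x p) -(ladj_add x w) -(ladj_add x z).
  move=> /colP + /colP + /colP.
  move: (col3 x) (col3 (x + p)) (col3 (x + w)) (col3 (x + z)) (col3 (x + q)).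
  by lia.
Qed.

Lemma hexdist_le p q (n : nat) : (hexdist p q <= n)%N =
  [&& - n%:Z <= q.1 - p.1 <= n%:Z, - n%:Z <= q.2 - p.2 <= n%:Z &
      - n%:Z <= (q.1 - p.1) + (q.2 - p.2) <= n%:Z].
Proof. by rewrite /hexdist !geq_max; lia. Qed.

Lemma hexdist_step p q r : ladj q r -> (hexdist p r <= (hexdist p q).+1)%N.
Proof.
case: p q r => [p1 p2] [q1 q2] [r1 r2]; rewrite /ladj /hexdist lat_eqE /=; lia.
Qed.

Lemma hexdist_eq0 p q : hexdist p q = 0%N -> p = q.
Proof.
by case: p q => [p1 p2] [q1 q2]; rewrite /hexdist => h; apply: latP; move: h => /=; lia.
Qed.

Lemma hexdistxx p : hexdist p p = 0%N.
Proof. by case: p => [p1 p2]; rewrite /hexdist /=; lia. Qed.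

(** With [hexdist_edge] and [hexdist_nearer], the lattice case of the properties of geodesics
    collected in [building_distance]. *)
Lemma hexdist_pred p q n : hexdist p q = n.+1 ->
  exists2 r, ladj q r & hexdist p r = n.
Proof.
case: p q => [p1 p2] [q1 q2]; rewrite /hexdist /= => h.
suff [u [hu e]] : exists u, u \in hexagon /\ hexdist (p1, p2) ((q1, q2) + u) = n.
  by exists ((q1, q2) + u) => //; exact: hexagon_ladj.
rewrite /hexdist /=.
have [a0|a0] := leP 0 (q1 - p1); have [b0|b0] := leP 0 (q2 - p2).
- have [b1|b1] := ltP 0 (q2 - p2).
    by exists (0, -1); split=> //=; lia.
  by exists (-1, 0); split=> //=; lia.
- have [a1|a1] := ltP 0 (q1 - p1).
    by exists (-1, 1); split=> //=; lia.
  by exists (0, 1); split=> //=; lia.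
- have [b1|b1] := ltP 0 (q2 - p2).
    by exists (1, -1); split=> //=; lia.
  by exists (1, 0); split=> //=; lia.
- by exists (1, 0); split=> //=; lia.
Qed.

Lemma hexdist_edge p q r : ladj q r -> hexdist p q = hexdist p r ->
  exists w, [/\ ladj q w, ladj r w & hexdist p q = (hexdist p w).+1].
Proof.
move=> /ladjP[u hu ->] e.
suff [v [hv uv h]] : exists v, [/\ v \in hexagon, ladj u v &
    hexdist p q = (hexdist p (q + v)).+1].
  by exists (q + v); rewrite ladj_add; split=> //; exact: hexagon_ladj.
case: p q e => [p1 p2] [q1 q2]; rewrite /hexdist /=.
move: hu; rewrite !inE => /or4P[|||/or3P[||]] /eqP-> /= e.
- have [h|h] := ltP (q2 - p2) 0; first by exists (0, 1); split=> //=; lia.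
  by exists (1, -1); split=> //=; lia.
- have [h|h] := ltP (q1 - p1) 0; first by exists (1, 0); split=> //=; lia.
  by exists (-1, 1); split=> //=; lia.
- have [h|h] := ltP (q1 - p1 + (q2 - p2)) 0; first by exists (0, 1); split=> //=; lia.
  by exists (-1, 0); split=> //=; lia.
- have [h|h] := ltP (q2 - p2) 0; first by exists (-1, 1); split=> //=; lia.
  by exists (0, -1); split=> //=; lia.
- have [h|h] := ltP (q1 - p1) 0; first by exists (1, -1); split=> //=; lia.
  by exists (-1, 0); split=> //=; lia.
- have [h|h] := ltP (q1 - p1 + (q2 - p2)) 0; first by exists (1, 0); split=> //=; lia.
  by exists (0, -1); split=> //=; lia.
Qed.

Lemma hexdist_nearer p q r s : ladj q r -> ladj q s ->
  (hexdist p r < hexdist p q)%N -> (hexdist p s < hexdist p q)%N -> r <> s -> ladj r s.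
Proof.
move=> /ladjP[u hu ->] /ladjP[v hv ->] + + uv; rewrite ladj_add.
have {uv} : u != v by apply/eqP => e; apply: uv; rewrite e.
case E: (hexdist p q) => [//|n]; rewrite !ltnS.
have : ~~ (hexdist p q <= n)%N by rewrite E ltnn.
rewrite !hexdist_le; case: p q {E} => [p1 p2] [q1 q2].
by move: hu hv; rewrite !in_cons => /or4P[|||/or4P[|||//]] /eqP-> /or4P[|||/or4P[|||//]] /eqP->
  //=; lia.
Qed.

(** * Buildings of type A2tilde *)

Definition nb (V : choiceType) (Y : complex V) (v a : V) :=
  a <> v /\ face Y [set v; a].

Definition tri (V : choiceType) (Y : complex V) (v a b : V) :=
  [/\ a <> v, b <> v, a <> b & face Y [set v; a; b]].

Lemma lface1 z : lface [set z].
Proof. by split=> [|x y -> ->//]; exists z. Qed.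

Lemma lface2 z w : ladj z w -> lface [set z; w].
Proof.
move=> zw; split; first by exists z; left.
by move=> x y [] -> [] -> // _; exact: ladj_sym.
Qed.

Lemma lface3 x y z : ladj x y -> ladj x z -> ladj y z -> lface [set x; y; z].
Proof.
move=> xy xz yz; split; first by exists x; left; left.
by move=> p q [[]|] -> [[]|] -> // _; exact: ladj_sym.
Qed.

Section Building.
Context (V : choiceType) (Y : complex V).
Hypothesis bY : building_of_type A2tilde Y.

Definition charts_of (f g : lattice -> V) :=
  [set f @` s | s in lface] = [set g @` s | s in lface].

(** The building axioms with injections of the lattice in place of apartments. An isomorphism of
    apartments becomes a new chart [g'] of the apartment of [g] agreeing with [f] on the common
    simplices. *)
Lemma atlas : exists charts : set (lattice -> V), [/\ charts !=set0,
  forall f, charts f -> injective f /\ forall s, lface s -> face Y (f @` s),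
  forall s t, face Y s -> face Y t -> exists f a b,
    [/\ charts f, lface a, lface b, s = f @` a & t = f @` b] &
  forall f g a b a' b', charts f -> charts g ->
    lface a -> lface b -> lface a' -> lface b' ->
    f @` a = g @` a' -> f @` b = g @` b' ->
    exists g', [/\ charts g', charts_of g' g & forall p, (a `|` b) p -> g' p = f p]].
Proof.
have [_ [apts [apts0 aptsC aptsE aptsI]]] := bY.
have [psi [psi_inj psiF]] := coxeter_lattice.
pose charts := [set f | injective f /\ apts [set f @` s | s in lface]].
have chart A : apts A -> exists2 f, charts f & A = [set f @` s | s in lface].
  move=> Aa; have [_ [f [f_inj AE]]] := aptsC A Aa.
  have E : A = [set (f \o psi) @` s | s in lface].
    rewrite AE psiF; apply/seteqP; split=> [_ [_ [s sf <-] <-]|_ [s sf <-]].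
      by exists s => //; rewrite image_comp.
    by exists (psi @` s); [exists s|rewrite image_comp].
  exists (f \o psi) => //; split; last by rewrite -E.
  have mem p : (\bigcup_(s in face (coxeter_complex A2tilde)) s) (psi p).
    exists (psi @` [set p]); last by exists p.
    by rewrite psiF; exists [set p] => //; exact: lface1.
  move=> p q /= e; apply: psi_inj; apply: f_inj e; exact: mem_set.
exists charts; split.
- by have [A Aa] := apts0; have [f fc _] := chart A Aa; exists f.
- move=> f [f_inj fa]; split=> // s sf; have [sub _] := aptsC _ fa.
  by apply: sub; exists s.
- move=> s t Ys Yt; have [A [Aa As At]] := aptsE s t Ys Yt.
  have [f fc AE] := chart A Aa; rewrite AE in As At.
  have [a af <-] := As; have [b bf <-] := At; by exists f, a, b.
- move=> f g a b a' b' [f_inj fa] [g_inj ga] af bf a'f b'f eab eab'.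
  have [||||phi [[phi_inj phiE] phi_fix]] := aptsI _ _ (f @` a) (f @` b) fa ga.
  + by exists a.
  + by exists b.
  + by exists a'.
  + by exists b'.
  have imE : [set (phi \o f) @` s | s in lface] = [set g @` s | s in lface].
    rewrite phiE; apply/seteqP; split=> [_ [s sf <-]|_ [_ [s sf <-] <-]].
      by exists (f @` s); [exists s|rewrite image_comp].
    by exists s => //; rewrite image_comp.
  exists (phi \o f); split=> //.
    split; last by rewrite imE.
    move=> p q /= e; apply: f_inj; apply: phi_inj e; apply: mem_set.
      by exists (f @` [set p]); [exists [set p] => //; exact: lface1|exists p].
    by exists (f @` [set q]); [exists [set q] => //; exact: lface1|exists q].
  move=> p pab /=; apply: phi_fix; case: pab => h; [left|right]; by exists p.
Qed.
End Building.

(** * Retractions, links and distances in a building of type [A2tilde] *)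

Section Atlas.
Context (V : choiceType) (Y : complex V) (charts : set (lattice -> V)).
Hypothesis chart_ex : charts !=set0.
Hypothesis chart_face : forall f, charts f ->
  injective f /\ forall s, lface s -> face Y (f @` s).
Hypothesis chart_two : forall s t, face Y s -> face Y t -> exists f a b,
  [/\ charts f, lface a, lface b, s = f @` a & t = f @` b].
Hypothesis chart_move : forall f g a b a' b', charts f -> charts g ->
  lface a -> lface b -> lface a' -> lface b' ->
  f @` a = g @` a' -> f @` b = g @` b' ->
  exists g', [/\ charts g', charts_of g' g & forall p, (a `|` b) p -> g' p = f p].

Lemma chart_inj f : charts f -> injective f.
Proof. by move=> /chart_face[]. Qed.

Lemma chart_nb f p q : charts f -> ladj p q -> nb Y (f p) (f q).
Proof.
move=> fc pq; have [f_inj fF] := chart_face fc.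
split; first by move=> /f_inj e; exact: (ladj_neq pq).
by have := fF _ (lface2 pq); rewrite image_setU !image_set1.
Qed.

Lemma chart_tri f p q r : charts f -> ladj p q -> ladj p r -> ladj q r ->
  tri Y (f p) (f q) (f r).
Proof.
move=> fc pq pr qr; have [f_inj fF] := chart_face fc.
split; [by move=> /f_inj e; exact: (ladj_neq pq)|
  by move=> /f_inj e; exact: (ladj_neq pr)|by move=> /f_inj; exact: (ladj_neq qr)|].
by have := fF _ (lface3 pq pr qr); rewrite !image_setU !image_set1.
Qed.

Lemma charts_of_adj (g h : lattice -> V) x y x' y' :
  charts g -> charts h -> charts_of g h ->
  g x = h x' -> g y = h y' -> ladj x y -> ladj x' y'.
Proof.
move=> gc hc gh ex ey xy; have h_inj := chart_inj hc.
have : [set g @` s | s in lface] (g @` [set x; y]) by exists [set x; y] => //; exact: lface2.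
rewrite gh => -[s [_ sf] sE].
have : (h @` s) (g x) by rewrite sE; exists x => //; left.
rewrite ex => -[x1 sx1 /h_inj e1]; subst x1.
have : (h @` s) (g y) by rewrite sE; exists y => //; right.
rewrite ey => -[y1 sy1 /h_inj e1]; subst y1.
apply: sf => // e; apply: (ladj_neq xy); apply: (chart_inj gc).
by rewrite ex ey e.
Qed.

Lemma charts_of_onto (g h : lattice -> V) x : charts_of g h -> exists x', g x = h x'.
Proof.
move=> gh; have : [set g @` s | s in lface] (g @` [set x]) by exists [set x] => //; exact: lface1.
rewrite gh => -[s [[z sz] _] sE].
have : (g @` [set x]) (h z) by rewrite -sE; exists z.
by case=> _ -> e; exists z.
Qed.

Section Rigid.
Context (g h : lattice -> V).
Hypotheses (gc : charts g) (hc : charts h) (gh : charts_of g h).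

Let step x y z w : ladj x y -> ladj x z -> ladj y z -> ladj x w -> ladj y w ->
  g x = h x -> g y = h y -> g z = h z -> g w = h w.
Proof.
move=> xy xz yz xw yw ex ey ez.
have [w' ew] := charts_of_onto w gh.
have [<-//|zw] := EM (z = w).
have zw' : z <> w' by move=> e; apply: zw; apply: (chart_inj gc); rewrite ez ew e.
have xw' := charts_of_adj gc hc gh ex ew xw.
have yw' := charts_of_adj gc hc gh ey ew yw.
by rewrite ew; case: (two_common xy xz yz xw' yw' xw yw zw') => e; [case: zw|rewrite e].
Qed.

Let around x y z w : ladj x y -> ladj x z -> ladj y z -> ladj x w ->
  g x = h x -> g y = h y -> g z = h z -> g w = h w.
Proof.
move=> xy xz yz xw ex ey ez.
have [xt1 zt1] := ladj_turn xy xz yz.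
have [xt2 t1t2] := ladj_turn xz xt1 zt1.
have [xt3 t2t3] := ladj_turn xt1 xt2 t1t2.
have [xt4 t3t4] := ladj_turn xt2 xt3 t2t3.
have e1 := step xz xy (ladj_sym yz) xt1 zt1 ex ez ey.
have e2 := step xt1 xz (ladj_sym zt1) xt2 t1t2 ex e1 ez.
have e3 := step xt2 xt1 (ladj_sym t1t2) xt3 t2t3 ex e2 e1.
have e4 := step xt3 xt2 (ladj_sym t2t3) xt4 t3t4 ex e3 e2.
have := hexagon_around xy xz yz xw; cbv zeta; rewrite !inE.
by case/or4P => [|||/or3P[||]] /eqP->.
Qed.

(** Agreement on a triangle passes to the vertex across each edge, since an edge has only two common
    neighbours, then around each hexagon, and then outwards by induction on the distance. *)
Lemma charts_of_rigid x y z : ladj x y -> ladj x z -> ladj y z ->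
  g x = h x -> g y = h y -> g z = h z -> g = h.
Proof.
move=> xy xz yz ex ey ez; apply: funext => w.
have : forall n q, hexdist x q = n -> g q = h q /\ forall w, ladj q w -> g w = h w.
  elim=> [|n IH] q.
    by move=> /hexdist_eq0 <-; split=> // w' xw; exact: (around xy xz yz).
  move=> /hexdist_pred[r qr /IH[er rw]]; have rq := ladj_sym qr.
  split=> [|t qt]; first exact: rw.
  have [s [rs qs]] := third_vertex rq.
  by apply: (around qr qs rs qt) => //; exact: rw.
by move=> /(_ _ w erefl)[].
Qed.

End Rigid.

(* A chart [f] and a triangle [x y z] give a retraction onto the apartment of
   [f]: each vertex is carried into it by a chart agreeing with [f] on the
   triangle. *)
Lemma retraction f x y z : charts f -> ladj x y -> ladj x z -> ladj y z ->
  exists r : V -> lattice,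
  [/\ forall g p, charts g -> g x = f x -> g y = f y -> g z = f z -> r (g p) = p &
      forall s, face Y s -> exists g b, [/\ charts g, g x = f x /\ g y = f y /\ g z = f z,
        lface b & s = g @` b]].
Proof.
move=> fc xy xz yz; pose c := [set x; y; z]; have cf : lface c := lface3 xy xz yz.
have fx := (chart_face fc).2 _ cf.
have ex s : face Y s -> exists g b, [/\ charts g,
    g x = f x /\ g y = f y /\ g z = f z, lface b & s = g @` b].
  move=> Ys; have [h [a [b [hc af bf ea eb]]]] := chart_two fx Ys.
  have [g [gc gh gE]] := chart_move fc hc cf cf af af ea ea.
  have : [set g @` s | s in lface] s by rewrite gh; exists b.
  move=> [b' b'f b'E]; exists g, b'; split=> //.
  by split; [|split]; apply: gE; left; [left; left|left; right|right].
have exv v : exists p, exists2 g, charts g /\ (g x = f x /\ g y = f y /\ g z = f z) & g p = v.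
  have [g [b [gc gE bf vE]]] := ex _ (face_vertex Y v).
  have : [set v] v by []. 
  by rewrite vE => -[p _ <-]; exists p, g.
have [r rP] := choice exv; exists r; split=> // g p gc gx gy gz.
have [h [hc [hx [hy hz]]] e] := rP (g p).
have hgc : h @` c = g @` c.
  by rewrite /c !image_setU !image_set1 hx hy hz gx gy gz.
have hgp : h @` [set r (g p)] = g @` [set p] by rewrite !image_set1 e.
(* Independence of the chart: [h] is moved into the apartment of [g] without changing it on the
   triangle and at the vertex; by rigidity the result is [g]. *)
have [g' [g'c g'g g'E]] := chart_move hc gc cf (lface1 _) cf (lface1 _) hgc hgp.
have g'x : g' x = g x by rewrite gx -hx; apply: g'E; left; left; left.
have g'y : g' y = g y by rewrite gy -hy; apply: g'E; left; left; right.
have g'z : g' z = g z by rewrite gz -hz; apply: g'E; left; right.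
have g'gE := charts_of_rigid g'c gc g'g xy xz yz g'x g'y g'z.
apply: (chart_inj gc); transitivity (g' (r (g p))); first by rewrite g'gE.
by rewrite -[RHS]e; apply: g'E; right.
Qed.

Lemma base_retraction f : charts f -> exists x y z (r : V -> lattice),
  [/\ forall g p, charts g -> g x = f x -> g y = f y -> g z = f z -> r (g p) = p &
      forall s, face Y s -> exists g b, [/\ charts g,
        g x = f x /\ g y = f y /\ g z = f z, lface b & s = g @` b]].
Proof.
move=> fc; have [y xy] : exists y, ladj 0 y by eexists; exact: neighbor.
have [z [xz yz]] := third_vertex xy.
by exists 0, y, z; exact: retraction.
Qed.

(** The retraction onto the apartment of [f] is simplicial and fixes it, so faces of [Y] cannot join
    non-adjacent vertices of it. *)
Lemma chart_full f p q s : charts f -> face Y s -> s (f p) -> s (f q) ->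
  p <> q -> ladj p q.
Proof.
move=> fc Ys sp sq pq; have [x0 [y0 [z0 [r [rK rF]]]]] := base_retraction fc.
have [g [b [gc [gx [gy gz]] [_ bf] sE]]] := rF s Ys.
have mem x : s (f x) -> b x.
  rewrite sE => -[y yb e]; suff -> : x = y by [].
  by rewrite -(rK f x fc erefl erefl erefl) -e rK.
by apply: bf => //; exact: mem.
Qed.

Lemma nb_sym v a : nb Y v a -> nb Y a v.
Proof. by case=> av ?; split; [exact: nesym|rewrite setUC]. Qed.

Lemma tri_nb v a b : tri Y v a b -> nb Y v a.
Proof.
case=> av _ _ f; split=> //; apply: face_sub f _ _; first by left.
by exists v; left.
Qed.

Lemma tri_sym v a b : tri Y v a b -> tri Y v b a.
Proof. by case=> av bv ab ?; split=> //; [exact: nesym|rewrite setUAC]. Qed.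

Lemma nb_chart v a b : nb Y v a -> nb Y v b ->
  exists f p q r, charts f /\ [/\ f p = v, f q = a, f r = b, ladj p q & ladj p r].
Proof.
move=> [av Ya] [bv Yb]; have [f [c [d [fc cf df ce de]]]] := chart_two Ya Yb.
have f_inj := chart_inj fc.
have [p cp pe] : (f @` c) v by rewrite -ce; left.
have [q cq qe] : (f @` c) a by rewrite -ce; right.
have [p' dp pe'] : (f @` d) v by rewrite -de; left.
have [r dr re] : (f @` d) b by rewrite -de; right.
have pp : p' = p by apply: f_inj; rewrite pe.
exists f, p, q, r; split=> //; split=> //.
  by apply: cf.2 => // e; apply: av; rewrite -pe e.
by rewrite pp in dp; apply: df.2 => // e; apply: bv; rewrite -pe e.
Qed.

(** The three types of lattice vertices, pulled back along a retraction. *)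
Lemma coloring : exists col : V -> nat, (forall v, (col v < 3)%N) /\
  forall s u v, face Y s -> s u -> s v -> u <> v -> col u <> col v.
Proof.
have [f fc] := chart_ex; have [x0 [y0 [z0 [r [rK rF]]]]] := base_retraction fc.
have [ty tyP] := choice type_exists.
exists (ty \o r); split=> [v|s u v Ys su sv uv]; first by case: (tyP (r v)).
have [g [b [gc [gx [gy gz]] [_ bf] sE]]] := rF s Ys.
have [p bp pe] : (g @` b) u by rewrite -sE.
have [q bq qe] : (g @` b) v by rewrite -sE.
rewrite /= -pe -qe !rK // => e.
have pq : ladj p q by apply: bf => // e'; apply: uv; rewrite -pe -qe e'.
by apply: (ladj_type pq (tyP p).2); rewrite e; exact: (tyP q).2.
Qed.

(** Joins and their uniqueness are read in an apartment containing the two given edges or triangles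
    at [v], where the link is a hexagon. *)
Lemma link_gen_triangle v : exists t, gen_triangle (nb Y v) (tri Y v) t.
Proof.
have [col [col3 colP]] := coloring.
have colN a : nb Y v a -> col v <> col a.
  by move=> [av f]; apply: (colP _ _ _ f); [left|right|exact: nesym].
have colT a b : tri Y v a b -> col a <> col b.
  by move=> [_ _ ab f]; apply: (colP _ _ _ f); [left; right|right|].
exists (fun a => col a == ((col v).+1 %% 3)%N); split.
- exact: tri_sym.
- exact: tri_nb.
- move=> a b vab; have := colT _ _ vab.
  have := colN _ (tri_nb vab); have := colN _ (tri_nb (tri_sym vab)).
  move: (col3 v) (col3 a) (col3 b); lia.
- move=> a b va vb ab cab.
  have {}cab : col a = col b.
    move: (colN _ va) (colN _ vb) (col3 v) (col3 a) (col3 b) cab; lia.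
  have [f [p [q [r [fc [fp fq fr pq pr]]]]]] := nb_chart va vb.
  have qr : q <> r by move=> e; apply: ab; rewrite -fq -fr e.
  have [|||w [pw qw rw]] := @hexagon_join (col \o f) p q r _ _ pq pr qr.
  + move=> z w zw /=; have [nzw f'] := chart_nb fc zw.
    by apply: (colP _ _ _ f'); [left|right|exact: nesym].
  + by move=> z /=.
  + by rewrite /= fq fr.
  by exists (f w); rewrite -fp -fq -fr; split; exact: chart_tri.
move=> a b c d ab ac bc ad bd; apply: contrapT => cd.
have [_ _ _ Fac] := ac; have [_ _ _ Fbd] := bd.
have [f [s [t [fc sf tf sE tE]]]] := chart_two Fac Fbd.
have [p sp pv] : (f @` s) v by rewrite -sE; left; left.
have [qa sa qae] : (f @` s) a by rewrite -sE; left; right.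
have [qc sc qce] : (f @` s) c by rewrite -sE; right.
have [qb tb qbe] : (f @` t) b by rewrite -tE; left; right.
have [qd td qde] : (f @` t) d by rewrite -tE; right.
have adj x y q q' : tri Y v x y -> f q = x -> f q' = y -> ladj p q /\ ladj q q'.
  move=> [xv yv xy F] qx qy.
  have Fp : [set v; x; y] (f p) by rewrite pv; left; left.
  have Fq : [set v; x; y] (f q) by rewrite qx; left; right.
  have Fq' : [set v; x; y] (f q') by rewrite qy; right.
  split; [apply: chart_full fc F Fp Fq _|apply: chart_full fc F Fq Fq' _] => e.
    by apply: xv; rewrite -pv e.
  by apply: xy; rewrite -qx e.
have [pa ac'] := adj _ _ _ _ ac qae qce; have [pb bc'] := adj _ _ _ _ bc qbe qce.
have [_ ad'] := adj _ _ _ _ ad qae qde; have [_ bd'] := adj _ _ _ _ bd qbe qde.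
have [pc _] := adj _ _ _ _ (tri_sym ac) qce qae.
have [pd _] := adj _ _ _ _ (tri_sym bd) qde qbe.
apply: cd; rewrite -qce -qde; congr f.
apply: (hexagon_no_square pa pb pc pd ac' bc' ad' bd') => e.
by apply: ab; rewrite -qae e.
Qed.

Lemma chart_lipschitz (phi : V -> nat) f p q :
  (forall u v, nb Y u v -> (phi v <= (phi u).+1)%N) -> charts f ->
  (phi (f q) <= phi (f p) + hexdist p q)%N.
Proof.
move=> phiP fc; move E: (hexdist p q) => n; elim: n q E => [|n IH] q.
  by move=> /hexdist_eq0 ->; rewrite addn0.
move=> /hexdist_pred[r qr /IH h]; apply: leq_trans (phiP _ _ (chart_nb fc (ladj_sym qr))) _.
by rewrite addnS ltnS.
Qed.

(** [d] is the lattice distance after retraction from a triangle at [o]. For the first four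
    properties an apartment containing [o] and the given simplex suffices; in the last, [o], [u1]
    and [u2] need not share an apartment. *)
Lemma building_distance o : exists d : V -> nat, [/\
  forall v, d v = 0%N <-> v = o,
  forall u v, nb Y u v -> (d v <= (d u).+1)%N,
  forall v n, d v = n.+1 -> exists u, nb Y v u /\ d u = n,
  forall u v, nb Y u v -> d u = d v -> exists w, tri Y u v w /\ d u = (d w).+1 &
  forall v u1 u2, nb Y v u1 -> nb Y v u2 -> d v = (d u1).+1 -> d v = (d u2).+1 ->
    u1 <> u2 -> tri Y v u1 u2].
Proof.
have [f [a [_ [fc af _ fa _]]]] := chart_two (face_vertex Y o) (face_vertex Y o).
have [p0 _ fp0] : (f @` a) o by rewrite -fa.
have [t [h1 h2]] := third_vertex (neighbor p0).
have [r [rK rF]] := retraction fc (neighbor p0) h1 h2.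
pose d v := hexdist p0 (r v).
have ro : r o = p0 by rewrite -fp0 rK.
have at_ v : exists g p, [/\ charts g, r v = p, g p = v, g p0 = o & forall q, r (g q) = q].
  have [g [b [gc [gx [gy gz]] _ vE]]] := rF _ (face_vertex Y v).
  have [p _ gp] : (g @` b) v by rewrite -vE.
  have gK q : r (g q) = q by rewrite rK.
  by exists g, p; split; rewrite // -?gp ?gK // gx.
have dnb u v : nb Y u v -> (d v <= (d u).+1)%N.
  move=> [uv Yuv]; have [g [b [gc [gx [gy gz]] [_ bf] sE]]] := rF _ Yuv.
  have [p bp gp] : (g @` b) u by rewrite -sE; left.
  have [q bq gq] : (g @` b) v by rewrite -sE; right.
  rewrite /d -gp -gq !rK //; apply: hexdist_step; apply: bf => // e.
  by apply: uv; rewrite -gp -gq e.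
exists d; split=> //.
- move=> v; split=> [/hexdist_eq0 h|->]; last by rewrite /d ro hexdistxx.
  by have [g [p [gc rv <- <- _]]] := at_ v; rewrite -rv -h.
- move=> v n; have [g [p [gc rv gp _ gK]]] := at_ v; rewrite /d rv.
  move=> /hexdist_pred[q pq e]; exists (g q); rewrite gK; split=> //.
  by rewrite -gp; exact: chart_nb.
- move=> u v [uv Yuv]; have [g [b [gc [gx [gy gz]] [_ bf] sE]]] := rF _ Yuv.
  have [p bp gp] : (g @` b) u by rewrite -sE; left.
  have [q bq gq] : (g @` b) v by rewrite -sE; right.
  have pq : ladj p q by apply: bf => // e; apply: uv; rewrite -gp -gq e.
  rewrite /d -gp -gq !rK // => e; have [w [pw qw ew]] := hexdist_edge pq e.
  by exists (g w); rewrite rK //; split=> //; exact: chart_tri.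
move=> v u1 u2 vu1 vu2 du1 du2 u12.
have [e [p [q1 [q2 [ec [ep eq1 eq2 pq1 pq2]]]]]] := nb_chart vu1 vu2.
have [q12|q12] := EM (ladj q1 q2).
  by rewrite -ep -eq1 -eq2; exact: chart_tri.
exfalso; apply: q12.
(* Measure distances from [o] in an apartment containing [o] and a triangle on
   [v] and [u1]; the retraction onto it centred at this triangle is injective on
   the apartment of [e], which contains [u1] and [u2]. *)
have [w [pw q1w]] := third_vertex pq1.
have [_ eF] := chart_face ec.
have [h [c [b [hc cf bf ec' ob]]]] := chart_two (eF _ (lface3 pq1 pw q1w)) (face_vertex Y o).
have [f' [f'c f'h f'E]] := chart_move ec hc (lface3 pq1 pw q1w) (lface3 pq1 pw q1w) cf cf ec' ec'.
have f'p : f' p = e p by apply: f'E; left; left; left.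
have f'q : f' q1 = e q1 by apply: f'E; left; left; right.
have f'w : f' w = e w by apply: f'E; left; right.
have [p0' f'p0] : exists p0', f' p0' = o.
  have : [set f' @` s | s in lface] [set o] by rewrite f'h; exists b.
  case=> s [[z sz] _] sE; exists z.
  by have : [set o] (f' z) by rewrite -sE; exists z.
have [r' [r'K r'F]] := retraction f'c pq1 pw q1w.
pose D v := hexdist p0' (r' v).
have Dnb u u' : nb Y u u' -> (D u' <= (D u).+1)%N.
  move=> [uv Yuv]; have [g [b' [gc [gx [gy gz]] [_ b'f] sE]]] := r'F _ Yuv.
  have [s bs gs] : (g @` b') u by rewrite -sE; left.
  have [s' bs' gs'] : (g @` b') u' by rewrite -sE; right.
  rewrite /D -gs -gs' !r'K //; apply: hexdist_step; apply: b'f => // ee.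
  by apply: uv; rewrite -gs -gs' ee.
have r'e s : r' (e s) = s by rewrite r'K.
have Do : D o = 0%N by rewrite /D -f'p0 r'K // hexdistxx.
(* [u] lies in a chart through [o] at lattice distance [d u], and [D] starts from 0 at [o] and grows
   by at most one along each edge. *)
have Dd u : (D u <= d u)%N.
  have [g [s [gc ru <- go gK]]] := at_ u.
  have := chart_lipschitz p0 s Dnb gc; rewrite go Do add0n /d gK.
  by [].
(* The converse estimate at [v], which lies with [o] in the apartment of [f']. *)
have dD : (d v <= hexdist p0' p)%N.
  have := chart_lipschitz p0' p dnb f'c; rewrite f'p f'p0 ep.
  by have -> : d o = 0%N by rewrite /d ro hexdistxx.
apply: (hexdist_nearer (p := p0') pq1 pq2).
- apply: leq_trans dD; rewrite du1 ltnS; have := Dd u1; by rewrite /D -eq1 r'e.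
- apply: leq_trans dD; rewrite du2 ltnS; have := Dd u2; by rewrite /D -eq2 r'e.
- by move=> eq12; apply: u12; rewrite -eq1 -eq2 eq12.
Qed.

Lemma building_triangle : exists x y z, [/\ x <> y, x <> z, y <> z &
  face Y [set x; y; z]].
Proof.
have [f fc] := chart_ex.
have [q q0] : exists q, ladj 0 q by eexists; exact: neighbor.
have [t [h1 h2]] := third_vertex q0.
have [a0 b0 ab F] := chart_tri fc q0 h1 h2.
by exists (f 0), (f q), (f t); split=> //; exact: nesym.
Qed.

Lemma face_le3 s : face Y s -> exists x y z, s `<=` [set x; y; z].
Proof.
move=> Ys; have [f [a [_ [fc af _ -> _]]]] := chart_two Ys Ys.
have [x [y [z [_ _ _ h]]]] := lface_triangle af.
exists (f x), (f y), (f z) => _ [p /h[]-> <-]; by [left; left|left; right|right].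
Qed.

End Atlas.

Section BuildingFacts.
Context (V : choiceType) (Y : complex V).
Hypothesis bY : building_of_type A2tilde Y.

Lemma A2_link v : exists t, gen_triangle (nb Y v) (tri Y v) t.
Proof. by have [charts [? ? ? ?]] := atlas bY; exact: (@link_gen_triangle _ _ charts). Qed.

Lemma A2_distance o : exists d : V -> nat, [/\
  forall v, d v = 0%N <-> v = o,
  forall u v, nb Y u v -> (d v <= (d u).+1)%N,
  forall v n, d v = n.+1 -> exists u, nb Y v u /\ d u = n,
  forall u v, nb Y u v -> d u = d v -> exists w, tri Y u v w /\ d u = (d w).+1 &
  forall v u1 u2, nb Y v u1 -> nb Y v u2 -> d v = (d u1).+1 -> d v = (d u2).+1 ->
    u1 <> u2 -> tri Y v u1 u2].
Proof. by have [charts [? ? ? ?]] := atlas bY; exact: (@building_distance _ _ charts). Qed.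

Lemma A2_triangle : exists x y z, [/\ x <> y, x <> z, y <> z & face Y [set x; y; z]].
Proof. by have [charts [? ? ? ?]] := atlas bY; exact: (@building_triangle _ _ charts). Qed.

Lemma A2_face_le3 s : face Y s -> exists x y z, s `<=` [set x; y; z].
Proof. by have [charts [? ? ? ?]] := atlas bY; exact: (@face_le3 _ _ charts). Qed.

End BuildingFacts.

(** * Points of the realization *)

Local Notation supp := Defs.support.

Section Points.
Context (R : realType).

Lemma affine_map_at (V V' : choiceType) (f : V -> V') (p : V -> R) v :
  (forall u, p u <> 0 -> f u = f v -> u = v) -> affine_map f p (f v) = p v.
Proof.
move=> h; rewrite /affine_map -(@fsbig_widen _ _ _ _ [set v]); first by rewrite fsbig_set1.
  by move=> u ->.
move=> u [/= fu uv]; apply: contrapT => pu; apply: uv; exact: h.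
Qed.

Lemma affine_map_off (V V' : choiceType) (f : V -> V') (p : V -> R) v' :
  ~ (f @` supp p) v' -> affine_map f p v' = 0.
Proof.
move=> h; rewrite /affine_map fsbig1 // => u /= fu; apply: contrapT => pu.
by apply: h; exists u.
Qed.

Lemma weights_point (V : choiceType) (X : complex V) s (w : V -> R) : face X s ->
  (forall v, s v -> 0 < w v) ->
  exists p c, [/\ points X p, supp p = s, c != 0 & forall v, s v -> p v = c * w v].
Proof.
move=> Xs w0; pose W := \sum_(v \in s) w v.
have sfin := face_finite Xs.
have W0 : 0 < W.
  have [v sv] := face_neq0 Xs.
  rewrite /W (fsbigD1 v) //; apply: ltr_pwDl; first exact: w0.
  by apply: fsumr_ge0 => u [/w0/ltW].
pose p v := if v \in s then W^-1 * w v else 0.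
have pE v : s v -> p v = W^-1 * w v by move=> sv; rewrite /p ifT // inE.
have p0 v : s v -> 0 < p v by move=> sv; rewrite pE // mulr_gt0 ?invr_gt0 ?w0.
have sp : supp p = s.
  apply/seteqP; split=> [v /= pv|v sv]; last by move=> e; have := p0 v sv; rewrite e ltxx.
  by apply: contrapT => nv; apply: pv; rewrite /p ifF //; apply/negbTE; rewrite notin_setE.
exists p, W^-1; split=> //; last by rewrite invr_eq0 gt_eqF.
split=> [v||]; rewrite ?sp //.
  have [sv|nv] := EM (s v); first exact/ltW/p0.
  by rewrite /p ifF //; apply/negbTE; rewrite notin_setE.
rewrite (eq_fsbigr (fun v => W^-1 * w v)); last by move=> v; rewrite inE => /pE.
by rewrite -mulr_fsumr // mulVf // gt_eqF.
Qed.

(** Distinct coordinates, obtained from the weights 1, 2, 3, ..., make each vertex recognizable from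
    the point. *)
Lemma generic_point (V : choiceType) (X : complex V) s : face X s ->
  exists p : V -> R, [/\ points X p, supp p = s &
    forall u v, s u -> s v -> p u = p v -> u = v].
Proof.
move=> Xs; have sfin := face_finite Xs.
have /finite_seqP[r sr] := sfin.
have [//|p [c [Xp ps c0 pw]]] := @weights_point _ X s (fun v => (index v r).+1%:R) Xs.
exists p; split=> // u v su sv; rewrite !pw // => /(mulfI c0)/eqP.
rewrite eqr_nat eqSS => /eqP e; rewrite sr in su sv.
by rewrite -(nth_index u su) e nth_index.
Qed.

Lemma barycenter (V : choiceType) (X : complex V) s : face X s ->
  exists (p : V -> R) c, [/\ points X p, supp p = s & forall v, s v -> p v = c].
Proof.
move=> Xs; have [//|p [c [Xp ps _ pw]]] := @weights_point _ X s (fun=> 1) Xs.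
by exists p, c; split=> // v /pw; rewrite mulr1.
Qed.

Lemma pair_point (V : choiceType) (X : complex V) u v (a : R) :
  face X [set u; v] -> u <> v -> 0 < a < 1 ->
  exists p, [/\ points X p, supp p = [set u; v], p u = a & p v = 1 - a].
Proof.
move=> F uv /andP[a0 a1].
pose w x : R := if x == u then a else if x == v then 1 - a else 0.
have wu : w u = a by rewrite /w eqxx.
have wv : w v = 1 - a by rewrite /w ifF ?eqxx //; apply/eqP => /esym.
have sw : supp w = [set u; v].
  apply/seteqP; split=> [x|x [] ->].
  - rewrite /Defs.support /w /=; case: eqP => [->|_]; first by left.
    by case: eqP => [->|_ //]; right.
  - by rewrite /Defs.support /= wu; apply/eqP; rewrite gt_eqF.
  - by rewrite /Defs.support /= wv; apply/eqP; rewrite gt_eqF // subr_gt0.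
exists w; split=> //; split=> [x||]; rewrite ?sw //.
  rewrite /w; case: eqP => _; first exact: ltW.
  by case: eqP => _ //; rewrite subr_ge0 ltW.
have disj : [set u] `&` [set v] `<=` set0 by move=> x [-> e]; apply: uv.
rewrite fsbigU0 //; rewrite !fsbig_set1 wu wv /=.
by rewrite addrC subrK.
Qed.

Lemma transport_point (V W : choiceType) (X : complex V) (Y : complex W) s t h
    (p : V -> R) :
  points X p -> supp p = s -> face Y t -> set_bij s t h ->
  exists q, [/\ points Y q, supp q = t & forall v, s v -> q (h v) = p v].
Proof.
move=> [p0 _ p1] sp Yt hb; have [hst h_inj h_surj] := hb.
have [k kP] : exists k : W -> V, forall w, t w -> s (k w) /\ h (k w) = w.
  have [v0 _] : s !=set0.
    by have [w /h_surj[v sv _]] := face_neq0 Yt; exists v.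
  have /choice[k kP] : forall w, exists v, t w -> s v /\ h v = w.
    move=> w; have [/h_surj[v sv <-]|nw] := EM (t w); first by exists v.
    by exists v0.
  by exists k.
pose q w := if w \in t then p (k w) else 0.
have qh v : s v -> q (h v) = p v.
  move=> sv; have th := hst _ sv.
  rewrite /q ifT ?inE //; congr p; have [sk hk] := kP _ th.
  by apply: h_inj; rewrite ?inE.
have sq : supp q = t.
  apply/seteqP; split=> [w /= qw|w tw].
    by apply: contrapT => nw; apply: qw; rewrite /q ifF //; apply/negbTE; rewrite notin_setE.
  have [v sv <-] := h_surj _ tw; rewrite /Defs.support /= qh //.
  by move: sv; rewrite -sp.
exists q; split=> //; split; rewrite ?sq //.
  move=> w; rewrite /q; case: ifP => // _; exact: p0.
rewrite -p1 sp (reindex_fsbig h s) //; apply: eq_fsbigr => v; rewrite inE; exact: qh.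
Qed.

End Points.


(** * Free actions on faces and vertices *)

Section Group.
Context (R : realType) (V : choiceType) (X : complex V) (G : set (V -> V)).
Hypothesis fG : free_cofinite_group R X G.

Lemma grp_id : G id. Proof. by case: fG => -[]. Qed.

Lemma grp_comp g h : G g -> G h -> G (g \o h).
Proof. by case: fG => -[_ c _ _] _ _; exact: c. Qed.

Lemma grp_inv g : G g -> exists h, [/\ G h, cancel g h & cancel h g].
Proof. by case: fG => -[_ _ c _] _ _; exact: c. Qed.

Lemma grp_inj g : G g -> injective g.
Proof. by move=> /grp_inv[h [_ gh _]]; exact: can_inj gh. Qed.

Lemma grp_face g s : G g -> face X s <-> face X (g @` s).
Proof. by case: fG => -[_ _ _ c] _ _ /c[]. Qed.

(** An element preserving a face fixes its barycenter. *)
Lemma grp_free_face g s : G g -> face X s -> g @` s = s -> g = id.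
Proof.
move=> Gg Xs gs; have [p [c [Xp sp pc]]] := barycenter R Xs.
have [_ free _] := fG; apply: (free g p Gg Xp); apply: funext => v.
have g_inj := grp_inj Gg; have [h [_ gh hg]] := grp_inv Gg.
rewrite -[v]hg affine_map_at; last by move=> u _ /g_inj.
have pn u : ~ s u -> p u = 0 by rewrite -sp => /contrapT.
have [su|nu] := EM (s (h v)).
  by rewrite !pc // -gs; exists (h v).
rewrite !pn // -{1}gs => -[u su /g_inj e]; apply: nu; by rewrite -e.
Qed.

Lemma grp_free g v : G g -> g v = v -> g = id.
Proof.
move=> Gg gv; apply: (grp_free_face Gg (face_vertex X v)).
by rewrite image_set1 gv.
Qed.

Lemma grp_eq g h v : G g -> G h -> g v = h v -> g = h.
Proof.
move=> Gg Gh e; have [k [Gk hk kh]] := grp_inv Gh.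
have : k \o g = id by apply: (@grp_free _ v); [exact: grp_comp|rewrite /= e hk].
by move=> kg; apply: funext => u; rewrite -[LHS]kh; congr h; have := congr1 (@^~ u) kg.
Qed.

Lemma grp_nb g v a : G g -> nb X v a -> nb X (g v) (g a).
Proof.
move=> Gg [av F]; split; first by move=> /(grp_inj Gg).
by have := (grp_face [set v; a] Gg).1 F; rewrite image_setU !image_set1.
Qed.

End Group.

(** Arithmetic separating the coordinates (1/3, 2/3) and (1/4, 3/4) of two points of an edge, in
    either order. *)
Lemma third_quarter (R : realType) :
  [/\ 0 < (3%:R^-1 : R) < 1, 0 < (4%:R^-1 : R) < 1, 4%:R^-1 <> 3%:R^-1 :> R,
    1 - 4%:R^-1 <> 3%:R^-1 :> R & 3%:R^-1 <> 0 :> R].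
Proof.
split; first [lra|by apply/andP; split; lra|by apply/eqP; lra|idtac].
Qed.

(** * Consequences of the axioms of an extension for faces *)

Section Extension.
Context (R : realType) (V V' : choiceType) (X : complex V) (G : set (V -> V)).
Context (X' : complex V') (G' : set (V' -> V')) (lam : V -> V').
Hypothesis ext : extension R X G X' G' lam.

Let gG := ext_group ext.
Let gG' := ext_group' ext.

(** If [lam] collapsed an edge, its points would have a common image and thus, by [ext_orbit], lie
    in one orbit of [G]; but elements of [G] preserve the set of coordinates of a point. *)
Lemma ext_inj s u v : face X s -> s u -> s v -> lam u = lam v -> u = v.
Proof.
move=> Xs su sv luv; apply: contrapT => uv.
have F : face X [set u; v].
  apply: face_sub Xs _ _; last by exists u; left.
  by move=> _ [] ->.
have cst (p : V -> R) : points X p -> supp p = [set u; v] -> p u + p v = 1 ->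
    affine_map lam p = (fun v' => if v' == lam u then 1 else 0).
  move=> Xp sp p1; apply: funext => v'; case: eqP => [->|nv'].
    rewrite /affine_map -(@fsbig_widen _ _ _ _ [set u; v]).
    - have disj : [set u] `&` [set v] `<=` set0 by move=> x [-> e]; apply: uv.
      by rewrite fsbigU0 //; rewrite !fsbig_set1.
    - by move=> x [] ->.
    - by move=> x [_ nx]; rewrite -sp in nx; exact: contrapT.
  by apply: affine_map_off => -[x]; rewrite sp => -[] -> e; apply: nv'; rewrite -e // luv.
have [h3 h4 h43 h143 h30] := third_quarter R.
have [p [Xp sp pu pv]] := pair_point F uv h3.
have [q [Xq sq qu qv]] := pair_point F uv h4.
have so : same_orbit G' (affine_map lam p) (affine_map lam q).
  exists id; first exact: (grp_id gG').
  rewrite !cst // ?pu ?pv ?qu ?qv ?(addrC _ (1 - _)) ?subrK //.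
  by apply: funext => v'; rewrite (@affine_map_at _ _ _ id) // => w _ ->.
have [g Gg gpq] := (ext_orbit ext Xp Xq).2 so.
have e : q (g u) = 3%:R^-1.
  by rewrite -gpq affine_map_at // => w _ /(grp_inj gG Gg).
have : [set u; v] (g u) by rewrite -sq /Defs.support /= e.
by case=> eg; move: e; rewrite eg ?qu ?qv.
Qed.

Lemma ext_affine (p : V -> R) v : points X p -> supp p v ->
  affine_map lam p (lam v) = p v.
Proof.
move=> [_ Xs _] sv; apply: affine_map_at => u su e.
exact: ext_inj Xs _ sv e.
Qed.

Lemma ext_affine_supp (p : V -> R) : points X p ->
  supp (affine_map lam p) = lam @` supp p.
Proof.
move=> Xp; apply/seteqP; split=> [v' h|_ [v sv <-]].
  by apply: contrapT => n; apply: h; exact: affine_map_off.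
by rewrite /Defs.support /= ext_affine.
Qed.

(** [h] carries a generic point of [s] to a point with image in the same orbit of [G']. The element
    of [G] relating the two points must induce [h], as the coordinates are distinct. *)
Lemma ext_lift s t h g' : face X s -> face X t -> set_bij s t h -> G' g' ->
  (forall v, s v -> lam (h v) = g' (lam v)) -> exists2 g, G g & forall v, s v -> g v = h v.
Proof.
move=> Xs Xt hb Gg' hl; have [hst h_inj h_surj] := hb.
have [p [Xp sp p_inj]] := generic_point R Xs.
have [q [Xq sq qh]] := transport_point Xp sp Xt hb.
have g'_inj := grp_inj gG' Gg'; have [k' [_ g'k k'g]] := grp_inv gG' Gg'.
have so : same_orbit G' (affine_map lam p) (affine_map lam q).
  exists g' => //; apply: funext => v'.
  have [[w tw <-]|nv'] := EM ((lam @` t) v').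
    have [v sv <-] := h_surj _ tw.
    rewrite hl // affine_map_at; last by move=> u _ /g'_inj.
    rewrite -hl // !ext_affine ?qh ?sp ?sq //; exact: hst.
  rewrite [RHS]affine_map_off ?sq //; apply: affine_map_off.
  rewrite ext_affine_supp // sp => -[_ [v sv <-] e]; apply: nv'; rewrite -e -hl //.
  by exists (h v) => //; exact: hst.
have [g Gg gpq] := (ext_orbit ext Xp Xq).2 so; exists g => // v sv.
have e : q (g v) = p v by rewrite -gpq affine_map_at // => w _ /(grp_inj gG Gg).
have : t (g v) by rewrite -sq /Defs.support /= e; rewrite -sp in sv.
move=> /h_surj[u su hu]; rewrite -hu; congr h; apply: p_inj => //.
by rewrite -e -hu qh.
Qed.

Lemma ext_equivariant_face s g : face X s -> G g ->
  exists2 g', G' g' & forall v, s v -> lam (g v) = g' (lam v).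
Proof.
move=> Xs Gg; have [p [Xp sp p_inj]] := generic_point R Xs.
have g_inj := grp_inj gG Gg; have Xt := (grp_face gG s Gg).1 Xs.
have hb : set_bij s (g @` s) g.
  by split; [move=> v sv; exists v|move=> u v _ _ /g_inj|].
have [q [Xq sq qh]] := transport_point Xp sp Xt hb.
have so : same_orbit G p q.
  exists g => //; apply: funext => v.
  have [h [_ gh hg]] := grp_inv gG Gg; rewrite -[v]hg affine_map_at; last by move=> u _ /g_inj.
  have [sv|nv] := EM (s (h v)); first by rewrite qh.
  have -> : p (h v) = 0 by apply: contrapT; move: nv; rewrite -sp.
  apply/esym; apply: contrapT => nq; have : (supp q) (g (h v)) by [].
  by rewrite sq => -[u su /g_inj e]; apply: nv; rewrite -e.
have [g' Gg' e] := (ext_orbit ext Xp Xq).1 so.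
exists g' => // v sv; have g'_inj := grp_inj gG' Gg'.
have [k' [_ g'k k'g]] := grp_inv gG' Gg'.
have tv : (g @` s) (g v) by exists v.
have qv : affine_map lam q (lam (g v)) = p v by rewrite ext_affine ?sq ?qh.
have pv : p v <> 0 by rewrite -sp in sv.
have lv : affine_map lam p (k' (lam (g v))) = p v.
  rewrite -qv -e -{2}[lam (g v)]k'g affine_map_at // => u _ /g'_inj //.
have : (lam @` supp p) (k' (lam (g v))) by rewrite -ext_affine_supp // /Defs.support /= lv.
case=> u su eu; have puv : p u = p v by rewrite -lv -eu ext_affine.
have suu : s u by rewrite -sp.
by rewrite -(p_inj _ _ suu sv puv) in eu *; rewrite eu k'g.
Qed.

(** The barycenter of [s'] lies either in the image of [lam] or in a translate of one of the open
    chambers, and its support is [s']. *)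
Lemma ext_image s' : face X' s' -> (exists2 s, face X s & lam @` s = s') \/ chamber X' s'.
Proof.
move=> Xs'; have [n [C [Cch _ _ cover]]] := ext_chambers ext.
have [p' [c [Xp' sp' _]]] := barycenter R Xs'.
have : points X' p' by [].
rewrite -cover => -[[p Xp e]|[i _ [g Gg [p [Xp sp] e]]]].
  left; exists (supp p); first by case: Xp.
  by rewrite -ext_affine_supp // e.
right; have g_inj := grp_inj gG' Gg.
have es : s' = g @` C i.
  rewrite -sp' -e -sp; apply/seteqP; split=> [v h|_ [v sv <-]].
    by apply: contrapT => nv; apply: h; exact: affine_map_off.
  by rewrite /Defs.support /= affine_map_at // => u _ /g_inj.
have [k [Gk gk kg]] := grp_inv gG' Gg.
split=> // t Xt st; have [_ mx] := Cch i.
have imk (t0 : set V') : g @` (k @` t0) = t0.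
  rewrite image_comp; apply/seteqP; split=> [_ [v tv <-]|v tv]; first by rewrite /= kg.
  by exists v => //=; rewrite kg.
rewrite es -(imk t); congr (_ @` _); apply: mx; first exact: ((grp_face gG' t Gk).1 Xt).
move=> v Cv; exists (g v); last by rewrite gk.
by apply: st; rewrite es; exists v.
Qed.

Lemma ext_missing s' : face X' s' -> ~ (exists2 s, face X s & lam @` s = s') ->
  missing_chamber R X X' lam s'.
Proof.
move=> Xs' ns'; split; first by case: (ext_image Xs').
move=> sub; have [p' [c [Xp' sp' _]]] := barycenter R Xs'.
have [|p Xp e] := sub p'; first by split=> //=; rewrite sp'.
by apply: ns'; exists (supp p); [case: Xp|rewrite -ext_affine_supp // e].
Qed.

End Extension.


(** A face lies entirely in [P] or entirely outside, so the points supported in [P] and those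
    supported outside form complementary open sets, which no path can connect. *)
Lemma path_connected_nb (R : realType) (V : choiceType) (X : complex V) (P : V -> Prop) :
  path_connected R X -> (forall x y, nb X x y -> P x -> P y) ->
  forall x y, P x -> P y.
Proof.
move=> pc Pnb x y Px.
have face_P s u v : face X s -> s u -> s v -> P u -> P v.
  move=> Xs su sv Pu; have [<-//|uv] := EM (u = v).
  apply: Pnb Pu; split; first exact: nesym.
  by apply: face_sub Xs _ _; [move=> _ [] ->|exists u; left].
pose U (Q : V -> Prop) : set (realization R X) := [set p | forall v, supp (sval p) v -> Q v].
have suppX (p : realization R X) : face X (supp (sval p)) by case: p => p [].
have openU (Q : V -> Prop) :
    (forall s u v, face X s -> s u -> s v -> Q u -> Q v) -> open (U Q).
  move=> faceQ; have : realization_open (U Q); last by [].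
  move=> s Xs p Up sp; exists 1 => // q sq _ v qv.
  have [u pu] := face_neq0 (suppX p).
  by apply: (faceQ s u v) => //; [exact: sp|exact: sq|exact: Up].
have oP := openU P face_P.
have oN : open (U (fun v => ~ P v)).
  by apply: openU => s u v Xs su sv nu Pv; apply: nu; exact: face_P Xs sv su Pv.
have vertex v : exists p : realization R X, supp (sval p) = [set v].
  have [p [c [Xp sp _]]] := barycenter R (face_vertex X v).
  by exists (exist _ p Xp).
have [p sp] := vertex x; have [q sq] := vertex y.
have [g [gcont g0 g1]] := pc p q.
have cI : connected (g @` `[0, 1]%classic).
  by apply: connected_continuous_connected gcont; exact: segment_connected.
have UC : U P = ~` U (fun v => ~ P v).
  apply/seteqP; split=> [r Ur nU|r nU v rv].
    by have [v rv] := face_neq0 (suppX r); exact: nU v rv (Ur v rv).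
  apply: contrapT => nPv; apply: nU => u ru Pu; apply: nPv.
  exact: face_P (suppX r) ru rv Pu.
have I0 : `[0, 1]%classic (0 : R) by rewrite /= in_itv /= lexx ler01.
have I1 : `[0, 1]%classic (1 : R) by rewrite /= in_itv /= lexx ler01.
have e : g @` `[0, 1]%classic `&` U P = g @` `[0, 1]%classic.
  apply: cI; last by exists (U P) => //; rewrite UC; exact: open_closedC.
    exists p; split; first by exists 0.
    by move=> v; rewrite sp => ->.
  by exists (U P).
have : (g @` `[0, 1]%classic `&` U P) q by rewrite e; exists 1.
by case=> _ /(_ y); apply; rewrite sq.
Qed.

(** * Simple connectedness of the building, in the form of a development *)

Local Close Scope ring_scope.

Lemma set3_rot (T : Type) (x y z : T) : [set y; z; x] = [set x; y; z].
Proof. by rewrite setUC setUA. Qed.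

Lemma tri_rot (V : choiceType) (Y : complex V) a b c :
  tri Y a b c -> tri Y b c a.
Proof.
by case=> ba ca bc F; split; [exact: nesym|exact: nesym|by []|rewrite set3_rot].
Qed.

Section Development.
Context (V : Type) (V' : choiceType) (Y : complex V') (d : V' -> nat).
Context (adj E : V -> V -> Prop) (lam : V -> V') (x0 : V).
Hypotheses (d0 : forall v, d v = 0 <-> v = lam x0)
  (d_nb : forall u v, nb Y u v -> d v <= (d u).+1)
  (d_pred : forall v n, d v = n.+1 -> exists u, nb Y v u /\ d u = n)
  (d_edge : forall u v, nb Y u v -> d u = d v ->
     exists w, tri Y u v w /\ d u = (d w).+1)
  (d_near : forall v u1 u2, nb Y v u1 -> nb Y v u2 -> d v = (d u1).+1 ->
     d v = (d u2).+1 -> u1 <> u2 -> tri Y v u1 u2).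
Hypotheses (adj_sym : forall x y, adj x y -> adj y x)
  (adj_nb : forall x y, adj x y -> nb Y (lam x) (lam y))
  (lift : forall x p, nb Y (lam x) p -> exists y, adj x y /\ lam y = p).
Hypotheses (Exx : forall x, E x x) (E_sym : forall x y, E x y -> E y x)
  (E_trans : forall x y z, E x y -> E y z -> E x z)
  (E_lift : forall x y x' y', E x y -> adj x x' -> adj y y' ->
     lam x' = lam y' -> E x' y')
  (E_tri : forall x y z z', adj x y -> adj y z -> adj x z' -> lam z = lam z' ->
     tri Y (lam x) (lam y) (lam z) -> E z z').

(* [geod n x]: some geodesic of length [n] from [lam x0] to [lam x] lifts to a
   path from [x0] to [x]. *)
Fixpoint geod n x := if n is n'.+1 then
  exists y, [/\ geod n' y, adj y x & d (lam x) = n] else x = x0.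

Lemma geodS n x : geod n.+1 x ->
  exists y, [/\ geod n y, adj y x & d (lam x) = n.+1].
Proof. by []. Qed.

Lemma geod_dist n x : geod n x -> d (lam x) = n.
Proof. by case: n => [->|n [y []]] //; exact/d0. Qed.

Lemma geod_lift n x p : geod n x -> nb Y (lam x) p -> d p = n.+1 ->
  exists y, [/\ geod n.+1 y, adj x y & lam y = p].
Proof.
move=> gx xp dp; have [y [xy yp]] := lift xp.
by exists y; split=> //; exists x; rewrite yp.
Qed.

Lemma geod_ex n p : d p = n -> exists x, geod n x /\ lam x = p.
Proof.
elim: n p => [|n IH] p dp; first by exists x0; split=> //; apply/esym/d0.
have [u [pu /IH[x [gx xu]]]] := d_pred dp.
have [|y [gy _ yp]] := geod_lift gx _ dp; first by rewrite xu; exact: nb_sym.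
by exists y.
Qed.

(** If the last steps start at different vertices, these span a triangle with the endpoint and, one
    step nearer to the base, another triangle with some [w]. Both are closed by [E_tri], and the
    induction hypothesis compares the geodesics through [w] with the given ones. *)
Lemma geod_uniq n x y : geod n x -> geod n y -> lam x = lam y -> E x y.
Proof.
elim: n x y => [|n IH] x y; first by move=> -> ->.
move=> /geodS[u1 [g1 a1 dx]] /geodS[u2 [g2 a2 dy]] xy.
have [u12|u12] := EM (lam u1 = lam u2); first exact: E_lift (IH _ _ g1 g2 u12) a1 a2 xy.
have b1 := nb_sym (adj_nb a1); have b2 := nb_sym (adj_nb a2).
have T : tri Y (lam x) (lam u1) (lam u2).
  by apply: d_near => //; [rewrite xy|rewrite (geod_dist g1)|rewrite (geod_dist g2)].
have T' := tri_rot T.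
have [w [Tw]] := d_edge (tri_nb T') (etrans (geod_dist g1) (esym (geod_dist g2))).
rewrite (geod_dist g1) => dw; case: n IH g1 g2 dx dy dw => [//|n] IH g1 g2 dx dy dw.
have [w' [gw ww]] := geod_ex (esym (succn_inj dw)).
have Tw' : tri Y w (lam u1) (lam u2) by do 2 apply: tri_rot.
have [|v1 [gv1 av1 lv1]] := geod_lift gw (p := lam u1) _ (geod_dist g1).
  by rewrite ww; exact: tri_nb Tw'.
have [|v2 [gv2 av2 lv2]] := geod_lift gw (p := lam u2) _ (geod_dist g2).
  by rewrite ww; exact: tri_nb (tri_sym Tw').
have [|z [az lz]] := lift (x := v1) (p := lam u2); first by rewrite lv1; exact: tri_nb T'.
have Ez : E z u2.
  apply: (E_trans (E_tri av1 az av2 _ _)); rewrite ?lz ?ww ?lv1 //.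
  exact: IH.
have [|x' [ax' lx']] := lift (x := v1) (p := lam x); first by rewrite lv1; exact: nb_sym b1.
have [|y' [ay' ly']] := lift (x := z) (p := lam x); first by rewrite lz xy; exact: nb_sym b2.
have e1 : E x x' by apply: E_lift (IH _ _ g1 gv1 (esym lv1)) a1 ax' (esym lx').
have e2 : E y' y by apply: E_lift Ez ay' a2 _; rewrite ly'.
apply: E_trans e1 (E_trans _ e2); apply: E_sym.
by apply: (E_tri az ay' ax'); rewrite ?ly' ?lx' ?lz ?lv1.
Qed.

(** Along an edge the distance rises, falls or stays; in the last case geodesics to both ends pass
    through the nearer vertex [w] given by [d_edge]. *)
Lemma develop_adj x x' :
  (forall y, geod (d (lam x)) y -> lam y = lam x -> E x y) -> adj x x' ->
  forall y, geod (d (lam x')) y -> lam y = lam x' -> E x' y.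
Proof.
move=> H xx' y' gy' ly'; have b := adj_nb xx'; have b' := nb_sym b.
have [h|h|h] := ltngtP (d (lam x)) (d (lam x')).
- have {}h : d (lam x') = (d (lam x)).+1 by apply/eqP; rewrite eqn_leq d_nb.
  have [y [gy ly]] := geod_ex (erefl (d (lam x))).
  have [|y'' [gy'' ay'' ly'']] := geod_lift (p := lam x') gy _ h; first by rewrite ly.
  apply: (E_trans (E_lift (H y gy ly) xx' ay'' (esym ly''))).
  by rewrite h in gy'; apply: (geod_uniq gy'' gy'); rewrite ly''.
- have {}h : d (lam x) = (d (lam x')).+1 by apply/eqP; rewrite eqn_leq d_nb.
  have [|y [gy ay ly]] := geod_lift (p := lam x) gy' _ h; first by rewrite ly'.
  by apply: (E_lift (H y _ ly) xx' (adj_sym ay)) => //; rewrite h.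
have [w [Tw dw]] := d_edge b h; have [w' [gw lw]] := geod_ex (erefl (d w)).
have Tw' : tri Y w (lam x) (lam x') by do 2 apply: tri_rot.
have [|y [gy ay ly]] := geod_lift (p := lam x) gw _ dw.
  by rewrite lw; exact: tri_nb Tw'.
have [||z' [gz' az' lz']] := geod_lift (p := lam x') gw.
- by rewrite lw; exact: tri_nb (tri_sym Tw').
- by rewrite -h.
have [|z [az lz]] := lift (x := y) (p := lam x'); first by rewrite ly.
have e1 : E x' z by apply: (E_lift (H y _ ly) xx' az) => //; rewrite dw.
apply: E_trans e1 (E_trans (E_tri ay az az' _ _) _); rewrite ?lz ?lw ?ly //.
by rewrite -h dw in gy'; apply: (geod_uniq gz' gy'); rewrite lz'.
Qed.

Hypothesis conn : forall P : V -> Prop, (forall x y, adj x y -> P x -> P y) ->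
  P x0 -> forall x, P x.

Theorem development x y : lam x = lam y -> E x y.
Proof.
move=> xy; have H : forall x y, geod (d (lam x)) y -> lam y = lam x -> E x y.
  apply: (@conn (fun x => forall y, geod (d (lam x)) y -> lam y = lam x -> E x y)).
    by move=> ? ? a H; exact: develop_adj H a.
  have -> : d (lam x0) = 0 by apply/d0.
  by move=> ? -> _.
have [z [gz lz]] := geod_ex (erefl (d (lam x))).
by apply: E_trans (H _ _ gz lz) (E_sym (H _ _ _ _)); rewrite -?xy.
Qed.
End Development.

(** * An extension as a covering *)

Local Open Scope card_scope.

Lemma card_set3_le (T : choiceType) (x y z : T) : [set x; y; z] #<= `I_3.
Proof.
pose f (n : nat) := match n with 0 => x | 1 => y | _ => z end.
have -> : [set x; y; z] = f @` `I_3; last exact: card_image_le.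
apply/seteqP; split=> [_ [[]|] ->|_ [[|[|[|n]]] h <-] //].
- by exists 0.
- by exists 1.
- by exists 2.
- by left; left.
- by left; right.
- by right.
Qed.

Lemma card_set3 (T : choiceType) (x y z : T) : x <> y -> x <> z -> y <> z ->
  [set x; y; z] #= `I_3.
Proof.
move=> xy xz yz.
pose f (n : nat) := match n with 0 => x | 1 => y | _ => z end.
have -> : [set x; y; z] = f @` `I_3.
  apply/seteqP; split=> [_ [[]|] ->|_ [[|[|[|n]]] h <-] //].
  - by exists 0.
  - by exists 1.
  - by exists 2.
  - by left; left.
  - by left; right.
  - by right.
apply: inj_card_eq => m n; rewrite !inE /=.
by case: m => [|[|[|m]]] // _; case: n => [|[|[|n]]] // _ /=; congruence.
Qed.

Lemma card_set2 (T : choiceType) (x y : T) : x <> y -> [set x; y] #= `I_2.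
Proof.
move=> xy; pose f (n : nat) := match n with 0 => x | _ => y end.
have -> : [set x; y] = f @` `I_2.
  apply/seteqP; split=> [_ [] ->|_ [[|[|n]] h <-] //].
  - by exists 0.
  - by exists 1.
  - by left.
  - by right.
apply: inj_card_eq => m n; rewrite !inE /=.
by case: m => [|[|m]] // _; case: n => [|[|n]] // _ /=; congruence.
Qed.

Lemma card3_elim (T : choiceType) (C : set T) : C #= `I_3 ->
  exists x y z, [/\ x <> y, x <> z, y <> z & C = [set x; y; z]].
Proof.
move=> /card_set_bijP[f [fC f_inj f_surj]].
have [x Cx fx] := f_surj 0 isT; have [y Cy fy] := f_surj 1 isT.
have [z Cz fz] := f_surj 2 isT.
exists x, y, z; split; try by move=> e; move: fx fy fz; rewrite ?e; congruence.
have inj u v : C u -> C v -> f u = f v -> u = v by move=> Cu Cv; apply: f_inj; rewrite inE.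
apply/seteqP; split=> [c Cc|_ [[]|] -> //].
case E: (f c) (fC c Cc) => [|[|[|n]]] // _.
- by left; left; apply: inj; rewrite ?fx.
- by left; right; apply: inj; rewrite ?fy.
- by right; apply: inj; rewrite ?fz.
Qed.

Lemma card3_third (T : choiceType) (C : set T) a b : C #= `I_3 -> C a -> C b ->
  a <> b -> exists c, [/\ c <> a, c <> b & C = [set a; b; c]].
Proof.
move=> /card3_elim[x [y [z [xy xz yz ->]]]] Ca Cb ab.
have key p q r : [set x; y; z] `<=` [set p; q; r] -> [set p; q; r] `<=` [set x; y; z] ->
   [set x; y; z] = [set p; q; r] by move=> *; apply/seteqP.
have [c [ca cb sub sub']] : exists c, [/\ c <> a, c <> b,
    [set x; y; z] `<=` [set a; b; c] & [set a; b; c] `<=` [set x; y; z]].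
  have aux c : [set x; y; z] c -> c <> a -> c <> b ->
      [\/ x = a, x = b | x = c] -> [\/ y = a, y = b | y = c] -> [\/ z = a, z = b | z = c] ->
      exists c, [/\ c <> a, c <> b,
        [set x; y; z] `<=` [set a; b; c] & [set a; b; c] `<=` [set x; y; z]].
    move=> Cc ca cb hx hy hz; exists c; split=> //; last by move=> _ [[]|] ->.
    have to p : [\/ p = a, p = b | p = c] -> [set a; b; c] p.
      by case=> ->; [left; left|left; right|right].
    by move=> _ [[]|] ->; exact: to.
  have Cx : [set x; y; z] x by left; left.
  have Cy : [set x; y; z] y by left; right.
  have Cz : [set x; y; z] z by right.
  case: Ca => [[]|] /= ea; case: Cb => [[]|] /= eb; subst; try congruence;
  first [by apply: (aux x) => //; by [exact: nesym|constructor 1|constructor 2|constructor 3]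
        |by apply: (aux y) => //; by [exact: nesym|constructor 1|constructor 2|constructor 3]
        |by apply: (aux z) => //; by [exact: nesym|constructor 1|constructor 2|constructor 3]].
by exists c; split=> //; exact: key.
Qed.

Section Covering.
Context (R : realType) (V V' : choiceType) (X : complex V) (G : set (V -> V)).
Context (X' : complex V') (G' : set (V' -> V')) (lam : V -> V').
Hypothesis ext : extension R X G X' G' lam.
Hypothesis bX' : building_of_type A2tilde X'.
Hypothesis conn : forall P : V -> Prop, (forall x y, nb X x y -> P x -> P y) ->
  forall x y, P x -> P y.
Hypothesis X_neq0 : exists x : V, True.

Let gG := ext_group ext.
Let gG' := ext_group' ext.

(** The building contains a triangle and no face with more than three vertices, which fixes the
    dimension left open in [ext_dim]. *)
Lemma ext_dim2 : [/\ homogeneous_dim X' 2, homogeneous_dim X 2 & no_boundary X 2].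
Proof.
have [d [h' h nob]] := ext_dim ext.
have [x [y [z [xy xz yz F]]]] := A2_triangle bX'.
have [c3 [C [CX _ cC]]] := h' _ F.
have [p [q [r Cpqr]]] := A2_face_le3 bX' CX.
suff -> : 2 = d by [].
apply/eqP; rewrite eqn_leq; apply/andP; split.
  by rewrite (card_le_eql (card_set3 xy xz yz)) card_le_II in c3.
have := card_le_trans (subset_card_le Cpqr) (card_set3_le p q r).
by rewrite (card_le_eql cC) card_le_II.
Qed.

(** Absence of boundary, in the form of [L_deg] for the links of [X]. *)
Lemma tri_third a b : nb X a b -> exists c d, [/\ c <> d, tri X a b c & tri X a b d].
Proof.
move=> [ba F]; have [_ h nob] := ext_dim2.
have [C [D [CD Cch Dch sC sD]]] := nob _ F (card_set2 (nesym ba)).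
have third E : chamber X E -> [set a; b] `<=` E ->
    exists c, tri X a b c /\ E = [set a; b; c].
  move=> [EX Emax] sE; have [_ [E' [E'X EE' cE']]] := h _ EX.
  have e := Emax _ E'X EE'; rewrite e in cE'.
  have [c [ca cb Ec]] := card3_third cE' (sE _ (or_introl erefl))
    (sE _ (or_intror erefl)) (nesym ba).
  by exists c; split=> //; split=> //; [exact: nesym|rewrite -Ec].
have [c [tc Ce]] := third C Cch sC; have [d [td De]] := third D Dch sD.
by exists c, d; split=> // cd; apply: CD; rewrite Ce De cd.
Qed.

Lemma ext_edge p q : face X' [set p; q] -> exists2 s, face X s & lam @` s = [set p; q].
Proof.
move=> F; case: (ext_image ext F) => // -[_ mx].
have [h' _ _] := ext_dim2; have [_ [C [CX sC cC]]] := h' _ F.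
have e := mx _ CX sC; rewrite e in cC.
have [x [y [z [xy xz yz E]]]] := card3_elim cC.
have m u : [set x; y; z] u -> u = p \/ u = q by rewrite -E => -[]; [left|right].
have [] := m x (or_introl (or_introl erefl)); have [] := m y (or_introl (or_intror erefl));
have [] := m z (or_intror erefl); congruence.
Qed.

Lemma ext_nb x y : nb X x y -> nb X' (lam x) (lam y).
Proof.
move=> [yx F]; split.
  by move=> e; apply: yx; apply: (ext_inj ext F) e; [right|left].
by have := ext_simplicial ext F; rewrite image_setU !image_set1.
Qed.

Lemma ext_tri x y z : tri X x y z -> tri X' (lam x) (lam y) (lam z).
Proof.
move=> [yx zx yz F].
have sx : [set x; y; z] x by left; left.
have sy : [set x; y; z] y by left; right.
have sz : [set x; y; z] z by right.
split; [by move=> /(ext_inj ext F sy sx)|by move=> /(ext_inj ext F sz sx)|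
  by move=> /(ext_inj ext F sy sz)|].
by have := ext_simplicial ext F; rewrite !image_setU !image_set1.
Qed.

(** Two edges at [v] with the same image are related by an element of [G] fixing [v], which is the
    identity. *)
Lemma ext_locally_inj v a a' : nb X v a -> nb X v a' -> lam a = lam a' -> a = a'.
Proof.
move=> [av F] [a'v F'] e.
pose h u := if u == v then v else a'.
have hv : h v = v by rewrite /h eqxx.
have ha : h a = a' by rewrite /h ifF //; apply/eqP.
have hb : set_bij [set v; a] [set v; a'] h.
  split=> [_ [] ->||_ [] ->] /=; rewrite ?hv ?ha; [by left|by right| | |].
  - move=> x y; rewrite !inE => -[] -> [] ->; rewrite ?hv ?ha // => e'; by case: a'v.
  - by exists v => //; left.
  - by exists a => //; right.
have [|g Gg gE] := ext_lift ext F F' hb (grp_id gG').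
  by move=> _ [] ->; rewrite ?hv ?ha.
have gid := grp_free gG Gg (etrans (gE v (or_introl erefl)) hv).
by rewrite -ha -gE; [rewrite gid|right].
Qed.

(** The elements of [G'] found on two edges with a common vertex agree there, hence coincide by
    freeness; connectedness does the rest. *)
Lemma ext_equivariant g : G g -> exists2 g', G' g' & forall v, lam (g v) = g' (lam v).
Proof.
move=> Gg; have [x _] := X_neq0.
have [g' Gg' g'E] := ext_equivariant_face ext (face_vertex X x) Gg.
exists g' => // v; apply: (conn (P := fun v => lam (g v) = g' (lam v))) (g'E x erefl).
move=> y z [_ F] e; have [g1 Gg1 g1E] := ext_equivariant_face ext F Gg.
have <- : g1 = g'.
  by apply: (grp_eq gG' (v := lam y)) => //; rewrite -e g1E //; left.
by rewrite g1E //; right.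
Qed.

Lemma ext_lift1 x y g' : G' g' -> lam y = g' (lam x) -> exists2 g, G g & g x = y.
Proof.
move=> Gg' e; have hb : set_bij [set x] [set y] (fun=> y).
  by split=> [_ _ //|u v /set_mem -> /set_mem -> //|_ ->]; exists x.
have [|g Gg gE] := ext_lift ext (face_vertex X x) (face_vertex X y) hb Gg'.
  by move=> _ ->.
by exists g => //; exact: gE.
Qed.

Lemma deck_transformation x y : lam x = lam y ->
  exists g, [/\ G g, g x = y & forall v, lam (g v) = lam v].
Proof.
move=> e; have [g Gg gx] := ext_lift1 (grp_id gG') (esym e).
exists g; split=> // v; have [g' Gg' g'E] := ext_equivariant Gg.
have g'id : g' = id by apply: (grp_free gG' Gg' (v := lam x)); rewrite -g'E gx.
by rewrite g'E g'id.
Qed.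

(** The edge is the image of a face of [X], which a deck transformation moves to [x]. *)
Lemma ext_lift_nb x p : nb X' (lam x) p -> exists y, nb X x y /\ lam y = p.
Proof.
move=> [px F]; have [s sX sE] := ext_edge F.
have [u su eu] : (lam @` s) (lam x) by rewrite sE; left.
have [w sw ew] : (lam @` s) p by rewrite sE; right.
have [g [Gg gu gl]] := deck_transformation eu.
exists (g w); split; last by rewrite gl.
split; first by move=> e; apply: px; rewrite -ew -(gl w) e.
apply: (face_sub ((grp_face gG s Gg).1 sX)); last by exists x; left.
by move=> _ [] ->; [exists u|exists w].
Qed.

Lemma ext_lift_tri v a b s : nb X v a -> nb X v b -> a <> b -> face X s ->
  lam @` s = [set lam v; lam a; lam b] -> tri X v a b.
Proof.
move=> va vb ab sX sE.
have [u su eu] : (lam @` s) (lam v) by rewrite sE; left; left.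
have [g [Gg gu gl]] := deck_transformation eu; have tX := (grp_face gG s Gg).1 sX.
have tv : (g @` s) v by exists u.
have mem w : nb X v w -> (lam @` s) (lam w) -> (g @` s) w.
  move=> vw [z sz ez]; have tz : (g @` s) (g z) by exists z.
  suff <- : g z = w by [].
  apply: ext_locally_inj (vw) _; last by rewrite gl ez.
  have [wv _] := ext_nb vw.
  split; first by move=> e; apply: wv; rewrite -ez -(gl z) e.
  by apply: face_sub tX _ _; [move=> _ [] ->|exists v; left].
have ta : (g @` s) a by apply: mem => //; rewrite sE; left; right.
have tb : (g @` s) b by apply: mem => //; rewrite sE; right.
have [av _] := va; have [bv _] := vb; split=> //.
by apply: face_sub tX _ _; [move=> _ [[]|] ->|exists v; left; left].
Qed.

Lemma ext_onto p : exists x, lam x = p.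
Proof.
have [|s sX sE] := @ext_edge p p; first by rewrite setUid; exact: face_vertex.
have [x _ xp] : (lam @` s) p by rewrite sE; left.
by exists x.
Qed.

Lemma ext_onto_group g' : G' g' -> exists2 g, G g & forall v, lam (g v) = g' (lam v).
Proof.
move=> Gg'; have [x _] := X_neq0; have [y ly] := ext_onto (g' (lam x)).
have [g Gg gx] := ext_lift1 Gg' ly; have [g1 Gg1 g1E] := ext_equivariant Gg.
have e : g1 = g' by apply: (grp_eq gG' (v := lam x)); rewrite // -g1E gx.
by exists g => // v; rewrite g1E e.
Qed.

(** The link of [lam v] pulled back to the neighbours of [v], on which [lam] is bijective. Thus
    links of different extensions live on the same set. *)
Definition link_rel v a b := [/\ nb X v a, nb X v b & tri X' (lam v) (lam a) (lam b)].

Lemma link_rel_gen v : exists t, gen_triangle (nb X v) (link_rel v) t.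
Proof.
have [t gt] := A2_link bX' (lam v); exists (t \o lam); split.
- by move=> x y [? ? /tri_sym]; split.
- by move=> x y [].
- by move=> x y [_ _ /(gt_type gt)].
- move=> x y vx vy xy txy.
  have [||||p [xp yp]] := @gt_join _ _ _ _ gt (lam x) (lam y).
  + exact: ext_nb.
  + exact: ext_nb.
  + by move=> /(ext_locally_inj vx vy).
  + by [].
  have [z [vz lz]] := ext_lift_nb (tri_nb (tri_sym xp)).
  by exists z; split; split; rewrite // lz.
move=> x y z w xy [vx vz xz] [vy _ yz] [_ vw xw] [_ _ yw].
apply: (ext_locally_inj vz vw); apply: (gt_uniq gt _ xz yz xw yw).
by move=> /(ext_locally_inj vx vy).
Qed.

End Covering.

(** * Missing chambers *)

Lemma pigeonhole3 (T : Type) (x y z a b c d : T) :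
  [set x; y; z] a -> [set x; y; z] b -> [set x; y; z] c -> [set x; y; z] d ->
  [\/ a = b \/ a = c, a = d \/ b = c | b = d \/ c = d].
Proof.
by move=> [[]|] -> [[]|] -> [[]|] -> [[]|] ->;
  first [by constructor 1; left|by constructor 1; right|by constructor 2; left
  |by constructor 2; right|by constructor 3; left|by constructor 3; right].
Qed.

Section Missing.
Context (R : realType) (V V' : choiceType) (X : complex V) (G : set (V -> V)).
Context (X' : complex V') (G' : set (V' -> V')) (lam : V -> V').
Hypothesis ext : extension R X G X' G' lam.
Hypothesis bX' : building_of_type A2tilde X'.
Hypothesis conn : forall P : V -> Prop, (forall x y, nb X x y -> P x -> P y) ->
  forall x y, P x -> P y.
Hypothesis X_neq0 : exists x : V, True.
Hypothesis far : forall C D : set V',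
  missing_chamber R X X' lam C -> missing_chamber R X X' lam D ->
  face_orbit G' C <> face_orbit G' D ->
  forall n : nat, is_distance X' C D n -> (2 <= n)%N.

Let gG' := ext_group' ext.

Definition missing p q r :=
  tri X' p q r /\ ~ (exists2 s, face X s & lam @` s = [set p; q; r]).

Lemma missing_rot p q r : missing p q r -> missing q r p.
Proof.
move=> [t n]; split; first exact: tri_rot.
by rewrite set3_rot.
Qed.

(** Chambers sharing a vertex are at distance 0, so [far] puts them in one orbit. *)
Lemma missing_orbit p C D : missing_chamber R X X' lam C ->
  missing_chamber R X X' lam D -> C p -> D p -> exists2 g, G' g & g @` C = D.
Proof.
move=> mC mD Cp Dp.
have [e|ne] := EM (face_orbit G' C = face_orbit G' D).
  have : face_orbit G' D D by exists id; [exact: (grp_id gG')|rewrite image_id].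
  by rewrite -e => -[g Gg gE]; exists g.
have : is_distance X' C D 0 by split=> //; exists (fun=> p).
by move=> /(far mC mD ne).
Qed.

Lemma missing_in_orbit p q r p' q' r' : missing p q r -> missing p' q' r' ->
  p = p' -> exists2 g, G' g & g @` [set p; q; r] = [set p'; q'; r'].
Proof.
move=> [[_ _ _ F] n] [[_ _ _ F'] n'] pp; apply: (@missing_orbit p).
- exact: (ext_missing ext F n).
- exact: (ext_missing ext F' n').
- by left; left.
- by left; left.
Qed.

Let A := link_rel X X' lam.

Lemma link_missing v a b : A v a b -> ~ tri X v a b -> missing (lam v) (lam a) (lam b).
Proof.
move=> [va vb T] nT; split=> // -[s sX sE]; apply: nT.
apply: (ext_lift_tri ext conn X_neq0 va vb _ sX sE) => e.
by case: T => _ _ /(_ (congr1 lam e)).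
Qed.

(* The missing chambers around a vertex form one orbit, so freeness matches them
   with distinct vertices of one of them. *)
Lemma link_missing_four v t : gen_triangle (nb X v) (A v) t ->
  let M a b := A v a b /\ ~ tri X v a b in
  forall p1 l1 p2 l2 p3 l3 p4 l4, M p1 l1 -> M p2 l2 -> M p3 l3 -> M p4 l4 ->
  t p1 = t p2 -> t p1 = t p3 -> t p1 = t p4 ->
  [\/ (p1, l1) = (p2, l2) \/ (p1, l1) = (p3, l3),
      (p1, l1) = (p4, l4) \/ (p2, l2) = (p3, l3)
    | (p2, l2) = (p4, l4) \/ (p3, l3) = (p4, l4)].
Proof.
move=> gt M p1 l1 p2 l2 p3 l3 p4 l4 M1 M2 M3 M4 t12 t13 t14.
pose D p l := [set lam v; lam p; lam l].
have vtx p l : M p l -> exists g w, [/\ G' g, D p1 l1 w, g w = lam v & g @` D p1 l1 = D p l].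
  move=> [a na]; have [g Gg gE] :=
    missing_in_orbit (link_missing M1.1 M1.2) (link_missing a na) erefl.
  have [w Dw gw] : (g @` D p1 l1) (lam v) by rewrite /D gE; left; left.
  by exists g, w.
have uniq p l p' l' g g' w : M p l -> M p' l' -> t p = t p' -> G' g -> G' g' ->
    g w = lam v -> g' w = lam v -> g @` D p1 l1 = D p l -> g' @` D p1 l1 = D p' l' ->
    (p, l) = (p', l').
  move=> [Apl _] [Apl' _] tt Gg Gg' gw gw' e e'.
  have gg : g = g' by apply: (grp_eq gG' (v := w)); rewrite // gw.
  have DD : D p l = D p' l' by rewrite -e -e' gg.
  have [vp vl [pv lv pl _]] := Apl; have [vp' vl' [pv' lv' pl' _]] := Apl'.
  have tpl := gt_type gt Apl; have tpl' := gt_type gt Apl'.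
  have linj := ext_locally_inj ext.
  have ep : p = p'.
    have : D p' l' (lam p) by rewrite -DD; left; right.
    case=> [[//|]|] /= h; first exact: linj vp vp' h.
    by case: tpl'; rewrite -tt (linj _ _ _ vp vl' h).
  have el : l = l'.
    have : D p' l' (lam l) by rewrite -DD; right.
    case=> [[//|]|] /= h; last exact: linj vl vl' h.
    by case: tpl; rewrite tt (linj _ _ _ vl vp' h).
  by rewrite ep el.
have [g1 [w1 [G1 D1 gw1 e1]]] := vtx _ _ M1; have [g2 [w2 [G2 D2 gw2 e2]]] := vtx _ _ M2.
have [g3 [w3 [G3 D3 gw3 e3]]] := vtx _ _ M3; have [g4 [w4 [G4 D4 gw4 e4]]] := vtx _ _ M4.
have t23 := etrans (esym t12) t13; have t24 := etrans (esym t12) t14.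
have t34 := etrans (esym t13) t14.
case: (pigeonhole3 D1 D2 D3 D4) => -[] w; subst.
- by constructor 1; left; exact: uniq M1 M2 t12 G1 G2 gw1 gw2 e1 e2.
- by constructor 1; right; exact: uniq M1 M3 t13 G1 G3 gw1 gw3 e1 e3.
- by constructor 2; left; exact: uniq M1 M4 t14 G1 G4 gw1 gw4 e1 e4.
- by constructor 2; right; exact: uniq M2 M3 t23 G2 G3 gw2 gw3 e2 e3.
- by constructor 3; left; exact: uniq M2 M4 t24 G2 G4 gw2 gw4 e2 e4.
- by constructor 3; right; exact: uniq M3 M4 t34 G3 G4 gw3 gw4 e3 e4.
Qed.

(* An edge shared by two missing chambers yields an element of the group carrying
   one vertex of [x y z] to the next one, twice in a row. *)
Lemma edge_rotation x y z p : missing x y z -> missing x y p -> p <> z ->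
  (exists2 k, G' k & k x = y /\ k y = z) \/ (exists2 k, G' k & k z = x /\ k x = y).
Proof.
move=> mz mp pz; have [g Gg gE] := missing_in_orbit mz mp erefl.
have [k [Gk gk kg]] := grp_inv gG' Gg.
have mem u : [set x; y; p] u -> [set x; y; z] (k u).
  by rewrite -gE => -[w Cw <-]; rewrite gk.
have [[yx zx yz F] _] := mz.
have k1 w : k w = w -> False.
  move=> /(grp_free gG' Gk) e; apply: pz.
  have : [set x; y; z] p by have := mem p (or_intror erefl); rewrite e.
  by case=> [[]|] // e'; have [[yx' px yp _] _] := mp; [case: px|case: yp].
have k_inj := grp_inj gG' Gk.
have [] := mem x (or_introl (or_introl erefl)); last first.
  move=> /= kx; right; have [h [Gh kh hk]] := grp_inv gG' Gk; exists h => //.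
  rewrite -kx kh; split=> //.
  have [[]|] := mem y (or_introl (or_intror erefl)) => /= ky.
  - by rewrite -ky kh.
  - by case: (k1 y).
  - by case: yx; apply: k_inj; rewrite ky.
case=> [/k1 //|/= kx]; left; exists k => //; split=> //.
have [[]|] := mem y (or_introl (or_intror erefl)) => //= ky; last by case: (k1 y).
(* Here [k] would exchange [x] and [y], thus preserve an edge, against freeness. *)
exfalso; apply: (k1 x); suff -> : k = id by [].
have Fxy : face X' [set x; y].
  by apply: face_sub F _ _; [move=> u; left|exists x; left].
apply: (grp_free_face gG' Gk Fxy); rewrite image_setU !image_set1 kx ky.
exact: setUC.
Qed.

Definition lonely p q r := forall u, missing p q u -> u = r.

(* If all three edges were shared, two of the elements given by [edge_rotation]
   would agree at a vertex, hence be equal and rotate the chamber. *)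
Lemma missing_lonely x y z : missing x y z ->
  [\/ lonely x y z, lonely y z x | lonely z x y].
Proof.
move=> m; have m1 := missing_rot m; have m2 := missing_rot m1.
have rot a b c k h : missing a b c -> G' k -> G' h -> k a = b -> k b = c -> h b = c ->
    h c = a -> False.
  move=> mm Gk Gh ka kb hb hc; have e : k = h by apply: (grp_eq gG' (v := b)); rewrite // kb.
  have [[ba _ _ F] _] := mm; apply: ba; rewrite -ka.
  have -> // : k = id; apply: (grp_free_face gG' Gk F).
  rewrite !image_setU !image_set1 ka kb e hc.
  exact: set3_rot.
apply: contrapT => no.
have ex a b c : missing a b c -> ~ lonely a b c ->
    (exists2 k, G' k & k a = b /\ k b = c) \/ (exists2 k, G' k & k c = a /\ k a = b).
  move=> mm nl; have [u [mu uc]] : exists u, missing a b u /\ u <> c.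
    apply: contrapT => h; apply: nl => u mu; apply: contrapT => uc.
    by apply: h; exists u.
  exact: edge_rotation mm mu uc.
have r1 := ex _ _ _ m (fun h => no (Or31 _ _ h)).
have r2 := ex _ _ _ m1 (fun h => no (Or32 _ _ h)).
have r3 := ex _ _ _ m2 (fun h => no (Or33 _ _ h)).
case: r1 => -[k Gk [ka kb]]; case: r2 => -[h Gh [ha hb]].
- exact: rot m Gk Gh ka kb ha hb.
- case: r3 => -[j Gj [ja jb]].
  + exact: rot m2 Gj Gk ja jb ka kb.
  + exact: rot m Gk Gj ka kb ja jb.
- exact: rot m1 Gh Gk ha hb ka kb.
- exact: rot m2 Gk Gh ka kb ha hb.
Qed.

End Missing.

(** * Comparison of two extensions *)

Section Compare.
Context (R : realType) (V V1 V2 : choiceType) (X : complex V) (G : set (V -> V)).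
Context (X1 : complex V1) (G1 : set (V1 -> V1)) (lam1 : V -> V1).
Context (X2 : complex V2) (G2 : set (V2 -> V2)) (lam2 : V -> V2).
Hypotheses (ext1 : extension R X G X1 G1 lam1) (ext2 : extension R X G X2 G2 lam2).
Hypotheses (b1 : building_of_type A2tilde X1) (b2 : building_of_type A2tilde X2).
Hypothesis conn : forall P : V -> Prop, (forall x y, nb X x y -> P x -> P y) ->
  forall x y, P x -> P y.
Hypothesis X_neq0 : exists x : V, True.

(** Both images are compared, so that the element of [G] carrying [x] to [y] is a deck
    transformation for both maps and identifies the lifts of edges at [x] and [y]. *)
Definition same_image x y := lam1 x = lam1 y /\ lam2 x = lam2 y.

Lemma same_image_lift x y x' y' : same_image x y -> nb X x x' -> nb X y y' ->
  lam1 x' = lam1 y' -> same_image x' y'.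
Proof.
move=> [e1 e2] xx' yy' e'; have [g [Gg gx gl]] := deck_transformation ext1 conn X_neq0 e1.
have [g2 Gg2 g2E] := ext_equivariant ext2 conn X_neq0 Gg.
have g2id : g2 = id.
  by apply: (grp_free (ext_group' ext2) Gg2 (v := lam2 x)); rewrite -g2E gx.
suff <- : g x' = y' by split; rewrite ?gl // g2E g2id.
apply: (ext_locally_inj ext1) yy' _; last by rewrite gl.
by rewrite -gx; exact: (grp_nb (ext_group ext1)).
Qed.

Lemma kernel_le (tri12 : forall x y z z', nb X x y -> nb X y z -> nb X x z' ->
    lam1 z = lam1 z' -> tri X1 (lam1 x) (lam1 y) (lam1 z) -> lam2 z = lam2 z') x y :
  lam1 x = lam1 y -> lam2 x = lam2 y.
Proof.
have [x0 _] := X_neq0; have [d [d0 dnb dpred dedge dnear]] := A2_distance b1 (lam1 x0).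
move=> e; suff [] : same_image x y by [].
apply: (@development _ _ X1 d (nb X) same_image lam1 x0) e => //.
- exact: nb_sym.
- by move=> ? ?; exact: (ext_nb ext1).
- by move=> ? ? h; exact: (ext_lift_nb ext1 b1 conn X_neq0 h).
- by move=> ? ? [].
- by move=> a b c [h1 h2] [h3 h4]; split; congruence.
- exact: same_image_lift.
- by move=> a b c c' ab bc ac' cc' t; split=> //; exact: tri12 ab bc ac' cc' t.
- by move=> P h Px0 z; exact: conn Px0.
Qed.

(** Images of faces of [X] transfer because [theta] commutes with the two maps; a missing chamber
    transfers through its corner at one vertex, by [link12]. *)
Lemma transfer_face (theta : V1 -> V2) (th : forall x, theta (lam1 x) = lam2 x)
    (link12 : forall v a b, link_rel X X1 lam1 v a b -> link_rel X X2 lam2 v a b) s :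
  face X1 s -> face X2 (theta @` s).
Proof.
move=> F; case: (ext_image ext1 F) => [[t tX <-]|[_ mx]].
  have -> : theta @` (lam1 @` t) = lam2 @` t.
    by rewrite image_comp; apply: eq_imagel => x _ /=.
  exact: ext_simplicial ext2 _ tX.
have [h _ _] := ext_dim2 ext1 b1; have [_ [C [CX sC cC]]] := h _ F.
have e := mx _ CX sC; subst C.
have [p [q [r [pq pr qr sE]]]] := card3_elim cC.
have [v lv] := ext_onto ext1 b1 p; subst p.
have [|a [va la]] := ext_lift_nb ext1 b1 conn X_neq0 (x := v) (p := q).
  split; first exact: nesym.
  by apply: face_sub F _ _; [rewrite sE; left|exists q; right].
have [|b [vb lb]] := ext_lift_nb ext1 b1 conn X_neq0 (x := v) (p := r).
  split; first exact: nesym.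
  by apply: face_sub F _ _; [rewrite sE => _ [] ->; [left; left|right]|exists r; right].
have [|_ _ [_ _ _]] := link12 v a b.
  split=> //; rewrite la lb; split=> //; try exact: nesym.
  by rewrite -sE.
by rewrite sE !image_setU !image_set1 -la -lb !th.
Qed.

Lemma theta_equivariant (theta : V1 -> V2) (th : forall x, theta (lam1 x) = lam2 x) g1 :
  G1 g1 -> exists2 g2, G2 g2 & theta \o g1 = g2 \o theta.
Proof.
move=> Gg1; have [g Gg gE] := ext_onto_group ext1 b1 conn X_neq0 Gg1.
have [g2 Gg2 g2E] := ext_equivariant ext2 conn X_neq0 Gg.
exists g2 => //; apply: funext => p; have [x <-] := ext_onto ext1 b1 p.
by rewrite /= -gE !th g2E.
Qed.

End Compare.

(** * Coincidence of links, fibres and extensions *)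

Section Uniqueness.
Context (R : realType) (V V' V'' : choiceType) (X : complex V) (G : set (V -> V)).
Context (X' : complex V') (G' : set (V' -> V')) (lam : V -> V').
Context (X'' : complex V'') (G'' : set (V'' -> V'')) (mu : V -> V'').
Hypotheses (ext : extension R X G X' G' lam) (ext2 : extension R X G X'' G'' mu).
Hypotheses (bX' : building_of_type A2tilde X') (bX'' : building_of_type A2tilde X'').
Hypothesis conn : forall P : V -> Prop, (forall x y, nb X x y -> P x -> P y) ->
  forall x y, P x -> P y.
Hypothesis X_neq0 : exists x : V, True.
Hypothesis far : forall C D : set V',
  missing_chamber R X X' lam C -> missing_chamber R X X' lam D ->
  face_orbit G' C <> face_orbit G' D ->
  forall n : nat, is_distance X' C D n -> (2 <= n)%N.

Lemma link_same v a b : link_rel X X' lam v a b <-> link_rel X X'' mu v a b.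
Proof.
have [t gA] := link_rel_gen ext bX' conn X_neq0 v.
have [s gB] := link_rel_gen ext2 bX'' conn X_neq0 v.
apply: (@link_unique _ (nb X v) (tri X v) _ _ t s gA gB).
- move=> x y T; split; [exact: tri_nb T|exact: tri_nb (tri_sym T)|exact: ext_tri ext _ _ _ T].
- move=> x y T; split; [exact: tri_nb T|exact: tri_nb (tri_sym T)|exact: ext_tri ext2 _ _ _ T].
- by move=> x y; exact: tri_sym.
- by move=> x vx; have [c [d [cd tc td]]] := tri_third ext bX' vx; exists c, d.
- exact: (link_missing_four ext conn X_neq0 far gA).
Qed.

(* The boundary of a missing chamber closes up in both extensions: the corners
   at both ends of an edge lying in no other missing chamber are corners of
   the same missing chamber of the second extension. *)
Lemma lonely_closes a b c c' : nb X a b -> nb X b c -> nb X a c' -> lam c = lam c' ->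
  missing X X' lam (lam a) (lam b) (lam c) -> lonely X X' lam (lam a) (lam b) (lam c) ->
  mu c = mu c'.
Proof.
move=> ab bc ac' cc' m l; have [T nim] := m.
have Lb : link_rel X X' lam b a c by split=> //; [exact: nb_sym|exact: tri_sym (tri_rot T)].
have [_ _ Tb] := (link_same b a c).1 Lb.
have Ta := tri_sym (tri_rot Tb).
have [d [ad md]] := ext_lift_nb ext2 bX'' conn X_neq0 (tri_nb (tri_sym Ta)).
have La : link_rel X X'' mu a b d by split=> //; rewrite md.
have La' := (link_same a b d).2 La; have [_ _ Td] := La'.
have md' : missing X X' lam (lam a) (lam b) (lam d).
  apply: (link_missing ext conn X_neq0) La' _ => tX.
  have bd := tri_nb (tri_rot tX).
  have e : d = c by apply: (ext_locally_inj ext2) bd bc md.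
  apply: nim; exists [set a; b; c]; first by rewrite -e; case: tX.
  by rewrite !image_setU !image_set1.
have e : d = c' by apply: (ext_locally_inj ext) ad ac' _; rewrite (l _ md').
by rewrite -md e.
Qed.

(** The image of a face lifts by [ext_lift_tri]. For a missing chamber any of the three edges may be
    the lonely one; the path is then restarted at another vertex and [same_image_lift] carries the
    conclusion back to [z] and [z']. *)
Lemma triangle_closes x y z z' : nb X x y -> nb X y z -> nb X x z' -> lam z = lam z' ->
  tri X' (lam x) (lam y) (lam z) -> mu z = mu z'.
Proof.
move=> xy yz xz' zz' T.
have xz : x <> z by move=> e; case: T => _ /(_ (congr1 lam (esym e))).
have [[s sX sE]|nim] := EM (exists2 s, face X s & lam @` s = [set lam x; lam y; lam z]).
  have tX : tri X y z x.
    apply: (ext_lift_tri ext conn X_neq0 yz (nb_sym xy) (nesym xz) sX).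
    by rewrite sE [RHS]set3_rot.
  by rewrite (ext_locally_inj ext (tri_nb (tri_sym (tri_rot (tri_rot tX)))) xz' zz').
have m : missing X X' lam (lam x) (lam y) (lam z) by [].
have sym p q r : missing X X' lam p q r -> missing X X' lam q p r.
  move=> [t n]; split; first exact: tri_sym (tri_rot t).
  by move=> [s sX sE]; apply: n; exists s => //; rewrite sE (setUC [set q]).
have [l|l|l] := missing_lonely ext far m.
- exact: lonely_closes xy yz xz' zz' m l.
- have zy := nb_sym yz.
  have [|x'' [zx'' lx'']] := ext_lift_nb ext bX' conn X_neq0 (x := z) (p := lam x).
    exact: tri_nb (tri_rot (tri_rot T)).
  have e : mu x = mu x''.
    apply: (lonely_closes zy (nb_sym xy) zx'' (esym lx'')).
      by apply: sym; exact: missing_rot.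
    by move=> u /sym /l.
  have [_ //] : same_image lam mu z z'.
  by apply: (same_image_lift ext ext2 conn X_neq0) (nb_sym zx'') xz' zz'.
have [|y'' [zy'' ly'']] := ext_lift_nb ext bX' conn X_neq0 (x := z') (p := lam y).
  by rewrite -zz'; exact: tri_nb (tri_sym (tri_rot (tri_rot T))).
have e : mu y'' = mu y.
  apply: (lonely_closes xz' zy'' xy ly''); rewrite -zz' ly''.
    by apply: sym; exact: missing_rot (missing_rot m).
  by move=> u /sym /l.
have [_ //] : same_image lam mu z z'.
apply: (same_image_lift (x := y) (y := y'') ext ext2 conn X_neq0) yz (nb_sym zy'') zz'.
by split.
Qed.

(** Since [far] speaks of [lam] only, this is reduced to [triangle_closes]: equality of links makes
    the triangle one of [X'], whose third side lifts to [z2], and local injectivity of [mu] gives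
    [z2 = z']. *)
Lemma triangle_closes' x y z z' : nb X x y -> nb X y z -> nb X x z' -> mu z = mu z' ->
  tri X'' (mu x) (mu y) (mu z) -> lam z = lam z'.
Proof.
move=> xy yz xz' zz' T.
have [|_ _ T'] := (link_same y z x).2.
  by split; [exact: yz|exact: nb_sym|exact: tri_rot].
have Txyz := tri_rot (tri_rot T').
have [z2 [xz2 lz2]] := ext_lift_nb ext bX' conn X_neq0 (tri_nb (tri_sym Txyz)).
have e := triangle_closes xy yz xz2 (esym lz2) Txyz.
by rewrite -lz2 (ext_locally_inj ext2 xz2 xz') // -e zz'.
Qed.

Lemma same_kernel x y : lam x = lam y <-> mu x = mu y.
Proof.
split.
  exact: (kernel_le ext ext2 bX' conn X_neq0 triangle_closes).
exact: (kernel_le ext2 ext bX'' conn X_neq0 triangle_closes').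
Qed.

Lemma extension_unique : isomorphic_extensions X G X' G' lam X G X'' G'' mu.
Proof.
have [f fP] := choice (ext_onto ext bX'); have [f' f'P] := choice (ext_onto ext2 bX'').
(* The preimages are arbitrary; [same_kernel] makes the result independent of them. *)
pose th p := mu (f p); pose th' q := lam (f' q).
have thE x : th (lam x) = mu x by apply/same_kernel; rewrite fP.
have th'E x : th' (mu x) = lam x by apply/same_kernel; rewrite f'P.
have thK : cancel th th' by move=> p; rewrite -(fP p) thE th'E.
have th'K : cancel th' th by move=> q; rewrite -(f'P q) th'E thE.
have fwd := transfer_face ext ext2 bX' conn X_neq0 thE (fun v a b => (link_same v a b).1).
have bwd := transfer_face ext2 ext bX'' conn X_neq0 th'E (fun v a b => (link_same v a b).2).
exists id, th; split.
- split; first by split; [exists id|move=> s; rewrite image_id].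
  by split=> g Gg; exists g.
- split; first split; first by exists th'.
    move=> s; split; first exact: fwd.
    move=> /bwd; rewrite image_comp; congr (face X' _).
    by rewrite -[RHS]image_id; apply: eq_imagel => p _ /=; rewrite thK.
  split; first exact: theta_equivariant ext ext2 bX' conn X_neq0 _ thE.
  move=> g2 Gg2.
  have [g1 Gg1 e] := theta_equivariant ext2 ext bX'' conn X_neq0 th'E Gg2.
  exists g1 => //; apply: funext => p /=.
  by have := congr1 (@^~ (th p)) e; rewrite /= thK => <-; rewrite th'K.
by apply: funext => x /=; rewrite thE.
Qed.

End Uniqueness.

Theorem theorem0p4 (R : realType) (V : choiceType) (X : complex V)
    (Gamma : set (V -> V))
    (V' : choiceType) (X' : complex V') (Gamma' : set (V' -> V'))
    (lambda : V -> V')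
    (X_missing : euclidean_missing_A2tilde R X Gamma)
    (lambda_ext : extension R X Gamma X' Gamma' lambda)
    (X'_A2tilde : building_of_type A2tilde X')
    (far : forall C D : set V',
       missing_chamber R X X' lambda C -> missing_chamber R X X' lambda D ->
       face_orbit Gamma' C <> face_orbit Gamma' D ->
       forall n : nat, is_distance X' C D n -> (2 <= n)%N)
    (V'' : choiceType) (X'' : complex V'') (Gamma'' : set (V'' -> V''))
    (mu : V -> V'')
    (mu_ext : extension R X Gamma X'' Gamma'' mu)
    (X''_A2tilde : building_of_type A2tilde X'') :
  isomorphic_extensions X Gamma X' Gamma' lambda X Gamma X'' Gamma'' mu.
Proof.
have [[[p [_ Fp _]] pc _] _] := X_missing.
have X_neq0 : exists x : V, True by have [x _] := face_neq0 Fp; exists x.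
have conn (P : V -> Prop) (h : forall x y, nb X x y -> P x -> P y) x y : P x -> P y.
  exact: path_connected_nb pc h x y.
exact: extension_unique lambda_ext mu_ext X'_A2tilde X''_A2tilde conn X_neq0 far.
Qed.
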